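(* Let $0\le k\le n$, $n\ge 1$, and write $G_\lambda(\bar x)=G_\lambda(\bar x;1,\ldots,1)$ for the dual Grothendieck polynomials with all secondary variables set to $1$. For Young diagrams $\lambda,\mu$ in the $k\times(n-k)$ rectangle, let $c_{\lambda,\mu}^{\,\,\nu}$ be the coefficients defined by the identity in $K(Gr(k,n))$ $$G_\lambda(\bar x)\,G_\mu(\bar x)=\sum_\nu c_{\lambda,\mu}^{\,\,\nu}\,G_\nu(\bar x),$$ where $\nu$ runs over Young diagrams in the $k\times(n-k)$ rectangle. Then for all such $\lambda,\mu,\nu$, $c_{\lambda,\mu}^{\,\,\nu}$ equals $(-1)^{|\lambda|+|\mu|-|\nu|-k(n-k)}$ times the number of (ordinary) puzzles in a down-pointing equilateral triangle of side $n$ whose boundary is as follows: the left side, read from the top-left corner to the bottom corner, encodes $\lambda$; the right side, read from the bottom corner to the top-right corner, encodes $\mu$; the top horizontal side, read from left to right, encodes $\nu$.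
   Context: **Young diagrams.** Fix $0\le k\le n$. A Young diagram $\lambda$ (English convention) in the $k\times(n-k)$ rectangle ($k$ rows, $n-k$ columns) is encoded by its frame, a $k$-subset of $\{1,\dots,n\}$: follow the border of $\lambda$ from the bottom-left to the top-right corner of the rectangle in $n$ unit steps (up or right), and record $i$ if the $i$-th step is up. So $\varnothing$ has frame $\{1,\dots,k\}$ and the full rectangle has frame $\{n-k+1,\dots,n\}$. Write $i\in\lambda$ if $i$ is in the frame of $\lambda$; $|\lambda|$ is the number of boxes; $\lambda^\ast$ is the diagram with frame $\{n+1-i: i\in\lambda\}$. **Polynomials.** Let $\bar x=(x_1,\dots,x_k)$, $\vec y=(y_1,\dots,y_n)$, $\overleftarrow{y}=(y_n,\dots,y_1)$. The double Grothendieck polynomials $G^\lambda(\bar x;\vec y)$ are defined inductively by $G^{\{n-k+1,\dots,n\}}(\bar x;\vec y)=\prod_{i=1}^k\prod_{j=1}^{n-k}(1-x_i/y_j)$ and $G^\mu=D_iG^\lambda$ whenever the frame of $\mu$ is obtained from that of $\lambda$ by replacing $i+1$ with $i$, where $D_if=\dfrac{y_if(\ldots,y_i,y_{i+1},\ldots)-y_{i+1}f(\ldots,y_{i+1},y_i,\ldots)}{y_i-y_{i+1}}$ acts on the $y$ variables. The dual polynomials are $G_\lambda(\bar x;\vec y)=\prod_{i=1}^kx_i\prod_{i\in\lambda}y_i^{-1}\,G^{\lambda^\ast}(\bar x;\overleftarrow{y})$. **Ring.** $K_T(Gr(k,n))$ is the quotient of $\mathbb Z[x_1^{\pm1},\dots,x_k^{\pm1},y_1^{\pm1},\dots,y_n^{\pm1}]^{\mathcal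 S_k}$ ($\mathcal S_k$ permuting the $x_i$) by the ideal of elements that vanish whenever $(x_1,\dots,x_k)$ is specialized to $(y_{i_1},\dots,y_{i_k})$ for any $i_1<\dots<i_k$. $K(Gr(k,n))$ is obtained from it by base change $y_i\mapsto1$ for all $i$. It is known that the classes of the $G_\lambda(\bar x)$ form a $\mathbb Z$-basis of $K(Gr(k,n))$. **Puzzles.** Consider the triangular lattice of unit equilateral triangles with horizontal edges. Each unit triangle has a horizontal edge $h$, an edge $a$ in direction $60^\circ/240^\circ$ and an edge $b$ in direction $120^\circ/300^\circ$; for an up-pointing triangle $a$ is the left and $b$ the right edge; for a down-pointing triangle $a$ is the right and $b$ the left edge. Each edge has a state, a subset of $\{R,G\}$ (red, green), written $\emptyset,R,G,RG$. The allowed tiles, given by the states $(h,a,b)$, are $E=(\emptyset,\emptyset,\emptyset)$, $G_1=(G,G,\emptyset)$, $G_2=(G,RG,R)$, $R_1=(R,\emptyset,R)$, $R_2=(R,G,RG)$, for both up- and down-pointing triangles, and the $K$-tile $K=(\emptyset,RG,RG)$ for up-pointing triangles only. An (ordinary) puzzle in a domain is an assignment of an allowed tile to every unit triangle of the domain such that triangles sharing an edge assign it the same state. **Boundary conditions.** Horizontal boundary edges must be in state $R$ or $G$; boundary edges in direction $60^\circ/240^\circ$ in state $G$ or $\emptyset$; boundary edges in direction $120^\circ/300^\circ$ in state $R$ or $\emptyset$. A side of length $n$, read in a given direction, encodes the Young diagram whose frame is the set of positions (numbered $1,\dots,n$ along the reading direction) of the $G$ edges for horizontal and $60^\circ/240^\circ$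 sides, and of the $\emptyset$ edges for $120^\circ/300^\circ$ sides. *)

(* Defs.v *)
From Stdlib Require Import ClassicalEpsilon.
From HB Require Import structures.
From mathcomp Require Import all_boot all_order all_algebra all_fingroup.
From mathcomp Require Import mpoly.

Set Implicit Arguments.
Unset Strict Implicit.
Unset Printing Implicit Defensive.

Import Order.TTheory GRing.Theory Num.Theory.
Local Open Scope ring_scope.

(* Positions 1, ..., n are the ordinals 0, ..., n-1.  A Young diagram in the
   k x (n-k) rectangle is given by its frame, A : {set 'I_n} with #|A| = k. *)

(* The box in the row of the up-step j and the column of the right-step i lies
   in the diagram iff step i comes before step j. *)
Definition num_boxes n (A : {set 'I_n}) : nat :=
  #|[set p : 'I_n * 'I_n | [&& p.1 \notin A, p.2 \in A & (p.1 < p.2)%N]]|.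

Definition star n (A : {set 'I_n}) : {set 'I_n} := [set rev_ord i | i in A].

(* Laurent polynomials in x_1, ..., x_k, y_1, ..., y_n are handled inside the
   field of rational functions, so that divided differences can be written as
   quotients. *)
Definition ratfun (k n : nat) := {fraction {mpoly int[k + n]}}.

Section RationalFunctions.
Variables k n : nat.
Local Notation F := (ratfun k n).
Local Notation tofrac := (@FracField.tofrac {mpoly int[k + n]}).

Definition xvar (i : 'I_k) : F := tofrac 'X_(lshift n i).
Definition yvar (j : 'I_n) : F := tofrac 'X_(rshift k j).

Definition poly_subst (vx : 'I_k -> F) (vy : 'I_n -> F)
    (p : {mpoly int[k + n]}) : F :=
  mmap (fun z : int => z%:~R)
    (fun a => match split a with inl i => vx i | inr j => vy j end) p.

(* The value of f at x := vx, y := vy, computed from any way of writing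
   f = p / q with q nonzero at that point; the result does not depend on the
   choice of p and q.  It is only used where such p and q exist: for Laurent
   polynomials at nonzero vx, vy, and for arbitrary f when vx, vy is a
   permutation of the variables. *)
Definition rsubst (vx : 'I_k -> F) (vy : 'I_n -> F) (f : F) : F :=
  epsilon (inhabits 0) (fun c : F => exists p q : {mpoly int[k + n]},
    [/\ f * tofrac q = tofrac p, poly_subst vx vy q != 0
      & c * poly_subst vx vy q = poly_subst vx vy p]).

Definition y_swap (i j : 'I_n) (f : F) : F :=
  rsubst xvar (fun l => yvar (tperm i j l)) f.

(* Used with j the successor of i. *)
Definition divdiff (i j : 'I_n) (f : F) : F :=
  (yvar i * f - yvar j * y_swap i j f) / (yvar i - yvar j).

Inductive is_double_groth : {set 'I_n} -> F -> Prop :=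
| Groth_full :
    is_double_groth [set i : 'I_n | (n - k <= i)%N]
      (\prod_(i < k) \prod_(j < n | (j < n - k)%N) (1 - xvar i / yvar j))
| Groth_step (A : {set 'I_n}) (f : F) (i j : 'I_n) :
    j = i.+1 :> nat -> j \in A -> i \notin A -> is_double_groth A f ->
    is_double_groth (i |: (A :\ j)) (divdiff i j f).

(* The upper-index polynomial.  The inductive rule reaches every k-subset, and
   its outcome does not depend on the order of the steps. *)
Definition double_groth (A : {set 'I_n}) : F :=
  epsilon (inhabits 0) (is_double_groth A).

(* The lower-index polynomial. *)
Definition dual_groth (A : {set 'I_n}) : F :=
  (\prod_(i < k) xvar i) * (\prod_(i in A) (yvar i)^-1)
  * rsubst xvar (fun j => yvar (rev_ord j)) (double_groth (star A)).

Definition dual_groth1 (A : {set 'I_n}) : F :=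
  rsubst xvar (fun=> 1) (dual_groth A).

Definition is_laurent (f : F) : Prop :=
  exists (p : {mpoly int[k + n]}) (m : 'X_{1..k + n}),
    f = tofrac p / tofrac 'X_[m].

Definition sym_laurent (f : F) : Prop :=
  is_laurent f /\
  (forall s : 'S_k, rsubst (fun i => xvar (s i)) yvar f = f).

(* K_T(Gr(k,n)) is the quotient of the ring sym_laurent by this ideal. *)
Definition KT_ideal (f : F) : Prop :=
  sym_laurent f /\
  (forall g : 'I_k -> 'I_n, {homo g : a b / (a < b)%N} ->
     rsubst (fun a => yvar (g a)) yvar f = 0).

(* Equality of the classes of f and g in
     K(Gr(k,n)) = K_T(Gr(k,n)) / (y_1 - 1, ..., y_n - 1),
   the base change of K_T(Gr(k,n)) along y_i |-> 1. *)
Definition K_eq (f g : F) : Prop :=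
  exists (h : F) (q : 'I_n -> F),
    [/\ KT_ideal h, forall i, sym_laurent (q i)
      & f - g = h + \sum_(i < n) (yvar i - 1) * q i].

End RationalFunctions.

(* A subset of {R, G}, as the pair (R is in it, G is in it). *)
Definition state : Type := (bool * bool)%type.
Definition st0 : state := (false, false).
Definition stR : state := (true, false).
Definition stG : state := (false, true).
Definition stRG : state := (true, true).

(* A tile is the triple (h, a, b) of the states of its edges. *)
Definition tile : Type := (state * state * state)%type.
Definition edge_h (t : tile) : state := t.1.1.
Definition edge_a (t : tile) : state := t.1.2.
Definition edge_b (t : tile) : state := t.2.

Definition down_tiles : seq tile :=
  [:: (st0, st0, st0); (stG, stG, st0); (stG, stRG, stR);
      (stR, st0, stR); (stR, stG, stRG)].
Definition up_tiles : seq tile := rcons down_tiles (st0, stRG, stRG).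

(* The down-pointing triangle of side n is cut into n horizontal strips,
   numbered from the top.  Strip r contains the down-pointing unit triangles
   (r, c) with r + c < n, numbered from the left, and the up-pointing ones
   (r, c) with r + c + 1 < n, where (r, c) up lies between (r, c) and (r, c+1)
   down and has its base on top of (r+1, c) down. *)
Definition down_tri n := {p : 'I_n * 'I_n | (p.1 + p.2 < n)%N}.
Definition up_tri n := {p : 'I_n * 'I_n | ((p.1 + p.2).+1 < n)%N}.

Definition tiling n : Type :=
  ({ffun down_tri n -> tile} * {ffun up_tri n -> tile})%type.

Definition strip n (P : pred ('I_n * 'I_n)) (t : {p | P p}) : 'I_n := (val t).1.
Definition place n (P : pred ('I_n * 'I_n)) (t : {p | P p}) : 'I_n := (val t).2.

Definition is_puzzle n (T : tiling n) : bool :=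
  [&& [forall d, T.1 d \in down_tiles],
      [forall u, T.2 u \in up_tiles]
    & [forall u, forall d,
        [&& (strip d == strip u :> nat) && (place d == place u :> nat)
              ==> (edge_a (T.1 d) == edge_a (T.2 u)),
            (strip d == strip u :> nat) && (place d == (place u).+1 :> nat)
              ==> (edge_b (T.1 d) == edge_b (T.2 u))
          & (strip d == (strip u).+1 :> nat) && (place d == place u :> nat)
              ==> (edge_h (T.1 d) == edge_h (T.2 u))]]].

(* The left boundary consists of the b-edges of the triangles (r, 0), read by
   increasing r; the right boundary of the a-edges of the triangles
   (n-1-c, c), read from the bottom, that is by increasing c; the top boundary
   of the h-edges of the triangles (0, c), read by increasing c. *)
Definition has_boundary n (lambda mu nu : {set 'I_n}) (T : tiling n) : bool :=
  [forall d : down_tri n,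
    [&& (place d == 0 :> nat) ==>
          (edge_b (T.1 d) == if strip d \in lambda then st0 else stR),
        ((strip d + place d).+1 == n)%N ==>
          (edge_a (T.1 d) == if place d \in mu then stG else st0)
      & (strip d == 0 :> nat) ==>
          (edge_h (T.1 d) == if place d \in nu then stG else stR)]].

Definition puzzles n (lambda mu nu : {set 'I_n}) : {set tiling n} :=
  [set T | is_puzzle T && has_boundary lambda mu nu T].

(* Main.v *)
(* Write z_i = x_i - 1.  At y = 1 the dual Grothendieck polynomial of a frame is, up to sign
   and the factor x_1 ... x_k, the quotient g of the alternant with columns z^a x^m by the
   Vandermonde determinant, and a column with a = n vanishes in K(Gr(k,n)).  Column operations
   give a Pieri rule for the product of g with prod_i (1 + u z_i).  The same Pieri coefficients
   are obtained by moving a line, whose crossings with the edges are weighted, through the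
   puzzle from its top to its right side.  Hence the matrix Z of puzzle coefficients with
   lambda fixed commutes with multiplication by every symmetric polynomial in the z_i.  As
   multiplication by g_mu maps g = 1 to g_mu, and the g's are independent, the product of
   g_mu with the row of Z at the frame of g = 1 is its row at mu; the former row consists of
   Pieri coefficients at u = 1, so it represents x_1 ... x_k g_lambda. *)
From Stdlib Require Import ClassicalEpsilon.
Require Import Defs.
From HB Require Import structures.
From mathcomp Require Import all_boot all_order all_algebra all_fingroup.
From mathcomp Require Import mpoly.
From mathcomp Require Import ring zify.

Set Implicit Arguments.
Unset Strict Implicit.
Unset Printing Implicit Defensive.

Import Order.TTheory GRing.Theory Num.Theory.
Local Open Scope ring_scope.

(** * Commutation of a coloured line with the puzzle tiles *)

(** The line weights contain the inverses of u and u - 1, so the line moves only over a field; the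
    resulting commutation is nevertheless an identity in Z[u], since Z[u] embeds in its fraction
    field, and its coefficients in u belong to the elementary symmetric polynomials. Independence of
    the g's comes from a residue pairing: localization on the k-fold product of P^(n-1), applied to
    multiples of the Vandermonde determinant, kills the ideal and has polynomial values, so it
    survives y = 1, where it becomes a triangular system of coefficients of powers of z. Cutting a
    puzzle into strips parallel to its right side makes all three sides be read backwards; reversing
    a frame is [star], the same reversal that enters the dual polynomials. A product of two dual
    polynomials contains x_1 ... x_k twice and its expansion once; the surplus copy is the value at
    u = 1 of prod_i (1 + u z_i). *)

Lemma big_state (S : nmodType) (F : state -> S) :
  \sum_s F s = F st0 + F stR + F stG + F stRG.
Proof.
transitivity (\sum_(p : bool * bool) F (p.1, p.2)); first by apply: eq_bigr; case.
rewrite -(pair_bigA _ (fun x y => F (x, y))) /= !big_bool /=.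
by rewrite [LHS]addrC (addrC (F (false, true))) (addrC (F (true, true))) addrACA addrA.
Qed.

(* States of an auxiliary line crossing the puzzle: the line carries a parameter u, and
   wa, wb, wh are the weights of its crossing an edge of each direction, in the states x
   and y on its two sides.  They solve the local relations down_rel and up_rel, which let
   the line be moved through one triangle. *)
Definition colour := option bool.
Definition c1 : colour := None.
Definition c2 : colour := Some true.
Definition c3 : colour := Some false.

Lemma big_colour (S : nmodType) (F : colour -> S) :
  \sum_c F c = F c1 + F c2 + F c3.
Proof.
rewrite (bigD1 c1) //= (bigD1 c2) //= (bigD1 c3) //= big1 ?addr0 ?addrA //.
by case=> [[]|].
Qed.

Section Line.
Variables (S : fieldType) (u : S).
Hypotheses (u_neq0 : u != 0) (u_neq1 : u - 1 != 0).

Definition dtile (h a b : state) : S := ((h, a, b) \in down_tiles)%:R.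
Definition utile (h a b : state) : S := ((h, a, b) \in up_tiles)%:R.

Definition wa (c : colour) (x y : state) (c' : colour) : S :=
  match c, c' with
  | None, None => (x == y)%:R
  | None, Some false => if (x == st0) && (y == stG) then u else 0
  | None, Some true => if (x == st0) && (y == stRG) then u else 0
  | Some true, None => ((x == stRG) && (y == st0))%:R
  | Some true, Some true =>
      if (x == stG) && (y == stG) then 1
      else if (x == stRG) && (y == stRG) then u - 1 else 0
  | Some true, Some false => if (x == stRG) && (y == stG) then u else 0
  | Some false, None => ((x == stG) && (y == st0))%:R
  | Some false, Some true => if (x == stG) && (y == stRG) then u - 1 else 0
  | Some false, Some false => if (x == stG) && (y == stG) then u - 1 else 0
  end.

Definition wb (c : colour) (x y : state) (c' : colour) : S :=
  match c, c' with
  | None, None => ((x == y) && (x != stRG))%:R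
  | None, Some true => ((x == stRG) && (y == st0))%:R
  | None, Some false => ((x == stRG) && (y == stR))%:R
  | Some true, None => 0
  | Some true, Some true => ((x == stR) && (y == stR))%:R
  | Some true, Some false => ((x == st0) && (y == stR))%:R
  | Some false, None => if (x == stR) && (y == stRG) then u^-1 else 0
  | Some false, Some true => if (x == stR) && (y == st0) then (u - 1) / u else 0
  | Some false, Some false =>
      if (x == st0) && (y == st0) then 1
      else if (x == stR) && (y == stR) then - u^-1
      else if (x == stRG) && (y == stRG) then (u - 1)^-1 else 0
  end.

Definition wh (c : colour) (x y : state) (c' : colour) : S :=
  match c, c' with
  | None, None => (x == y)%:R
  | None, Some true => if (x == stR) && (y == stG) then u else 0
  | None, Some false => if (x == st0) && (y == stG) then u else 0
  | Some true, None => ((x == stG) && (y == stR))%:R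
  | Some true, Some true => if (x == stG) && (y == stG) then u - 1 else 0
  | Some true, Some false => 0
  | Some false, None => ((x == stG) && (y == st0))%:R
  | Some false, Some true => ((x == stR) && (y == st0))%:R
  | Some false, Some false =>
      if (x == stG) && (y == stG) then u - 1
      else ((x == stR) && (y == stR))%:R
  end.

Lemma sum_dtile_l h (F : state -> state -> S) :
  \sum_a \sum_b F a b * dtile h a b
  = match h with
    | (false, false) => F st0 st0
    | (false, true) => F stG st0 + F stRG stR
    | (true, false) => F st0 stR + F stG stRG
    | (true, true) => 0
    end.
Proof.
rewrite !big_state /dtile.
by case: h => [[] []]; rewrite /= ?(mulr0, mulr1, addr0, add0r).
Qed.

Lemma sum_utile_l h (F : state -> state -> S) :
  \sum_a \sum_b F a b * utile h a b
  = match h with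
    | (false, false) => F st0 st0 + F stRG stRG
    | (false, true) => F stG st0 + F stRG stR
    | (true, false) => F st0 stR + F stG stRG
    | (true, true) => 0
    end.
Proof.
rewrite !big_state /utile.
by case: h => [[] []]; rewrite /= ?(mulr0, mulr1, addr0, add0r).
Qed.

Lemma sum_dtile_h a b (F : state -> S) :
  \sum_h F h * dtile h a b
  = match a, b with
    | (false, false), (false, false) => F st0
    | (false, true), (false, false) | (true, true), (true, false) => F stG
    | (false, false), (true, false) | (false, true), (true, true) => F stR
    | _, _ => 0
    end.
Proof.
rewrite big_state /dtile.
by case: a => [[] []]; case: b => [[] []];
  rewrite /= ?(mulr0, mulr1, addr0, add0r).
Qed.

Lemma sum_utile_h a b (F : state -> S) :
  \sum_h F h * utile h a b
  = match a, b with
    | (false, false), (false, false) | (true, true), (true, true) => F st0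
    | (false, true), (false, false) | (true, true), (true, false) => F stG
    | (false, false), (true, false) | (false, true), (true, true) => F stR
    | _, _ => 0
    end.
Proof.
rewrite big_state /utile.
by case: a => [[] []]; case: b => [[] []];
  rewrite /= ?(mulr0, mulr1, addr0, add0r).
Qed.

(** Moves the line from the top edge of a down-pointing triangle to its two lower edges. It is a
    finite check: one rational identity in u for each choice of colours and outer states. *)
Lemma down_rel c c' h a b :
  \sum_h' wh c h h' c' * dtile h' a b
  = \sum_d \sum_a' \sum_b' wa c a' a d * wb d b' b c' * dtile h a' b'.
Proof.
rewrite sum_dtile_h (eq_bigr _ (fun d _ => sum_dtile_l _ _)) big_colour.
case: c => [[]|]; case: c' => [[]|];
  rewrite /wh /wa /wb /= ?(mul0r, mulr0, add0r, addr0);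
  case: h => [[] []]; case: a => [[] []];
  rewrite /= ?(mul0r, mulr0, add0r, addr0, mul1r, mulr1) //;
  case: b => [[] []]; rewrite /= ?(mul0r, mulr0, add0r, addr0, mul1r, mulr1) //;
  by field; rewrite ?u_neq0 ?u_neq1.
Qed.

Lemma up_rel c c' h a b :
  \sum_d \sum_a' \sum_b' wb c b b' d * wa d a a' c' * utile h a' b'
  = \sum_h' wh c h' h c' * utile h' a b.
Proof.
rewrite sum_utile_h (eq_bigr _ (fun d _ => sum_utile_l _ _)) big_colour.
case: c => [[]|]; case: c' => [[]|];
  rewrite /wh /wa /wb /= ?(mul0r, mulr0, add0r, addr0);
  case: h => [[] []]; case: a => [[] []];
  rewrite /= ?(mul0r, mulr0, add0r, addr0, mul1r, mulr1) //;
  case: b => [[] []]; rewrite /= ?(mul0r, mulr0, add0r, addr0, mul1r, mulr1) //;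
  by field; rewrite ?u_neq0 ?u_neq1.
Qed.

End Line.

(** * Evaluation of puzzles strip by strip, and the crossings of the line *)

Section Column.
Variable S : comNzRingType.

(* The sum over the tilings of the strip of triangles along the right side, with top edge h,
   right side a :: s and final left edge b; K receives the states on the left of the strip. *)
Fixpoint col (h a : state) (s : seq state) (b : state) (K : seq state -> S) : S :=
  match s with
  | [::] => ((h, a, b) \in down_tiles)%:R * K [::]
  | a1 :: s1 => \sum_b1 \sum_h1 \sum_a2
      ((h, a, b1) \in down_tiles)%:R * ((h1, a2, b1) \in up_tiles)%:R
      * col h1 a1 s1 b (fun t => K (a2 :: t))
  end.

(** The strip along the right side is peeled off first, so [bs] lists the left side from the bottom
    and [hs] the top side from the right. *)
Fixpoint puz (bs hs s : seq state) : S :=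
  match bs, hs, s with
  | b :: bs1, h :: hs1, a :: s1 => col h a s1 b (puz bs1 hs1)
  | [::], [::], [::] => 1
  | _, _, _ => 0
  end.

(* The transfer along a row of edges in states s, starting with the colour c. *)
Fixpoint tr (w : colour -> state -> state -> colour -> S) (c : colour)
    (s : seq state) (K : colour -> seq state -> S) : S :=
  match s with
  | [::] => K c [::]
  | x :: s1 => \sum_d \sum_y w c y x d * tr w d s1 (fun e t => K e (y :: t))
  end.

Lemma eq_col h a s b K1 K2 :
  (forall t, size t = size s -> K1 t = K2 t) -> col h a s b K1 = col h a s b K2.
Proof.
elim: s h a K1 K2 => [|a1 s IH] h a K1 K2 eK /=; first by rewrite eK.
apply: eq_bigr => b1 _; apply: eq_bigr => h1 _; apply: eq_bigr => a2 _.
by congr (_ * _); apply: IH => t st; apply: eK; rewrite /= st.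
Qed.

Lemma eq_tr w c s K1 K2 : K1 =2 K2 -> tr w c s K1 = tr w c s K2.
Proof.
elim: s c K1 K2 => [|x s IH] c K1 K2 eK /=; first exact: eK.
apply: eq_bigr => d _; apply: eq_bigr => y _.
by congr (_ * _); apply: IH => e t; apply: eK.
Qed.

Lemma col_sum (I : finType) h a s b (F : I -> seq state -> S) :
  col h a s b (fun t => \sum_i F i t) = \sum_i col h a s b (F i).
Proof.
elim: s h a F => [|a1 s IH] h a F /=; first by rewrite big_distrr.
rewrite [RHS]exchange_big; apply: eq_bigr => b1 _.
rewrite [RHS]exchange_big; apply: eq_bigr => h1 _.
rewrite [RHS]exchange_big; apply: eq_bigr => a2 _.
by rewrite IH big_distrr.
Qed.

Lemma col_scale h a s b x (F : seq state -> S) :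
  col h a s b (fun t => x * F t) = x * col h a s b F.
Proof.
elim: s h a F => [|a1 s IH] h a F /=; first by rewrite mulrCA.
rewrite [RHS]big_distrr; apply: eq_bigr => b1 _.
rewrite [RHS]big_distrr; apply: eq_bigr => h1 _.
rewrite [RHS]big_distrr; apply: eq_bigr => a2 _.
by rewrite IH /= mulrCA.
Qed.

Lemma tr_sum (I : finType) w c s (F : I -> colour -> seq state -> S) :
  tr w c s (fun d t => \sum_i F i d t) = \sum_i tr w c s (F i).
Proof.
elim: s c F => [|x s IH] c F //=.
rewrite [RHS]exchange_big; apply: eq_bigr => b1 _.
rewrite [RHS]exchange_big; apply: eq_bigr => h1 _.
by rewrite IH big_distrr.
Qed.

Lemma tr_scale w c s x (F : colour -> seq state -> S) :
  tr w c s (fun d t => x * F d t) = x * tr w c s F.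
Proof.
elim: s c F => [|y s IH] c F //=.
rewrite [RHS]big_distrr; apply: eq_bigr => b1 _.
rewrite [RHS]big_distrr; apply: eq_bigr => h1 _.
by rewrite IH /= mulrCA.
Qed.

Lemma tr_col w c s h a s2 b (F : colour -> seq state -> seq state -> S) :
  tr w c s (fun d t => col h a s2 b (F d t))
  = col h a s2 b (fun t2 => tr w c s (fun d t => F d t t2)).
Proof.
elim: s c F => [|y s IH] c F //=.
rewrite col_sum; apply: eq_bigr => d _.
rewrite col_sum; apply: eq_bigr => x _.
by rewrite IH col_scale.
Qed.

End Column.

Section Sums.
Variable S : comNzRingType.

Lemma mulr_sum2 (I J : finType) (x : S) (F : I -> J -> S) :
  x * (\sum_i \sum_j F i j) = \sum_i \sum_j x * F i j.
Proof. by rewrite mulr_sumr; apply: eq_bigr => i _; rewrite mulr_sumr. Qed.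

Lemma mulr_sum3 (I J L : finType) (x : S) (F : I -> J -> L -> S) :
  x * (\sum_i \sum_j \sum_l F i j l) = \sum_i \sum_j \sum_l x * F i j l.
Proof. by rewrite mulr_sumr; apply: eq_bigr => i _; rewrite mulr_sum2. Qed.

Lemma exchange_2_3 (A B I J L : finType) (F : A -> B -> I -> J -> L -> S) :
  \sum_a \sum_b \sum_i \sum_j \sum_l F a b i j l
  = \sum_i \sum_j \sum_l \sum_a \sum_b F a b i j l.
Proof.
under eq_bigr do rewrite exchange_big.
rewrite exchange_big; apply: eq_bigr => i _.
under eq_bigr do rewrite exchange_big.
rewrite exchange_big; apply: eq_bigr => j _.
under eq_bigr do rewrite exchange_big.
by rewrite exchange_big.
Qed.

Lemma exchange_2_2 (A B I J : finType) (F : A -> B -> I -> J -> S) :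
  \sum_a \sum_b \sum_i \sum_j F a b i j = \sum_i \sum_j \sum_a \sum_b F a b i j.
Proof.
under eq_bigr do rewrite exchange_big.
rewrite exchange_big; apply: eq_bigr => i _.
under eq_bigr do rewrite exchange_big.
by rewrite exchange_big.
Qed.

End Sums.

Section Line.
Variables (S : fieldType) (u : S).
Hypotheses (u_neq0 : u != 0) (u_neq1 : u - 1 != 0).
Local Notation wa := (wa u).
Local Notation wb := (wb u).
Local Notation wh := (wh u).

(** The line enters by the top edge of the strip and follows its left side. Passing it through the
    triangles one by one, with [down_rel] and [up_rel] alternately, brings it to the right side and
    the final left edge. *)
Lemma col_line c h a s b (K : colour -> seq state -> S) :
  \sum_d \sum_h1 wh c h h1 d * col h1 a s b (fun t => tr wa d t K)
  = tr wa c (a :: s) (fun d t => if t is a1 :: t1 then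
        \sum_e \sum_b1 wb d b1 b e * col h a1 t1 b1 (K e) else 0).
Proof.
elim: s c h a K => [|a' s IH] c h a K.
  rewrite /=.
  under [RHS]eq_bigr do under eq_bigr do rewrite mulr_sum2.
  rewrite [RHS](eq_bigr (fun d => \sum_e \sum_y \sum_b1
     wa c y a d * (wb d b1 b e * (((h, y, b1) \in down_tiles)%:R * K e [::])))); last first.
    by move=> d _; rewrite exchange_big.
  rewrite [RHS]exchange_big; apply: eq_bigr => e _.
  transitivity ((\sum_h1 wh c h h1 e * dtile S h1 a b) * K e [::]).
    by rewrite mulr_suml; apply: eq_bigr => h1 _; rewrite mulrA.
  rewrite (down_rel u_neq0 u_neq1 c e h a b).
  rewrite mulr_suml; apply: eq_bigr => d _.
  rewrite mulr_suml; apply: eq_bigr => y _.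
  by rewrite mulr_suml; apply: eq_bigr => b1 _; rewrite !mulrA.
pose X h1 d a2 := col h1 a' s b (fun t => tr wa d t (fun e t2 => K e (a2 :: t2))).
(* Isolate the first down-pointing triangle together with the crossing of its top edge. *)
transitivity (\sum_b1 \sum_h1 \sum_a1 \sum_d0 (\sum_h0 wh c h h0 d0 *
    dtile S h0 a b1) * utile S h1 a1 b1 * (\sum_d \sum_a2 wa d0 a2 a1 d * X h1 d a2)).
  transitivity (\sum_d0 \sum_h0 \sum_b1 \sum_h1 \sum_a1 (wh c h h0 d0 *
    dtile S h0 a b1 * utile S h1 a1 b1 * (\sum_d \sum_a2 wa d0 a2 a1 d * X h1 d a2))).
    apply: eq_bigr => d0 _; apply: eq_bigr => h0 _.
    rewrite [col _ _ _ _ _]/= mulr_sum3.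
    apply: eq_bigr => b1 _; apply: eq_bigr => h1 _; apply: eq_bigr => a1 _.
    rewrite !mulrA; congr (_ * _).
    rewrite col_sum; apply: eq_bigr => d _; rewrite col_sum; apply: eq_bigr => a2 _.
    by rewrite col_scale.
  rewrite exchange_2_3.
  apply: eq_bigr => b1 _; apply: eq_bigr => h1 _; apply: eq_bigr => a1 _.
  by apply: eq_bigr => d0 _; rewrite !mulr_suml.
(* [down_rel] moves the line to the two lower edges of that triangle. *)
transitivity (\sum_d0 \sum_a0 \sum_b0 (wa c a0 a d0 * dtile S h a0 b0) *
   \sum_h1 \sum_d \sum_a2 (\sum_d1 \sum_a1 \sum_b1 wb d0 b0 b1 d1 * wa d1 a2 a1 d
      * utile S h1 a1 b1) * X h1 d a2).
  under eq_bigr do under eq_bigr do under eq_bigr do under eq_bigr do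
    rewrite (down_rel u_neq0 u_neq1).
  transitivity (\sum_b1 \sum_h1 \sum_a1 \sum_d1 \sum_d0 \sum_a0 \sum_b0
     wa c a0 a d0 * dtile S h a0 b0 * (wb d0 b0 b1 d1 * utile S h1 a1 b1 *
       \sum_d \sum_a2 wa d1 a2 a1 d * X h1 d a2)).
    apply: eq_bigr => b1 _; apply: eq_bigr => h1 _; apply: eq_bigr => a1 _.
    apply: eq_bigr => d1 _; rewrite !mulr_suml; apply: eq_bigr => d0 _.
    rewrite !mulr_suml; apply: eq_bigr => a0 _.
    rewrite !mulr_suml; apply: eq_bigr => b0 _.
    by rewrite !mulrA; congr (_ * _ * _); rewrite -!mulrA; congr (_ * _); rewrite mulrC.
  transitivity (\sum_d0 \sum_a0 \sum_b0 \sum_b1 \sum_h1 \sum_a1 \sum_d1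
     wa c a0 a d0 * dtile S h a0 b0 * (wb d0 b0 b1 d1 * utile S h1 a1 b1 *
       \sum_d \sum_a2 wa d1 a2 a1 d * X h1 d a2)).
    under eq_bigr do under eq_bigr do rewrite exchange_2_3.
    rewrite exchange_2_3; apply: eq_bigr => d0 _; apply: eq_bigr => a0 _.
    by apply: eq_bigr => b0 _.
  apply: eq_bigr => d0 _; apply: eq_bigr => a0 _; apply: eq_bigr => b0 _.
  under eq_bigr do under eq_bigr do under eq_bigr do rewrite -mulr_sumr.
  under eq_bigr do under eq_bigr do rewrite -mulr_sumr.
  under eq_bigr do rewrite -mulr_sumr.
  rewrite -mulr_sumr; congr (_ * _).
  rewrite exchange_big; apply: eq_bigr => h1 _.
  transitivity (\sum_b1 \sum_a1 \sum_d1 \sum_d \sum_a2 wb d0 b0 b1 d1 * wa d1 a2 a1 d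
      * utile S h1 a1 b1 * X h1 d a2).
    apply: eq_bigr => b1 _; apply: eq_bigr => a1 _; apply: eq_bigr => d1 _.
    rewrite mulr_sum2; apply: eq_bigr => d _; apply: eq_bigr => a2 _.
    by rewrite !mulrA; congr (_ * _); rewrite -!mulrA; congr (_ * _); rewrite mulrC.
  under eq_bigr do under eq_bigr do rewrite exchange_big.
  under eq_bigr do rewrite exchange_big.
  rewrite exchange_big; apply: eq_bigr => d _.
  under eq_bigr do under eq_bigr do rewrite exchange_big.
  under eq_bigr do rewrite exchange_big.
  rewrite exchange_big; apply: eq_bigr => a2 _.
  rewrite exchange_big.
  under eq_bigr do rewrite exchange_big.
  under eq_bigr do under eq_bigr do rewrite -mulr_suml.
  rewrite exchange_big mulr_suml; apply: eq_bigr => d1 _.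
  by rewrite mulr_suml.
rewrite [RHS]/=.
apply: eq_bigr => d0 _; apply: eq_bigr => a0 _.
transitivity (wa c a0 a d0 * \sum_b0 dtile S h a0 b0 *
   \sum_h1 \sum_d \sum_a2 (\sum_d1 \sum_a1 \sum_b1 wb d0 b0 b1 d1 * wa d1 a2 a1 d
      * utile S h1 a1 b1) * X h1 d a2).
  by rewrite mulr_sumr; apply: eq_bigr => b0 _; rewrite mulrA.
congr (_ * _).
(* [up_rel] moves the line to the base of the up-pointing triangle, which is the top edge of the
   rest of the strip. *)
transitivity (\sum_b0 \sum_h0 \sum_a2 dtile S h a0 b0 * utile S h0 a2 b0 *
   (\sum_d \sum_h1 wh d0 h0 h1 d * X h1 d a2)).
  apply: eq_bigr => b0 _.
  under [in LHS]eq_bigr do under eq_bigr do under eq_bigr do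
    rewrite (up_rel u_neq0 u_neq1).
  transitivity (dtile S h a0 b0 * \sum_h1 \sum_d \sum_a2 \sum_h0 utile S h0 a2 b0 *
     (wh d0 h0 h1 d * X h1 d a2)).
    congr (_ * _); apply: eq_bigr => h1 _; apply: eq_bigr => d _.
    apply: eq_bigr => a2 _; rewrite mulr_suml; apply: eq_bigr => h0 _.
    by rewrite mulrA; congr (_ * _); rewrite mulrC.
  under [in RHS]eq_bigr do under eq_bigr do rewrite -mulrA mulr_sum2.
  under [in RHS]eq_bigr do rewrite -mulr_sumr.
  rewrite -mulr_sumr; congr (_ * _).
  rewrite exchange_2_2 exchange_big; apply: eq_bigr => h0 _; apply: eq_bigr => a2 _.
  exact: exchange_big.
transitivity (\sum_b0 \sum_h0 \sum_a2 dtile S h a0 b0 * utile S h0 a2 b0 *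
   tr wa d0 (a' :: s) (fun d t => if t is a1 :: t1 then
     \sum_e \sum_b1 wb d b1 b e * col h0 a1 t1 b1 (fun t2 => K e (a2 :: t2)) else 0)).
  apply: eq_bigr => b0 _; apply: eq_bigr => h0 _; apply: eq_bigr => a2 _.
  by congr (_ * _); rewrite -IH.
rewrite [RHS](_ : _ = tr wa d0 (a' :: s) (fun d t =>
   \sum_b0 \sum_h0 \sum_a2 dtile S h a0 b0 * utile S h0 a2 b0 *
   (if t is a1 :: t1 then
     \sum_e \sum_b1 wb d b1 b e * col h0 a1 t1 b1 (fun t2 => K e (a2 :: t2)) else 0))).
  rewrite tr_sum; apply: eq_bigr => b0 _; rewrite tr_sum; apply: eq_bigr => h0 _.
  by rewrite tr_sum; apply: eq_bigr => a2 _; rewrite tr_scale.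
rewrite /=; apply: eq_bigr => d _; apply: eq_bigr => a1 _; congr (_ * _).
apply: eq_tr => e t.
under [in RHS]eq_bigr do under eq_bigr do under eq_bigr do rewrite mulr_sum2.
rewrite -exchange_2_3; apply: eq_bigr => f _; apply: eq_bigr => b1 _.
rewrite mulr_sum3; apply: eq_bigr => b0 _; apply: eq_bigr => h0 _.
by apply: eq_bigr => a2 _; rewrite mulrCA.
Qed.

End Line.

(** * Pieri coefficients and their sums over bit strings *)

Section BitSums.
Variable S : comNzRingType.
Implicit Types (u : S) (s t : seq bool).

Lemma big_tuple_cons (T : finType) n (F : seq T -> S) :
  \sum_(t : n.+1.-tuple T) F t = \sum_x \sum_(t : n.-tuple T) F (x :: t).
Proof.
rewrite (reindex (fun p : T * n.-tuple T => [tuple of p.1 :: p.2])) /=; last first.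
  exists (fun t : n.+1.-tuple T => (thead t, [tuple of behead t])) => [[x t] _|t _] /=.
    by congr (_, _); apply: val_inj.
  by rewrite [RHS]tuple_eta.
by rewrite -(pair_bigA _ (fun x (t : n.-tuple T) => F (x :: t))).
Qed.

Lemma big_tuple_bool n (F : seq bool -> S) :
  \sum_(t : n.+1.-tuple bool) F t
  = \sum_(t : n.-tuple bool) F (false :: t) + \sum_(t : n.-tuple bool) F (true :: t).
Proof. by rewrite big_tuple_cons big_bool addrC. Qed.

Lemma big_tuple_nil (T : finType) (F : seq T -> S) :
  \sum_(t : 0.-tuple T) F t = F [::].
Proof.
rewrite (bigD1 [tuple]) //= big1 ?addr0 // => t.
by move/eqP; case; apply: val_inj; case: t => [[]].
Qed.

(* The K-theoretic Pieri coefficients: the generating function in u of the multiplication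
   by the elementary symmetric polynomials in the x_i - 1.  Up-steps (true) may move to the
   next position; c records whether one has just left the previous position. *)
Fixpoint pw u (c : bool) s s' : S :=
  match s, s' with
  | x :: s1, y :: s1' =>
    match c, x, y with
    | false, false, false | false, true, true | true, false, true => pw u false s1 s1'
    | false, true, false => u * pw u true s1 s1'
    | true, true, true => (u - 1) * pw u true s1 s1'
    | _, _, _ => 0
    end
  | [::], [::] => (~~ c)%:R
  | _, _ => 0
  end.

Lemma pw_count u c s s' : pw u c s s' != 0 -> count id s' = (c + count id s)%N.
Proof.
elim: s s' c => [|x s IH] [|y s'] c; rewrite /= ?eqxx //.
  by case: c; rewrite // eqxx.
have nz v a : v * a != 0 -> a != 0 :> S.
  by apply: contraNneq => ->; rewrite mulr0.
case: c; case: x; case: y; rewrite /= ?eqxx // => H;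
  by first [rewrite (IH _ _ H) | rewrite (IH _ _ (nz _ _ H))].
Qed.

(** [psum] and [psumT] are the row and column sums of [pw] in recursive form, matching the recursion
    of [tr] and of the alternants. *)
Fixpoint psum u (c : bool) s (K : seq bool -> S) : S :=
  match s, c with
  | [::], _ => (~~ c)%:R * K [::]
  | false :: s1, false => psum u false s1 (fun t => K (false :: t))
  | true :: s1, false => psum u false s1 (fun t => K (true :: t))
                         + u * psum u true s1 (fun t => K (false :: t))
  | false :: s1, true => psum u false s1 (fun t => K (true :: t))
  | true :: s1, true => (u - 1) * psum u true s1 (fun t => K (true :: t))
  end.

Fixpoint psumT u (c : bool) s (K : seq bool -> S) : S :=
  match s, c with
  | [::], _ => (~~ c)%:R * K [::]
  | false :: s1, false => psumT u false s1 (fun t => K (false :: t))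
                          + u * psumT u true s1 (fun t => K (true :: t))
  | true :: s1, false => psumT u false s1 (fun t => K (true :: t))
  | false :: s1, true => 0
  | true :: s1, true => psumT u false s1 (fun t => K (false :: t))
                        + (u - 1) * psumT u true s1 (fun t => K (true :: t))
  end.

Lemma psumE u c s K :
  psum u c s K = \sum_(t : (size s).-tuple bool) pw u c s t * K t.
Proof.
elim: s c K => [|x s IH] c K.
  by rewrite (big_tuple_nil (fun t => pw u c [::] t * K t)).
rewrite (big_tuple_bool _ (fun t => pw u c (x :: s) t * K t)) /=.
have z0 (F : _ -> S) : \sum_(t : (size s).-tuple bool) 0 * F t = 0.
  by rewrite big1 // => t _; rewrite mul0r.
by case: x; case: c; rewrite !IH ?mulr_sumr ?z0 ?add0r ?addr0 // ;
  try (rewrite addrC; congr (_ + _)); apply: eq_bigr => t _; rewrite mulrA.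
Qed.

Lemma psumTE u c s K :
  psumT u c s K = \sum_(t : (size s).-tuple bool) pw u c t s * K t.
Proof.
elim: s c K => [|x s IH] c K.
  by rewrite (big_tuple_nil (fun t => pw u c t [::] * K t)).
rewrite (big_tuple_bool _ (fun t => pw u c t (x :: s) * K t)) /=.
have z0 (F : _ -> S) : \sum_(t : (size s).-tuple bool) 0 * F t = 0.
  by rewrite big1 // => t _; rewrite mul0r.
by case: x; case: c; rewrite ?IH ?mulr_sumr ?z0 ?add0r ?addr0 // ;
  congr (_ + _); apply: eq_bigr => t _; rewrite mulrA.
Qed.

End BitSums.

Definition left_state (x : bool) : state := if x then st0 else stR.
Definition right_state (x : bool) : state := if x then stG else st0.
Definition top_state (x : bool) : state := if x then stG else stR.

Definition puz_bits (S : comNzRingType) (l m v : seq bool) : S :=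
  puz S (map left_state l) (map top_state v) (map right_state m).

(** * Commutation of the puzzle coefficients with the Pieri coefficients *)

Section Pieri.
Variables (S : fieldType) (u : S).
Hypotheses (u_neq0 : u != 0) (u_neq1 : u - 1 != 0).
Local Notation wa := (wa u).
Local Notation wb := (wb u).
Local Notation whT := (fun c x y d => wh u c y x d).
Local Notation puz := (@puz S).
Local Notation puz_bits := (@puz_bits S).

(** Both sides describe a line from the top right to the top left corner, once along the top and
    once down the right side and up the left one. [whT] exchanges the states of [wh] because the
    fixed outer state is the first one at the top and the second one on the other sides. *)
Lemma puz_line n bs hs s c (k : colour -> S) :
  size bs = n -> size hs = n -> size s = n ->
  tr whT c hs (fun d t => k d * puz bs t s)
  = tr wa c s (fun d t => tr wb d bs (fun e t2 => k e * puz t2 hs t)).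
Proof.
elim: n bs hs s c => [|n IH] [|b bs] [|h hs] [|a s] c //= [sb] [sh] [ss].
transitivity (\sum_d \sum_h1 wh u c h h1 d * col h1 a s b (fun t =>
    tr wa d t (fun e t1 => tr wb e bs (fun e2 t2 => k e2 * puz t2 hs t1)))).
  apply: eq_bigr => d _; apply: eq_bigr => h1 _; congr (_ * _).
  under eq_tr do rewrite -col_scale.
  by rewrite tr_col; apply: eq_col => t st; rewrite -IH // st.
rewrite (col_line u_neq0 u_neq1) /=.
apply: eq_bigr => d _; apply: eq_bigr => a1 _; congr (_ * _).
apply: eq_tr => e t; apply: eq_bigr => f _; apply: eq_bigr => b1 _; congr (_ * _).
by rewrite -tr_col; apply: eq_tr => e2 t2; rewrite col_scale.
Qed.

Definition carry_colour (c : bool) : colour := if c then c3 else c1.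

Lemma tr_wa_bits c s (K : seq state -> S) :
  tr wa (carry_colour c) (map right_state s)
    (fun d t => if d == c1 then K t else 0)
  = psum u c s (fun t => K (map right_state t)).
Proof.
elim: s c K => [|x s IH] c K /=; first by case: c; rewrite /= ?mul0r ?mul1r.
have IHt := IH true; have IHf := IH false; rewrite /= in IHt IHf.
rewrite big_colour !big_state; case: c; case: x => /=;
  rewrite ?(mul0r, mul1r, add0r, addr0) ?IHt ?IHf //.
Qed.

Lemma tr_wh_bits c s (K : seq state -> S) :
  tr whT (if c then c2 else c1) (map top_state s)
    (fun d t => if d == c1 then K t else 0)
  = psumT u c s (fun t => K (map top_state t)).
Proof.
elim: s c K => [|x s IH] c K /=; first by case: c; rewrite /= ?mul0r ?mul1r.
have IHt := IH true; have IHf := IH false; rewrite /= in IHt IHf.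
rewrite big_colour !big_state; case: c; case: x => /=;
  rewrite ?(mul0r, mul1r, add0r, addr0) ?IHt ?IHf // addrC //.
Qed.

(** On the left side the outer states are only [st0] and [stR], and there a line that ends in colour
    [c1] has this colour throughout and changes no state. Hence only the right and top sides
    contribute to the Pieri identity. *)
Lemma tr_wb_bits d s (K : seq state -> S) :
  tr wb d (map left_state s) (fun e t => if e == c1 then K t else 0)
  = if d == c1 then K (map left_state s) else 0.
Proof.
elim: s d K => [|x s IH] d K //=.
under eq_bigr do under eq_bigr do rewrite IH.
rewrite big_colour !big_state; case: d => [[]|]; case: x => /=;
  rewrite ?(mul0r, mul1r, mulr0, add0r, addr0) //.
Qed.

Lemma puz_pieri_field l m v : size m = size l -> size v = size l ->
  \sum_(t : (size m).-tuple bool) pw u false m t * puz_bits l t v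
  = \sum_(t : (size v).-tuple bool) pw u false t v * puz_bits l m t.
Proof.
move=> sm sv; rewrite -(psumE u false m (fun t => puz_bits l t v)).
rewrite -(psumTE u false v (puz_bits l m)).
rewrite /puz_bits -(tr_wh_bits false v (fun t => puz (map left_state l) t _)).
rewrite -(tr_wa_bits false m (fun t => puz _ _ t)) /=.
transitivity (tr wa c1 (map right_state m) (fun d t => tr wb d (map left_state l)
   (fun e t2 => (e == c1)%:R * puz t2 (map top_state v) t))).
  apply: eq_tr => d t; rewrite -[LHS](tr_wb_bits d l (fun t2 => puz t2 _ t)).
  by apply: eq_tr => e t2; case: eqP; rewrite ?mul1r ?mul0r.
rewrite -(@puz_line (size l)) ?size_map //.
by apply: eq_tr => e t2; case: eqP; rewrite ?mul1r ?mul0r.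
Qed.

End Pieri.

Lemma rmorph_col (S S' : comNzRingType) (f : {rmorphism S -> S'}) h a s b K :
  f (col h a s b K) = col h a s b (fun t => f (K t)).
Proof.
elim: s h a K => [|a1 s IH] h a K /=; first by rewrite rmorphM rmorph_nat.
rewrite rmorph_sum; apply: eq_bigr => b1 _.
rewrite rmorph_sum; apply: eq_bigr => h1 _.
rewrite rmorph_sum; apply: eq_bigr => a2 _.
by rewrite !rmorphM !rmorph_nat IH.
Qed.

Lemma rmorph_puz (S S' : comNzRingType) (f : {rmorphism S -> S'}) bs hs s :
  f (puz S bs hs s) = puz S' bs hs s.
Proof.
elim: bs hs s => [|b bs IH] [|h hs] [|a s] /=; rewrite ?rmorph0 ?rmorph1 //.
by rewrite rmorph_col; apply: eq_col.
Qed.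

Lemma rmorph_pw (S S' : comNzRingType) (f : {rmorphism S -> S'}) u c s t :
  f (pw u c s t) = pw (f u) c s t.
Proof.
elim: s t c => [|x s IH] [|y t] c /=; rewrite ?rmorph0 ?rmorph_nat //.
by case: c; case: x; case: y; rewrite ?rmorph0 ?rmorphM ?rmorphB ?rmorph1 ?IH.
Qed.

(** Both sides are polynomials in u, so they may be compared in the fraction field of Z[u], where u
    and u - 1 are nonzero as [puz_pieri_field] requires. *)
Lemma puz_pieri l m v : size m = size l -> size v = size l ->
  \sum_(t : (size m).-tuple bool) pw 'X false m t * puz_bits {poly int} l t v
  = \sum_(t : (size v).-tuple bool) pw 'X false t v * puz_bits {poly int} l m t.
Proof.
move=> sm sv; apply/eqP; rewrite -tofrac_eq; apply/eqP.
rewrite !rmorph_sum /=.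
have E := @puz_pieri_field {fraction {poly int}} (FracField.tofrac 'X) _ _ l m v sm sv.
transitivity (\sum_(t : (size m).-tuple bool)
    pw (FracField.tofrac 'X) false m t * puz_bits {fraction {poly int}} l t v).
  by apply: eq_bigr => t _; rewrite rmorphM rmorph_pw /puz_bits rmorph_puz.
rewrite E.
- by apply: eq_bigr => t _; rewrite rmorphM rmorph_pw /puz_bits rmorph_puz.
- by rewrite tofrac_eq0 polyX_eq0.
- by rewrite -tofrac1 -tofracB tofrac_eq0 -polyC1 polyXsubC_eq0.
Qed.

(** * The row of puzzle coefficients at the unit *)

Section Unit.
Variable S : comNzRingType.
Local Notation colS := (@col S).
Local Notation puz := (@puz S).

Lemma sum_up_b b (F : state -> state -> S) :
  \sum_h \sum_a ((h, a, b) \in up_tiles)%:R * F h a =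
  match b with
  | (false, false) => F st0 st0 + F stG stG
  | (true, false) => F stG stRG + F stR st0
  | (true, true) => F stR stG + F st0 stRG
  | _ => 0
  end.
Proof.
rewrite !big_state; case: b => [[] []];
  by rewrite /= ?(mul0r, mul1r, addr0, add0r) // addrC.
Qed.

Lemma col_cons h a a1 s b K :
  colS h a (a1 :: s) b K =
  match h, a with
  | (false, false), (false, false) | (false, true), (false, true) =>
    colS st0 a1 s b (fun t => K (st0 :: t)) + colS stG a1 s b (fun t => K (stG :: t))
  | (false, true), (true, true) | (true, false), (false, false) =>
    colS stG a1 s b (fun t => K (stRG :: t)) + colS stR a1 s b (fun t => K (st0 :: t))
  | (true, false), (false, true) =>
    colS stR a1 s b (fun t => K (stG :: t)) + colS st0 a1 s b (fun t => K (stRG :: t))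
  | _, _ => 0
  end.
Proof.
rewrite [LHS]/=.
under eq_bigr => b1 _ do under eq_bigr => h1 _ do under eq_bigr => a2 _ do
  rewrite -mulrA.
under eq_bigr => b1 _ do under eq_bigr => h1 _ do rewrite -mulr_sumr.
under eq_bigr => b1 _ do rewrite -mulr_sumr sum_up_b.
rewrite big_state; case: h => [[] []]; case: a => [[] []];
  by rewrite /= ?(mul0r, mulr0, mul1r, addr0, add0r).
Qed.

(** In these cases no down-pointing tile has top edge [h] and right edge [a]. *)
Lemma col_dead h a s b K :
  match h, a with
  | (false, false), (false, true) | (false, false), (true, true)
  | (true, false), (true, true) | (false, true), (false, false) => True
  | _, _ => False
  end -> colS h a s b K = 0.
Proof.
case: s => [|a1 s].
  by case: h => [[] []]; case: a => [[] []]; case: b => [[] []] //=; rewrite mul0r.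
rewrite /= => H; rewrite big1 // => b1 _; rewrite big1 // => h1 _; rewrite big1 // => a2 _.
by case: h a b1 H => [[] []] [[] []] [[] []] //=; rewrite !mul0r.
Qed.

Lemma col_nil h a b K : colS h a [::] b K = ((h, a, b) \in down_tiles)%:R * K [::].
Proof. by []. Qed.

Local Arguments col : simpl never.
Local Notation L := left_state.
Let G k := nseq k stG.
Let O m := nseq m st0.

Lemma col_00 m x K :
  colS st0 st0 (O m) (L x) K = if x then K (O m) else 0.
Proof.
elim: m K => [|m IH] K; first by case: x; rewrite [LHS]col_nil /= ?mul1r ?mul0r.
by rewrite [O _.+1]/= col_cons /= IH (@col_dead stG) // addr0.
Qed.

Lemma col_R0 m x K :
  colS stR st0 (O m) (L x) K = if x then 0 else K (O m).
Proof.
elim: m K => [|m IH] K; first by case: x; rewrite [LHS]col_nil /= ?mul1r ?mul0r.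
by rewrite [O _.+1]/= col_cons /= IH (@col_dead stG) // add0r.
Qed.

Lemma col_GG k m x K :
  colS stG stG (G k ++ O m) (L x) K
  = if x then K (G k ++ O m) else 0.
Proof.
elim: k K => [|k IH] K.
  case: m => [|m]; first by case: x; rewrite [LHS]col_nil /= ?mul1r ?mul0r.
  rewrite {1}/G [O _.+1]/= col_cons /= col_00 (@col_dead stG) // addr0.
  by [].
by rewrite [G _.+1]/= cat_cons col_cons /= IH (@col_dead st0) // add0r.
Qed.

Lemma col_RG k m x K :
  colS stR stG (G k ++ O m) (L x) K
  = if m is m1.+1 then
      if x then K (G k ++ stRG :: O m1) else K (G k.+1 ++ O m1)
    else 0.
Proof.
elim: k K => [|k IH] K.
  case: m => [|m]; first by case: x; rewrite [LHS]col_nil /= ?mul1r ?mul0r.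
  rewrite {1}/G [O _.+1]/= col_cons /= col_00 col_R0.
  by case: x; rewrite ?add0r ?addr0.
rewrite [G _.+1]/= cat_cons col_cons /= IH (@col_dead st0) // addr0.
by case: m {IH}.
Qed.

(** The right side of this strip is [G k ++ stRG :: O m]; the match on [k] only exposes its first
    edge. *)
Lemma col_G_RG k m x K :
  (if k is k1.+1 then colS stG stG (G k1 ++ stRG :: O m) (L x) K
   else colS stG stRG (O m) (L x) K)
  = if x then 0 else K (G k ++ O m).
Proof.
elim: k K => [|k IH] K.
  case: m => [|m]; first by case: x; rewrite [LHS]col_nil /= ?mul1r ?mul0r.
  rewrite [O _.+1]/= col_cons /= col_R0 (@col_dead stG) //.
  by case: x; rewrite ?addr0 ?add0r.
case: k IH => [|k] IH.
  by rewrite [G 0]/= cat0s col_cons /= IH (@col_dead st0) // add0r.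
by rewrite [G _.+1]/= cat_cons col_cons /= IH (@col_dead st0) // add0r.
Qed.

Lemma col_R_RG k m b K :
  (if k is k1.+1 then colS stR stG (G k1 ++ stRG :: O m) b K
   else colS stR stRG (O m) b K) = 0.
Proof.
elim: k K => [|k IH] K; first by rewrite col_dead.
case: k IH => [|k] IH.
  by rewrite [G 0]/= cat0s col_cons /= IH (@col_dead st0) // addr0.
by rewrite [G _.+1]/= cat_cons col_cons /= IH (@col_dead st0) // addr0.
Qed.

(** The right sides that arise when strips are peeled off a puzzle with right side G^k 0^m; the
    state RG marks a carry in the sense of [pw]. *)
Definition unit_state (c : bool) (k m : nat) : seq state :=
  if c then G k ++ stRG :: O m else G k ++ O m.

(** The top state and the final left state leave at most one filling of a strip, and its left side
    is again a [unit_state], so the peeling follows the recursion of [pw]. At u = 1 the coefficient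
    u - 1 vanishes, in accordance with the absence of a filling when a carry meets an up-step. *)
Lemma puz_unit (c : bool) l v m : size v = size l ->
  (c + count id l + m = size l)%N ->
  puz (map L l) (map top_state v) (unit_state c (count id l) m) = pw 1 c l v.
Proof.
elim: l v c m => [|x l IH] [|y v] c m // => [_|[sv]].
  by case: c m => [] [].
have cl := count_size id l.
case: c => /= szl.
  have {szl} szl : (x + count id l + m = size l)%N by lia.
  have splitE (F : state -> seq state -> S) :
    (if G (x + count id l) ++ stRG :: O m is a :: s1 then F a s1 else 0)
    = if (x + count id l)%N is k1.+1
      then F stG (G k1 ++ stRG :: O m) else F stRG (O m).
    by case: (x + count id l)%N.
  rewrite (splitE (fun a s1 => colS (top_state y) a s1 (L x) _)).
  case: y => /=; last by rewrite col_R_RG; case: x {szl splitE}.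
  rewrite col_G_RG; case: x szl {splitE} => szl; first by rewrite subrr mul0r.
  by rewrite -(IH v false m).
case E : (x + count id l)%N => [|k].
  have x0 : x = false by case: x E {szl}.
  subst x; rewrite /= add0n in E.
  case: m szl => [|m] szl; first by lia.
  rewrite [G 0]/= [O _.+1]/= cat0s.
  case: y => /=; first by rewrite col_dead.
  by rewrite (col_R0 m false) -(IH v false m sv) ?E //; lia.
rewrite [G _.+1]/= cat_cons; case: y => /=.
  rewrite col_GG; case: x szl E => szl E //.
  have {}E : count id l = k by lia.
  by rewrite -(IH v false m) ?E //; lia.
rewrite col_RG; case: m szl => [|m] szl.
  case: x szl E => szl E; last by lia.
  rewrite mul1r; apply/esym/eqP; apply: contraT => /pw_count Ev.
  by have := count_size id v; lia.
case: x szl E => szl E.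
  have {}E : count id l = k by lia.
  by rewrite mul1r -(IH v true m) /= ?E //; lia.
have {}E : count id l = k.+1 by lia.
by rewrite -(IH v false m) /= ?E //; lia.
Qed.

Lemma puz_bits_unit l v : size v = size l ->
  puz_bits S l (nseq (count id l) true ++ nseq (size l - count id l) false) v
  = pw 1 false l v.
Proof.
move=> sv; have cl := count_size id l.
rewrite -(@puz_unit false l v (size l - count id l)) //; last by lia.
by rewrite /puz_bits map_cat !map_nseq.
Qed.
End Unit.

(** * Puzzles as column sums *)

Definition tile0 : tile := (st0, st0, st0).

Section Lookup.
Variables (n : nat) (P : pred ('I_n * 'I_n)).

(** The value [tile0] off the domain is only a default, which allows natural numbers as
    coordinates. *)
Definition look (f : {ffun {p | P p} -> tile}) (r c : nat) : tile :=
  if insub r is Some i then if insub c is Some j then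
    if insub (i, j) is Some d then f d else tile0 else tile0 else tile0.

Definition mk (F : nat -> nat -> tile) : {ffun {p | P p} -> tile} :=
  [ffun d => F (strip d) (place d)].

Lemma lookE f (d : {p | P p}) : look f (strip d) (place d) = f d.
Proof.
case: d => -[i j] Pd; rewrite /look /strip /place /= !valK.
case: insubP => [e _ ve|]; last by rewrite Pd.
by congr (f _); apply: val_inj.
Qed.

Lemma mkK f : mk (look f) = f.
Proof. by apply/ffunP=> d; rewrite ffunE lookE. Qed.

Lemma look_mk (F : nat -> nat -> tile) (i j : 'I_n) : P (i, j) -> look (mk F) i j = F i j.
Proof.
move=> Pij; have := lookE (mk F) (Sub (i, j) Pij).
by rewrite /strip /place SubK /= ffunE /strip /place SubK.
Qed.

Lemma eq_mk (F G : nat -> nat -> tile) :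
  (forall i j : 'I_n, P (i, j) -> F i j = G i j) -> mk F = mk G.
Proof.
move=> eFG; apply/ffunP=> -[[i j] Pij]; rewrite !ffunE /strip /place /=.
exact: eFG.
Qed.

End Lookup.

Section Count.

(* The right side is indexed by strips, from the top. *)
Definition puzzle_at n (L M N : nat -> state) (D U : nat -> nat -> tile) : Prop :=
  [/\ forall r c, (r + c < n)%N -> D r c \in down_tiles,
      forall r c, ((r + c).+1 < n)%N ->
        [/\ U r c \in up_tiles, edge_a (D r c) = edge_a (U r c),
            edge_b (D r c.+1) = edge_b (U r c) & edge_h (D r.+1 c) = edge_h (U r c)]
    & forall r, (r < n)%N ->
        [/\ edge_b (D r 0) = L r, edge_a (D r (n.-1 - r)%N) = M r
          & edge_h (D 0 r) = N r]].

Definition boundary_at n (L M N : nat -> state) (T : tiling n) : bool :=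
  [forall d : down_tri n,
    [&& (place d == 0 :> nat) ==> (edge_b (T.1 d) == L (strip d)),
        ((strip d + place d).+1 == n)%N ==> (edge_a (T.1 d) == M (strip d))
      & (strip d == 0 :> nat) ==> (edge_h (T.1 d) == N (place d))]].

Definition tiling_at n L M N (T : tiling n) : bool :=
  is_puzzle T && boundary_at L M N T.

Definition count_at n L M N : nat := #|[set T : tiling n | tiling_at L M N T]|.

Definition mk_tiling n (D U : nat -> nat -> tile) : tiling n := (mk _ D, mk _ U).

Lemma tiling_atP n L M N D U :
  reflect (puzzle_at n L M N D U) (tiling_at L M N (mk_tiling n D U)).
Proof.
pose dn r c (H : (r + c < n)%N) (Hr : (r < n)%N) (Hc : (c < n)%N) : down_tri n :=
  Sub (Ordinal Hr, Ordinal Hc) H.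
pose up r c (H : ((r + c).+1 < n)%N) (Hr : (r < n)%N) (Hc : (c < n)%N) : up_tri n :=
  Sub (Ordinal Hr, Ordinal Hc) H.
apply: (iffP andP) => [[/and3P[/forallP dP /forallP uP /forallP aP] /forallP bP]|[dP uP bP]].
  split=> [r c H|r c H|r Hr].
  - have Hr : (r < n)%N by lia.
    have Hc : (c < n)%N by lia.
    by have := dP (dn r c H Hr Hc); rewrite /= ffunE.
  - have Hr : (r < n)%N by lia.
    have Hc : (c < n)%N by lia.
    have Hr1 : (r.+1 < n)%N by lia.
    have Hc1 : (c.+1 < n)%N by lia.
    have H0 : (r + c < n)%N by lia.
    have H1 : (r + c.+1 < n)%N by lia.
    have H2 : (r.+1 + c < n)%N by lia.
    have := uP (up r c H Hr Hc); have /forallP aP' := aP (up r c H Hr Hc).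
    have /and3P[/implyP A1 _ _] := aP' (dn r c H0 Hr Hc).
    have /and3P[_ /implyP A2 _] := aP' (dn r c.+1 H1 Hr Hc1).
    have /and3P[_ _ /implyP A3] := aP' (dn r.+1 c H2 Hr1 Hc).
    rewrite /= !ffunE /strip /place /= in A1 A2 A3 *.
    by split=> //; apply/eqP; [apply: A1 | apply: A2 | apply: A3]; rewrite !eqxx.
  - have H0 : (r + 0 < n)%N by lia.
    have Hn : (0 < n)%N by lia.
    have H1 : (r + (n.-1 - r) < n)%N by lia.
    have H1' : (n.-1 - r < n)%N by lia.
    have H2 : (0 + r < n)%N by lia.
    have /and3P[/implyP B1 _ _] := bP (dn r 0 H0 Hr Hn).
    have /and3P[_ /implyP B2 _] := bP (dn r (n.-1 - r)%N H1 Hr H1').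
    have /and3P[_ _ /implyP B3] := bP (dn 0 r H2 Hn Hr).
    rewrite /= !ffunE /strip /place /= in B1 B2 B3 *.
    split; apply/eqP; [exact: B1 | apply: B2 | exact: B3].
    by apply/eqP; lia.
split; last first.
  apply/forallP=> -[[i j] Hij]; rewrite /= ffunE /strip /place /=.
  have {}Hij : (i + j < n)%N := Hij.
  apply/and3P; split; apply/implyP=> /eqP E; apply/eqP.
  - by rewrite E; have [-> _ _] := bP i (ltn_ord i).
  - by have [_ <- _] := bP i (ltn_ord i); congr (edge_a (D _ _)); lia.
  - by rewrite E; have [_ _ ->] := bP j (ltn_ord j).
apply/and3P; split.
- by apply/forallP=> -[[i j] Hij]; rewrite /= ffunE; apply: dP.
- by apply/forallP=> -[[i j] Hij]; rewrite /= ffunE; have [] := uP i j Hij.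
apply/forallP=> -[[i j] Hij]; apply/forallP=> -[[i' j'] Hij'].
rewrite /= !ffunE /strip /place /=; have [_ A1 A2 A3] := uP i j Hij.
by apply/and3P; split; apply/implyP=> /andP[/eqP -> /eqP ->]; apply/eqP.
Qed.

Lemma tilingE n (T : tiling n) : mk_tiling n (look T.1) (look T.2) = T.
Proof. by case: T => D U; rewrite /mk_tiling !mkK. Qed.

(** The strip r + c = n along the right side, its triangles indexed by r alone; M' is its left side,
    hence the right side of the remaining triangle of side n. *)
Definition column_at n (L M N : nat -> state) (M' : nat -> state)
    (D U : nat -> tile) : Prop :=
  [/\ forall r, (r <= n)%N -> D r \in down_tiles /\ edge_a (D r) = M r,
      forall r, (r < n)%N ->
        [/\ U r \in up_tiles, edge_b (D r) = edge_b (U r),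
          edge_h (D r.+1) = edge_h (U r) & edge_a (U r) = M' r],
      edge_h (D 0) = N n & edge_b (D n) = L n].

Lemma puzzle_at_split n L M N D U :
  puzzle_at n.+1 L M N D U <->
  exists M', column_at n L M N M' (fun r => D r (n - r)%N) (fun r => U r (n.-1 - r)%N)
             /\ puzzle_at n L M' N D U.
Proof.
split=> [[dP uP bP]|[M' [[dP1 uP1 hP bP] [dP2 uP2 bP2]]]].
  exists (fun r => edge_a (U r (n.-1 - r)%N)); split; split.
  - move=> r rn; split; first by apply: dP; lia.
    by have [|_ <- _] := bP r; first lia.
  - move=> r rn; have [|? A1 A2 A3] := uP r (n.-1 - r)%N; first lia.
    split=> //.
      by rewrite -A2; congr (edge_b (D _ _)); lia.
    by rewrite -A3; congr (edge_h (D _ _)); lia.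
  - by rewrite subn0; have [|_ _ ->] := bP n.
  - by rewrite subnn; have [|-> _ _] := bP n.
  - by move=> r c H; apply: dP; lia.
  - by move=> r c H; apply: uP; lia.
  - move=> r rn; have [|B1 B2 B3] := bP r; first lia.
    by split=> //; have [|] := uP r (n.-1 - r)%N; first lia.
split.
- move=> r c H; have [E|E] := eqVneq (r + c)%N n; last by apply: dP2; lia.
  by have [|] := dP1 r; first lia; have -> : (n - r)%N = c by lia.
- move=> r c H; have [E|E] := eqVneq (r + c).+1 n; last by apply: uP2; lia.
  have rn : (r < n)%N by lia.
  have [] := uP1 r rn.
  have -> : (n.-1 - r)%N = c by lia.
  have -> : (n - r)%N = c.+1 by lia.
  have -> : (n - r.+1)%N = c by lia.
  move=> ? A2 A3 A1; split=> //.
  have [_ B2 _] := bP2 r rn; rewrite A1 -B2; congr (edge_a (D _ _)); lia.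
move=> r rn; split.
- have [E|E] := eqVneq r n; first by rewrite E -bP subnn.
  by have [|->] := bP2 r; first lia.
- by have [|_ <-] := dP1 r; first lia.
have [E|E] := eqVneq r n; first by rewrite E -hP subn0.
by have [|_ _ ->] := bP2 r; first lia.
Qed.

Lemma look_mk_down n F r c : (r + c < n)%N ->
  look (mk (fun p : 'I_n * 'I_n => (p.1 + p.2 < n)%N) F) r c = F r c.
Proof.
move=> H; have Hr : (r < n)%N by lia.
have Hc : (c < n)%N by lia.
exact: (@look_mk n (fun p => (p.1 + p.2 < n)%N) F (Ordinal Hr) (Ordinal Hc)).
Qed.

Lemma look_mk_up n F r c : ((r + c).+1 < n)%N ->
  look (mk (fun p : 'I_n * 'I_n => ((p.1 + p.2).+1 < n)%N) F) r c = F r c.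
Proof.
move=> H; have Hr : (r < n)%N by lia.
have Hc : (c < n)%N by lia.
exact: (@look_mk n (fun p => ((p.1 + p.2).+1 < n)%N) F (Ordinal Hr) (Ordinal Hc)).
Qed.

Definition glue n (x : n.+1.-tuple tile * n.-tuple tile * tiling n) : tiling n.+1 :=
  mk_tiling n.+1
    (fun r c => if (r + c)%N == n then nth tile0 x.1.1 r else look x.2.1 r c)
    (fun r c => if (r + c).+1 == n then nth tile0 x.1.2 r else look x.2.2 r c).

Definition unglue n (T : tiling n.+1) : n.+1.-tuple tile * n.-tuple tile * tiling n :=
  ([tuple look T.1 r (n - r) | r < n.+1], [tuple look T.2 r (n.-1 - r) | r < n],
   mk_tiling n (look T.1) (look T.2)).

Lemma glueK n : cancel (@glue n) (@unglue n).
Proof.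
move=> [[D U] T]; rewrite /unglue /glue /mk_tiling /=; congr (_, _, _).
- apply: eq_from_tnth => r; rewrite tnth_mktuple look_mk_down; last by have := ltn_ord r; lia.
  rewrite ifT ?(tnth_nth tile0) //; apply/eqP; have := ltn_ord r; lia.
- apply: eq_from_tnth => r; rewrite tnth_mktuple look_mk_up; last by have := ltn_ord r; lia.
  rewrite ifT ?(tnth_nth tile0) //; apply/eqP; have := ltn_ord r; lia.
rewrite -[RHS]tilingE; congr (_, _); apply: eq_mk => i j H /=.
  have {}H : (i + j < n)%N := H.
  by rewrite look_mk_down ?ifF //; [apply/eqP; lia | lia].
have {}H : ((i + j).+1 < n)%N := H.
by rewrite look_mk_up ?ifF //; [apply/eqP; lia | lia].
Qed.

Lemma unglueK n : cancel (@unglue n) (@glue n).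
Proof.
move=> T; rewrite -[RHS]tilingE /unglue /glue /mk_tiling /=.
congr (_, _); apply: eq_mk => i j H.
  have {}H : (i + j < n.+1)%N := H.
  case: eqP => E; last by rewrite look_mk_down //; lia.
  rewrite (nth_map i) ?size_enum_ord // nth_ord_enum; congr (look _ _ _); lia.
have {}H : ((i + j).+1 < n.+1)%N := H.
case: eqP => E; last by rewrite look_mk_up //; lia.
have Hi : (i < n)%N by lia.
rewrite (nth_map (Ordinal Hi)) ?size_enum_ord // (nth_ord_enum _ (Ordinal Hi)) /=.
congr (look _ _ _); lia.
Qed.

Fixpoint column (h : state) (D U : seq tile) (s : seq state) (b : state) : bool :=
  match U, D, s with
  | e :: U1, d :: D1, a :: s1 =>
    [&& d \in down_tiles, edge_h d == h, edge_a d == a, e \in up_tiles,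
        edge_b e == edge_b d & column (edge_h e) D1 U1 s1 b]
  | [::], [:: d], [:: a] =>
    [&& d \in down_tiles, edge_h d == h, edge_a d == a & edge_b d == b]
  | _, _, _ => false
  end.

Lemma column_cons h d D e U a s b : column h (d :: D) (e :: U) (a :: s) b =
  [&& d \in down_tiles, edge_h d == h, edge_a d == a, e \in up_tiles,
      edge_b e == edge_b d & column (edge_h e) D U s b].
Proof. reflexivity. Qed.

Lemma column_nil h d a b : column h [:: d] [::] [:: a] b =
  [&& d \in down_tiles, edge_h d == h, edge_a d == a & edge_b d == b].
Proof. by []. Qed.

Lemma columnP n h b M D U : size D = n.+1 -> size U = n ->
  reflect ([/\ forall r, (r <= n)%N ->
                 nth tile0 D r \in down_tiles /\ edge_a (nth tile0 D r) = M r,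
               forall r, (r < n)%N ->
                 [/\ nth tile0 U r \in up_tiles,
                     edge_b (nth tile0 D r) = edge_b (nth tile0 U r)
                   & edge_h (nth tile0 D r.+1) = edge_h (nth tile0 U r)],
               edge_h (nth tile0 D 0) = h & edge_b (nth tile0 D n) = b])
    (column h D U (mkseq M n.+1) b).
Proof.
elim: n h M D U => [|n IH] h M [|d D] [|e U] // sD sU.
  case: D sD => // _; apply: (iffP and4P) => [[? /eqP ? /eqP ? /eqP ?]|[dP _ <- <-]].
    by split=> // -[] //.
  by have [|? ->] := dP 0; rewrite // !eqxx.
case: sD sU => sD [sU].
rewrite /mkseq [iota _ _]/= [map _ _]/= (iotaDl 1) -map_comp -/(mkseq _ _).
rewrite column_cons.
apply: (iffP idP) => [/and5P[? /eqP ? /eqP ? ? /andP[/eqP ? /IH]]|].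
  move=> /(_ sD sU) [dP uP hP bP]; split=> //.
    by move=> [|r] rn //; apply: dP.
  by move=> [|r] rn //; apply: uP.
move=> [dP uP hP bP]; have /= [dd da] := dP 0 isT; have /= [uu ub uh] := uP 0 isT.
rewrite dd uu da ub hP !eqxx /=; apply/IH => //; split=> //.
  by move=> r rn; apply: (dP r.+1).
by move=> r rn; apply: (uP r.+1).
Qed.

Lemma count_atE n L M N :
  count_at n L M N = (\sum_(T : tiling n) tiling_at L M N T)%N.
Proof. by rewrite /count_at -sum1dep_card big_mkcond /=. Qed.

Lemma eq_column_at n L M N M1 M2 D1 D2 U1 U2 :
  (forall r, (r <= n)%N -> D1 r = D2 r) -> (forall r, (r < n)%N -> U1 r = U2 r) ->
  (forall r, (r < n)%N -> M1 r = M2 r) ->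
  column_at n L M N M1 D1 U1 -> column_at n L M N M2 D2 U2.
Proof.
move=> eD eU eM [dP uP hP bP]; split; rewrite -?eD //.
  by move=> r rn; rewrite -eD //; apply: dP.
by move=> r rn; rewrite -!eD -?eU -?eM //; [apply: uP | lia].
Qed.

Lemma eq_puzzle_at n L N M1 M2 D1 D2 U1 U2 :
  (forall r, (r < n)%N -> M1 r = M2 r) ->
  (forall r c, (r + c < n)%N -> D1 r c = D2 r c) ->
  (forall r c, ((r + c).+1 < n)%N -> U1 r c = U2 r c) ->
  puzzle_at n L M1 N D1 U1 -> puzzle_at n L M2 N D2 U2.
Proof.
move=> eM eD eU [dP uP bP]; split.
- by move=> r c rc; rewrite -eD //; apply: dP.
- by move=> r c rc; rewrite -!eD -?eU //; try apply: uP; lia.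
by move=> r rn; rewrite -!eD -?eM //; try apply: bP; lia.
Qed.

Lemma count_at_column n L M N :
  count_at n.+1 L M N = (\sum_(D : n.+1.-tuple tile) \sum_(U : n.-tuple tile)
    column (N n) D U (mkseq M n.+1) (L n)
    * count_at n L (fun r => edge_a (nth tile0 U r)) N)%N.
Proof.
rewrite count_atE (reindex (@glue n)) /=; last first.
  by exists (@unglue n) => x _; rewrite ?glueK ?unglueK.
rewrite [RHS]pair_bigA /=.
transitivity (\sum_(p : n.+1.-tuple tile * n.-tuple tile) \sum_(T : tiling n)
    nat_of_bool (tiling_at L M N (glue (p, T))))%N.
  by rewrite pair_bigA /=; apply: eq_bigr => -[p T].
apply: eq_bigr => -[D U] _ /=.
rewrite count_atE big_distrr /=; apply: eq_bigr => T _.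
have H := columnP (N n) (L n) M (size_tuple D) (size_tuple U).
rewrite mulnb; congr nat_of_bool; rewrite -[T in RHS]tilingE.
have eD r : (r <= n)%N -> (if (r + (n - r))%N == n then nth tile0 D r
    else look T.1 r (n - r)) = nth tile0 D r by move=> rn; rewrite ifT //; apply/eqP; lia.
have eU r : (r < n)%N -> (if (r + (n.-1 - r)).+1 == n then nth tile0 U r
    else look T.2 r (n.-1 - r)) = nth tile0 U r by move=> rn; rewrite ifT //; apply/eqP; lia.
apply/tiling_atP/andP => [/puzzle_at_split[M' [cP pP]]|[/H[dP uP hP bP] /tiling_atP pP]].
  have {cP} [dP uP hP bP] := eq_column_at eD eU (fun r _ => erefl) cP.
  split; first by apply/H; split=> // r rn; have [] := uP r rn.
  apply/tiling_atP; apply: eq_puzzle_at pP => [r rn|r c rc|r c rc] /=.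
  - by have [] := uP r rn.
  - by rewrite ifF //; apply/eqP; lia.
  - by rewrite ifF //; apply/eqP; lia.
apply/puzzle_at_split; exists (fun r => edge_a (nth tile0 U r)); split.
  apply: (@eq_column_at _ _ _ _ (fun r => edge_a (nth tile0 U r)) _ (nth tile0 D) _ (nth tile0 U))
    => [r rn|r rn|r rn|] //.
  - by rewrite /= eD.
  - by rewrite /= eU.
  - by split=> // r rn; have [] := uP r rn.
apply: eq_puzzle_at pP => [r rn|r c rc|r c rc] //=.
- by rewrite ifF //; apply/eqP; lia.
- by rewrite ifF //; apply/eqP; lia.
Qed.

Lemma sum_tile (F : tile -> int) : \sum_t F t = \sum_h \sum_a \sum_b F (h, a, b).
Proof.
rewrite pair_bigA /= [RHS]pair_bigA /=.
by apply: eq_bigr => -[[h a] b].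
Qed.

Lemma sum_down_tile h a (F : state -> int) :
  \sum_t [&& t \in down_tiles, edge_h t == h & edge_a t == a]%:R * F (edge_b t)
  = \sum_b ((h, a, b) \in down_tiles)%:R * F b.
Proof.
rewrite sum_tile (@big_only1 _ _ _ _ h) => [|//|h' nh _]; last first.
  by apply: big1 => a' _; apply: big1 => b _; rewrite /edge_h /= (negPf nh) andbF mul0r.
rewrite (@big_only1 _ _ _ _ a) => [|//|a' na _]; last first.
  by apply: big1 => b _; rewrite /edge_a /= (negPf na) !andbF mul0r.
by apply: eq_bigr => b _; rewrite /edge_h /edge_a !eqxx !andbT.
Qed.

Lemma sum_up_tile b (F : state -> state -> int) :
  \sum_t [&& t \in up_tiles & edge_b t == b]%:R * F (edge_h t) (edge_a t)
  = \sum_h \sum_a ((h, a, b) \in up_tiles)%:R * F h a.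
Proof.
rewrite sum_tile; apply: eq_bigr => h _; apply: eq_bigr => a _.
rewrite (@big_only1 _ _ _ _ b) => [|//|b' nb _]; last first.
  by rewrite /edge_b /= (negPf nb) !andbF mul0r.
by rewrite /edge_b eqxx andbT.
Qed.

(** A tile is determined by its three edge states, so the sums over tiles collapse to sums over the
    free edges, which is what [col] computes. *)
Lemma column_sum n h a s b (K : seq state -> int) : size s = n ->
  \sum_(D : n.+1.-tuple tile) \sum_(U : n.-tuple tile)
     (column h D U (a :: s) b)%:R * K (map edge_a U)
  = col h a s b K.
Proof.
elim: n h a s K => [|n IH] h a [|a1 s] K // => [_|[ss]].
  rewrite (big_tuple_cons 0 (fun D => \sum_(U : 0.-tuple tile)
     (column h D U [:: a] b)%:R * K (map edge_a U))).
  under eq_bigr => d _ do rewrite (big_tuple_nil (fun D => \sum_(U : 0.-tuple tile)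
     (column h (d :: D) U [:: a] b)%:R * K (map edge_a U))).
  under eq_bigr => d _ do rewrite (big_tuple_nil (fun U =>
     (column h [:: d] U [:: a] b)%:R * K (map edge_a U))).
  rewrite [LHS](_ : _ = \sum_d [&& d \in down_tiles, edge_h d == h & edge_a d == a]%:R
     * ((edge_b d == b)%:R * K [::])); last first.
    by apply: eq_bigr => d _; rewrite column_nil mulrA -natrM mulnb -!andbA.
  rewrite (sum_down_tile h a (fun b1 => (b1 == b)%:R * K [::])).
  rewrite (@big_only1 _ _ _ _ b) ?eqxx ?mul1r // => b1 /negPf -> _.
  by rewrite mul0r mulr0.
rewrite (big_tuple_cons n.+1 (fun D => \sum_(U : n.+1.-tuple tile)
     (column h D U [:: a, a1 & s] b)%:R * K (map edge_a U))).
transitivity (\sum_d [&& d \in down_tiles, edge_h d == h & edge_a d == a]%:R *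
   \sum_e [&& e \in up_tiles & edge_b e == edge_b d]%:R *
     col (edge_h e) a1 s b (fun t => K (edge_a e :: t))).
  apply: eq_bigr => d _.
  under eq_bigr => D _ do rewrite (big_tuple_cons n (fun U =>
     (column h (d :: D) U [:: a, a1 & s] b)%:R * K (map edge_a U))).
  rewrite exchange_big mulr_sumr; apply: eq_bigr => e _.
  rewrite -(IH _ _ _ _ ss) !mulr_sumr; apply: eq_bigr => D _.
  rewrite !mulr_sumr; apply: eq_bigr => U _.
  rewrite column_cons map_cons !mulrA; congr (_ * _).
  by rewrite -!natrM !mulnb -!andbA.
rewrite (sum_down_tile h a (fun b1 => \sum_e [&& e \in up_tiles & edge_b e == b1]%:R *
     col (edge_h e) a1 s b (fun t => K (edge_a e :: t)))) [RHS]/=.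
apply: eq_bigr => b1 _.
rewrite (sum_up_tile b1 (fun h1 a2 => col h1 a1 s b (fun t => K (a2 :: t)))).
rewrite mulr_sumr; apply: eq_bigr => h1 _; rewrite mulr_sumr.
by apply: eq_bigr => a2 _; rewrite mulrA.
Qed.

Lemma count_at0 L M N : count_at 0 L M N = 1%N.
Proof.
rewrite count_atE.
have e0 (P : pred ('I_0 * 'I_0)) : #|{: {p | P p}}| = 0%N.
  by apply: eq_card0 => -[[[]]].
have /card1P[T0 T0P] : #|{: tiling 0}| == 1%N by rewrite card_prod !card_ffun !e0.
rewrite (@big_only1 _ _ _ _ T0) // => [|T nT _]; last first.
  have : T \in pred1 T0 by rewrite -T0P.
  by rewrite inE (negPf nT).
suff -> : tiling_at L M N T0 by [].
by apply/andP; split; [apply/and3P; split|]; apply/forallP=> -[[[]]].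
Qed.

Lemma count_atP n L M N :
  (count_at n L M N)%:R
  = puz int (rev (mkseq L n)) (rev (mkseq N n)) (mkseq M n).
Proof.
elim: n M => [|n IH] M; first by rewrite count_at0.
rewrite count_at_column !mkseqS !rev_rcons -mkseqS /mkseq [iota 0 n.+1]/= map_cons /=.
rewrite -(column_sum (n := n)) ?size_map ?size_iota //.
rewrite natr_sum; apply: eq_bigr => D _; rewrite natr_sum; apply: eq_bigr => U _.
rewrite natrM IH; congr (_ * puz _ _ _ _).
by apply: (@eq_from_nth _ st0); rewrite !size_map ?size_iota ?size_tuple // => i Hi;
  rewrite !(nth_map 0%N) ?size_iota // (nth_map tile0) ?size_tuple // nth_iota.
Qed.

Definition bits n (A : {set 'I_n}) : seq bool := [seq i \in A | i <- enum 'I_n].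

Lemma size_bits n (A : {set 'I_n}) : size (bits A) = n.
Proof. by rewrite size_map size_enum_ord. Qed.

Lemma nth_bits n (A : {set 'I_n}) (i : 'I_n) : nth false (bits A) i = (i \in A).
Proof. by rewrite (nth_map i) ?size_enum_ord // nth_ord_enum. Qed.

(** The right boundary is prescribed from the bottom while [count_at] reads it from the top; thus
    all three bit strings are reversed. *)
Lemma card_puzzles n (l m v : {set 'I_n}) :
  #|puzzles l m v|%:R = puz_bits int (rev (bits l)) (rev (bits m)) (rev (bits v)).
Proof.
pose L (A : {set 'I_n}) (f : bool -> state) r := f (nth false (bits A) r).
have mkE A f : mkseq (L A f) n = map f (bits A).
  by rewrite -[in RHS](mkseq_nth false (bits A)) size_bits -map_comp.
rewrite /puz_bits !map_rev -!mkE.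
rewrite (_ : rev (mkseq (L m right_state) n)
  = mkseq (fun r => L m right_state (n.-1 - r)%N) n); last first.
  apply: (@eq_from_nth _ st0); rewrite ?size_rev !size_mkseq // => i Hi.
  rewrite nth_rev size_mkseq // !nth_mkseq //; last by lia.
  by rewrite /L; congr (right_state (nth _ _ _)); lia.
rewrite -count_atP /count_at; congr (_%:R).
apply: eq_card=> T; rewrite !inE /tiling_at; congr (_ && _).
apply/eq_forallb=> d; rewrite /L !nth_bits.
rewrite /left_state /right_state /top_state; congr [&& _, _ & _].
case: eqP => // E; rewrite !implyTb; congr (_ == _).
by rewrite -nth_bits; congr (if nth _ _ _ then _ else _); lia.
Qed.

End Count.

(** * Values of rational functions *)

(* The partial morphism F -> L that extends b : R -> L along a : R -> F. *)
Section PartialValue.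
Variables (R : comNzRingType) (F L : fieldType).
Variables (a : {rmorphism R -> F}) (b : {rmorphism R -> L}).
Hypothesis a_inj : injective a.

Definition value_at (f : F) (c : L) : Prop :=
  exists p q : R, [/\ f * a q = a p, b q != 0 & c * b q = b p].

Lemma value_at_inj f c d : value_at f c -> value_at f d -> c = d.
Proof.
move=> [p [q [fq q0 cq]]] [p' [q' [fq' q0' dq]]].
have E : p * q' = p' * q.
  by apply: a_inj; rewrite !rmorphM -fq -fq'; ring.
apply: (mulIf q0); apply: (mulIf q0'); rewrite cq -rmorphM E rmorphM -dq.
by rewrite mulrAC.
Qed.

Lemma value_at_morph p : value_at (a p) (b p).
Proof. by exists p, 1; rewrite !rmorph1 !mulr1 oner_neq0. Qed.

Lemma value_atD f g c d : value_at f c -> value_at g d -> value_at (f + g) (c + d).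
Proof.
move=> [p [q [fq q0 cq]]] [p' [q' [gq q0' dq]]].
exists (p * q' + p' * q), (q * q'); rewrite !rmorphD !rmorphM mulf_neq0 //.
by rewrite -fq -gq -cq -dq; split=> //; ring.
Qed.

Lemma value_atM f g c d : value_at f c -> value_at g d -> value_at (f * g) (c * d).
Proof.
move=> [p [q [fq q0 cq]]] [p' [q' [gq q0' dq]]].
exists (p * p'), (q * q'); rewrite !rmorphM mulf_neq0 //.
by rewrite -fq -gq -cq -dq; split=> //; ring.
Qed.

Lemma value_atN f c : value_at f c -> value_at (- f) (- c).
Proof.
by move=> [p [q [fq q0 cq]]]; exists (- p), q; rewrite !rmorphN !mulNr fq cq.
Qed.

Lemma value_atV f c : c != 0 -> value_at f c -> value_at f^-1 c^-1.
Proof.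
move=> c0 [p [q [fq q0 cq]]]; exists q, p.
have p0 : b p != 0 by rewrite -cq mulf_neq0.
have f0 : f != 0.
  apply: contraNneq p0 => f0; move: fq; rewrite f0 mul0r -(rmorph0 a) => /a_inj <-.
  by rewrite rmorph0.
by split=> //; rewrite -?fq -?cq mulKf.
Qed.

End PartialValue.

Section Specialization.
Variables k n : nat.
Local Notation F := (ratfun k n).
Local Notation R := {mpoly int[k + n]}.
Local Notation tofrac := (@FracField.tofrac R).
Local Notation xvar := (@xvar k n).
Local Notation yvar := (@yvar k n).

Section AtPoint.
Variables (vx : 'I_k -> F) (vy : 'I_n -> F).
Local Notation ps := (poly_subst vx vy).

Lemma poly_subst_is_zmod_morphism : zmod_morphism ps.
Proof. by move=> p q; rewrite /poly_subst (mmapB _ (intmul 1 : {rmorphism int -> F})). Qed.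

Lemma poly_subst_is_monoid_morphism : monoid_morphism ps.
Proof.
have [h1 h2] := mmap_is_multiplicative
  (fun a => match split a with inl i => vx i | inr j => vy j end)
  (intmul 1 : {rmorphism int -> F}).
by split.
Qed.

HB.instance Definition _ := GRing.isZmodMorphism.Build R F ps poly_subst_is_zmod_morphism.
HB.instance Definition _ := GRing.isMonoidMorphism.Build R F ps poly_subst_is_monoid_morphism.

Lemma poly_subst_x i : ps 'X_(lshift n i) = vx i.
Proof.
rewrite /poly_subst (mmapX _ (intmul 1 : {rmorphism int -> F})) mmap1U.
by rewrite (unsplitK (inl i)).
Qed.

Lemma poly_subst_y j : ps 'X_(rshift k j) = vy j.
Proof.
rewrite /poly_subst (mmapX _ (intmul 1 : {rmorphism int -> F})) mmap1U.
by rewrite (unsplitK (inr j)).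
Qed.

Lemma tofrac_inj : injective tofrac.
Proof. by move=> p q /eqP; rewrite tofrac_eq => /eqP. Qed.

Definition has_value (f c : F) : Prop := value_at tofrac ps f c.

(** Reduces [rsubst] to the calculus of [has_value]: whatever [epsilon] returns is the value,
    because there is at most one. *)
Lemma rsubstP f c : has_value f c -> rsubst vx vy f = c.
Proof.
move=> fc.
have H := epsilon_spec (inhabits 0) (has_value f) (ex_intro _ c fc).
exact: (value_at_inj tofrac_inj H fc).
Qed.

Lemma has_value_poly p : has_value (tofrac p) (ps p).
Proof. exact: value_at_morph. Qed.

Lemma has_value_x i : has_value (xvar i) (vx i).
Proof. by rewrite -poly_subst_x; apply: has_value_poly. Qed.

Lemma has_value_y j : has_value (yvar j) (vy j).
Proof. by rewrite -poly_subst_y; apply: has_value_poly. Qed.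

Lemma has_value_int (z : int) : has_value z%:~R z%:~R.
Proof.
by rewrite -[X in has_value X](rmorph_int tofrac) -[X in has_value _ X](rmorph_int ps);
  apply: has_value_poly.
Qed.

Lemma has_value1 : has_value 1 1. Proof. exact: (has_value_int 1). Qed.

Lemma has_value0 : has_value 0 0. Proof. exact: (has_value_int 0). Qed.

Lemma has_valueD f g c d : has_value f c -> has_value g d -> has_value (f + g) (c + d).
Proof. exact: value_atD. Qed.

Lemma has_valueM f g c d : has_value f c -> has_value g d -> has_value (f * g) (c * d).
Proof. exact: value_atM. Qed.

Lemma has_valueN f c : has_value f c -> has_value (- f) (- c).
Proof. exact: value_atN. Qed.

Lemma has_valueB f g c d : has_value f c -> has_value g d -> has_value (f - g) (c - d).
Proof. by move=> fc gd; apply: has_valueD => //; apply: has_valueN. Qed.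

Lemma has_valueV f c : c != 0 -> has_value f c -> has_value f^-1 c^-1.
Proof. exact: (value_atV tofrac_inj). Qed.

Lemma has_value_div f g c d : d != 0 -> has_value f c -> has_value g d ->
  has_value (f / g) (c / d).
Proof. by move=> d0 fc gd; apply: has_valueM => //; apply: has_valueV. Qed.

Lemma has_valueX f c m : has_value f c -> has_value (f ^+ m) (c ^+ m).
Proof.
move=> fc; elim: m => [|m IH]; first exact: has_value1.
by rewrite !exprS; apply: has_valueM.
Qed.

Lemma has_value_sum (I : Type) (r : seq I) (P : pred I) (f c : I -> F) :
  (forall i, P i -> has_value (f i) (c i)) ->
  has_value (\sum_(i <- r | P i) f i) (\sum_(i <- r | P i) c i).
Proof.
move=> fc; elim/big_rec2: _ => [|i x y Pi]; first exact: has_value0.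
by apply: has_valueD; apply: fc.
Qed.

Lemma has_value_prod (I : Type) (r : seq I) (P : pred I) (f c : I -> F) :
  (forall i, P i -> has_value (f i) (c i)) ->
  has_value (\prod_(i <- r | P i) f i) (\prod_(i <- r | P i) c i).
Proof.
move=> fc; elim/big_rec2: _ => [|i x y Pi]; first exact: has_value1.
by apply: has_valueM; apply: fc.
Qed.

Lemma has_value_det m (A B : 'M[F]_m) :
  (forall i j, has_value (A i j) (B i j)) -> has_value (\det A) (\det B).
Proof.
move=> AB; rewrite /determinant; apply: has_value_sum => s _; apply: has_valueM.
  by have := has_value_int ((-1) ^+ s); rewrite rmorphXn /= rmorphN1.
by apply: has_value_prod => i _; apply: AB.
Qed.

Lemma has_value_horner (p q : {poly F}) f c : (forall i, has_value p`_i q`_i) ->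
  has_value f c -> has_value p.[f] q.[c].
Proof.
move=> pq fc; pose m := maxn (size p) (size q).
rewrite (@horner_coef_wide _ m) ?leq_maxl // (@horner_coef_wide _ m q) ?leq_maxr //.
by apply: has_value_sum => i _; apply: has_valueM => //; apply: has_valueX.
Qed.

End AtPoint.
End Specialization.

(** * Alternants and the Pieri rule *)

Section Alternants.
Variable S : comNzRingType.

Definition vdm k (x : 'I_k -> S) : S := \prod_(j < k) \prod_(i < k | (i < j)%N) (x j - x i).

Lemma vdmS k (x : 'I_k.+1 -> S) :
  vdm x = (\prod_(j < k) (x (lift ord0 j) - x ord0)) * vdm (x \o lift ord0).
Proof.
rewrite /vdm big_ord_recl big_pred0 ?mul1r // -big_split /=; apply: eq_bigr => j _.
by rewrite big_mkcond big_ord_recl /= -big_mkcond.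
Qed.

Lemma horner_sub_dvd (p : {poly S}) a :
  exists q : {poly S}, forall b, p.[b] - p.[a] = (b - a) * q.[b].
Proof.
have /factor_theorem[q Dq] : root (p - p.[a]%:P) a by rewrite rootE !hornerE subrr.
exists q => b; have := congr1 (horner^~ b) Dq; rewrite !hornerE => ->.
by rewrite mulrC.
Qed.

(** Subtracting the column of the first variable from the others makes each of them divisible by x_i
    - x_0, and the cofactors of the first column are then determinants of the same kind in one
    variable less. *)
Lemma det_horner_dvd k (x : 'I_k -> S) (p : 'I_k -> {poly S}) :
  exists d, \det (\matrix_(j, i) (p j).[x i]) = d * vdm x.
Proof.
elim: k x p => [|k IH] x p.
  by exists 1; rewrite det_mx00 /vdm big_ord0 mulr1.
have q_ex j : exists q : {poly S}, forall b, (p j).[b] - (p j).[x ord0] = (b - x ord0) * q.[b].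
  exact: horner_sub_dvd.
have [q qE] := fin_all_exists q_ex.
(* Right multiplication by T subtracts column 0 from every other column. *)
pose T : 'M[S]_k.+1 := \matrix_(i, j) ((i == j)%:R - ((i == ord0) && (j != ord0))%:R).
pose M := \matrix_(j, i) (p j).[x i].
have detT : \det T = 1.
  rewrite -det_tr det_trig; last first.
    apply/is_trig_mxP=> i j ij; rewrite !mxE.
    have -> : (j == i) = false by apply/eqP=> E; rewrite E ltnn in ij.
    have -> : (j == ord0) = false by apply/eqP=> E; rewrite E in ij.
    by rewrite subrr.
  by rewrite big1 // => i _; rewrite !mxE eqxx andbN subr0.
have -> : \det M = \det (M *m T) by rewrite det_mulmx detT mulr1.
have MT j i : (M *m T) j i = (p j).[x i] - (i != ord0)%:R * (p j).[x ord0].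
  rewrite mxE; under eq_bigr => l _ do rewrite mxE mxE mulrBr.
  rewrite sumrB (@big_only1 _ _ _ _ i) // => [|l /negPf -> _]; last by rewrite mulr0.
  rewrite eqxx mulr1 (@big_only1 _ _ _ _ ord0) // => [|l /negPf -> _]; last by rewrite mulr0.
  by rewrite eqxx mulrC.
have MT0 j : (M *m T) j ord0 = (p j).[x ord0] by rewrite MT eqxx mul0r subr0.
have MTl j i : (M *m T) j (lift ord0 i) = (x (lift ord0 i) - x ord0) * (q j).[x (lift ord0 i)].
  by rewrite MT mul1r qE.
rewrite (expand_det_col _ ord0).
have d_ex j : exists d, cofactor (M *m T) j ord0 = d * vdm x.
  have [d dE] := IH (x \o lift ord0) (fun l => q (lift j l)).
  exists ((-1) ^+ (j + 0) * d).
  rewrite /cofactor -mulrA; congr (_ * _); rewrite vdmS mulrCA -dE.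
  rewrite [LHS](_ : _ = \det ((\matrix_(l, i) (q (lift j l)).[x (lift ord0 i)])
     *m diag_mx (\row_i (x (lift ord0 i) - x ord0)))); last first.
    congr (\det _); apply/matrixP=> l i; rewrite mul_mx_diag !mxE.
    by move: (MTl (lift j l) i); rewrite mxE => ->; rewrite mulrC.
  rewrite det_mulmx det_diag mulrC; congr (_ * _).
  by apply: eq_bigr => i _; rewrite mxE.
have [d dE] := fin_all_exists d_ex.
exists (\sum_j (p j).[x ord0] * d j); rewrite mulr_suml.
by apply: eq_bigr => j _; rewrite MT0 dE mulrA.
Qed.

Definition alt k (x : 'I_k -> S) (ps : seq {poly S}) : S :=
  \det (\matrix_(j < k, i < k) (ps`_j).[x i]).

Lemma alt_dvd k (x : 'I_k -> S) ps : exists d, alt x ps = d * vdm x.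
Proof. exact: det_horner_dvd. Qed.

Lemma alt_linear k (x : 'I_k -> S) P Q (a : S) p q : (size P < k)%N ->
  alt x (P ++ (a *: p + q) :: Q) = a * alt x (P ++ p :: Q) + alt x (P ++ q :: Q).
Proof.
move=> sP; pose j0 := Ordinal sP; rewrite -[X in _ = _ + X]mul1r.
have nthP r : (P ++ r :: Q)`_j0 = r by rewrite nth_cat ltnn subnn.
apply: (determinant_multilinear (i0 := j0)).
- by apply/rowP=> i; rewrite !mxE !nthP mul1r !hornerE.
- apply/matrixP=> l i; rewrite !mxE !nth_cat /=.
  have := neq_lift j0 l; rewrite -val_eqE /= => nl.
  by case: ltnP => // lP; case E: (_ - _)%N => //; lia.
- apply/matrixP=> l i; rewrite !mxE !nth_cat /=.
  have := neq_lift j0 l; rewrite -val_eqE /= => nl.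
  by case: ltnP => // lP; case E: (_ - _)%N => //; lia.
Qed.

Lemma alt_dup k (x : 'I_k -> S) P p Q : ((size P).+1 < k)%N ->
  alt x (P ++ [:: p, p & Q]) = 0.
Proof.
move=> sP; have sP' : (size P < k)%N by lia.
apply: (determinant_alternate (i1 := Ordinal sP') (i2 := Ordinal sP)).
  by rewrite -val_eqE /= neq_ltn ltnSn.
by move=> i; rewrite !mxE !nth_cat /= ltnn subnn ltnNge leqnSn /= subSnn.
Qed.

Lemma alt_scale k (x : 'I_k -> S) e ps : size ps = k ->
  alt x [seq e * p | p <- ps] = (\prod_i e.[x i]) * alt x ps.
Proof.
move=> sp; rewrite /alt mulrC.
rewrite [LHS](_ : _ = \det ((\matrix_(j < k, i < k) (ps`_j).[x i])
   *m diag_mx (\row_i e.[x i]))).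
  rewrite det_mulmx det_diag; congr (_ * _); by apply: eq_bigr => i _; rewrite mxE.
congr (\det _); apply/matrixP=> j i; rewrite mul_mx_diag !mxE (nth_map 0) ?sp //.
by rewrite hornerM mulrC.
Qed.

(** As [r j] has degree at most j, the j-th entry is a combination of the X^(k-1-l) with l <= j: the
    change of basis is triangular, with the constant terms on its diagonal. *)
Lemma alt_triangular k (x : 'I_k -> S) (r : 'I_k -> {poly S}) :
  (forall j, (size (r j) <= j.+1)%N) ->
  alt x [seq 'X^(k.-1 - j) * r j | j : 'I_k <- enum 'I_k]
  = (\prod_j (r j)`_0) * alt x [seq 'X^(k.-1 - j) | j : 'I_k <- enum 'I_k].
Proof.
move=> sr; pose T := \matrix_(j < k, l < k) (if (l <= j)%N then (r j)`_(j - l) else 0).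
have <- : \det T = \prod_j (r j)`_0.
  rewrite det_trig; last first.
    by apply/is_trig_mxP=> i j ij; rewrite mxE leqNgt ij.
  by apply: eq_bigr => j _; rewrite mxE leqnn subnn.
rewrite -det_mulmx; congr (\det _); apply/matrixP=> j i.
rewrite !mxE (nth_map j) ?size_enum_ord // nth_ord_enum hornerM hornerXn.
rewrite (@horner_coef_wide _ j.+1) // mulr_sumr.
rewrite (reindex_inj rev_ord_inj) /=.
have jk : (j.+1 <= k)%N := ltn_ord j.
under [RHS]eq_bigr => l _ do
  rewrite !mxE (nth_map j) ?size_enum_ord // nth_ord_enum hornerXn.
transitivity (\sum_(l < j.+1) (r j)`_(j - l) * x i ^+ (k.-1 - l)).
  apply: eq_bigr => l _; rewrite subSS mulrCA -exprD; congr (_ * _ ^+ _).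
  by have := ltn_ord l; lia.
rewrite (big_ord_widen _ (fun l => (r j)`_(j - l) * x i ^+ (k.-1 - l)) jk) big_mkcond.
by apply: eq_bigr => l _; rewrite ltnS; case: leqP => // _; rewrite mul0r.
Qed.

Lemma alt_monomials k (x : 'I_k -> S) :
  alt x [seq 'X^(k.-1 - j) | j : 'I_k <- enum 'I_k]
  = (-1) ^+ (perm (@rev_ord_inj k)) * vdm x.
Proof.
pose rv : 'S_k := perm (@rev_ord_inj k).
have := det_Vandermonde (\row_i x i).
rewrite [X in _ = X](_ : _ = vdm x); last first.
  rewrite /vdm (exchange_big_dep predT) //=; apply: eq_bigr => j _.
  by apply: eq_bigr => i _; rewrite !mxE.
move=> <-; rewrite -det_perm -det_mulmx -row_permE; congr (\det _).
apply/matrixP=> j i; rewrite !mxE (nth_map j) ?size_enum_ord // nth_ord_enum hornerXn.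
by rewrite permE /=; congr (_ ^+ _); lia.
Qed.

Lemma alt_perm k (x : 'I_k -> S) (s : 'S_k) ps :
  alt (x \o s) ps = (-1) ^+ s * alt x ps.
Proof.
rewrite -[in RHS]odd_permV mulrC -det_perm /alt -det_mulmx -col_permE; congr (\det _).
by apply/matrixP=> i j; rewrite !mxE.
Qed.

End Alternants.

Lemma rmorph_alt (S S' : comNzRingType) (f : {rmorphism S -> S'}) k (x : 'I_k -> S) ps :
  f (alt x ps) = alt (f \o x) [seq map_poly f p | p <- ps].
Proof.
rewrite /alt -det_map_mx; congr (\det _); apply/matrixP=> j i; rewrite !mxE.
have [jp|pj] := ltnP j (size ps); first by rewrite (nth_map 0) // horner_map.
by rewrite !nth_default ?size_map // !horner0 rmorph0.
Qed.

(* In terms of z = x - 1 the columns are z^a x^m. *)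
Definition zpow (a m : nat) : {poly int} := ('X - 1) ^+ a * 'X^m.

(** With z^a alone the quotient by the Vandermonde determinant would be, up to sign, a Schur
    polynomial in z; the power of x, whose exponent is the number of later up-steps, makes it a
    Grothendieck polynomial. *)
Fixpoint zcols (s : seq bool) (a : nat) : seq {poly int} :=
  match s with
  | [::] => [::]
  | true :: t => zpow a (count id t) :: zcols t a.+1
  | false :: t => zcols t a.+1
  end.

Lemma size_zcols s a : size (zcols s a) = count id s.
Proof. by elim: s a => [|[] s IH] a //=; rewrite IH. Qed.

Lemma zcols_cat s m a : zcols (s ++ nseq m false) a = zcols s a.
Proof.
have c0 l : count id (nseq l false) = 0%N by elim: l.
elim: s a => [|b s IH] a /=; first by elim: m a => //= m IH a; rewrite IH.
by rewrite IH count_cat c0 addn0.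
Qed.

Lemma zcols_nseq k a :
  zcols (nseq k true) a = [seq zpow (a + j) (k.-1 - j) | j : 'I_k <- enum 'I_k].
Proof.
rewrite [RHS](map_comp (fun j => zpow (a + j) (k.-1 - j)) val) val_enum_ord.
elim: k a => //= k IH a; rewrite IH addn0 subn0 count_nseq mul1n; congr (_ :: _).
rewrite (iotaDl 1 0 k) -map_comp; apply/eq_in_map => j.
rewrite mem_iota /= => jk; congr zpow; lia.
Qed.

Lemma zpowS a m : zpow a m.+1 = zpow a m + zpow a.+1 m.
Proof. by rewrite /zpow !exprS; ring. Qed.

Lemma zpow_succ a m : zpow a.+1 m = ('X - 1) * zpow a m.
Proof. by rewrite /zpow exprS mulrA. Qed.

Lemma eq_psum (S : comNzRingType) (u : S) (c : bool) s K1 K2 :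
  (forall t, size t = size s -> count id t = (c + count id s)%N -> K1 t = K2 t) ->
  psum u c s K1 = psum u c s K2.
Proof.
elim: s c K1 K2 => [|x s IH] c K1 K2 eK.
  by case: c eK => eK /=; rewrite ?mul0r // eK.
by case: c x eK => [] [] eK /=; try (congr (_ + _)); try (congr (_ * _));
  apply: IH => t st ct; apply: eK; rewrite /= ?st ?ct // ?addnS ?addn0; lia.
Qed.

Section Pieri.
Variables (S : comNzRingType) (k n : nat) (x : 'I_k -> S) (u : S) (N : S -> Prop).
Local Notation ip := (map_poly (intmul (1 : S))).
Local Notation alt := (alt x).

(* The columns of index n are negligible: in the application they vanish in K(Gr(k,n)). *)
Hypotheses (N0 : N 0) (ND : forall a b, N a -> N b -> N (a + b))
  (NN : forall a, N a -> N (- a)) (Nu : forall a, N a -> N (u * a))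
  (Nn : forall (P : seq {poly int}) m, (size P).+1 = k ->
     N (alt (map ip (rcons P (zpow n m))))).

Let E (p : {poly int}) : {poly S} := u *: ip (('X - 1) * p) + ip p.

(** Multiplication by prod_i (1 + u z_i) multiplies each column by 1 + u z, and the resulting
    columns are expanded from left to right. [P] holds the columns already settled; if [c] is set,
    the last of them in addition to [P] has just moved up to index [a]. *)
Lemma pieri_alt_carry (c : bool) P s a : (size P + c + count id s = k)%N ->
  (a + size s = n)%N ->
  N (alt (map ip (if c then rcons P (zpow a (count id s)) else P) ++ map E (zcols s a))
     - psum u c s (fun t => alt (map ip (P ++ zcols t a)))).
Proof.
elim: s c P a => [|b s IH] c P a /=.
  rewrite !addn0 => sP an; case: c sP => sP.
    (* A column still carried at the end of the word has index n and is negligible. *)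
    by rewrite cats0 mul0r subr0 an; apply: Nn; lia.
  by rewrite !cats0 mul1r subrr.
rewrite addnS -addSn => sP an.
have szP (Q : seq {poly int}) : size (map ip Q) = size Q by rewrite size_map.
have ip1 (Q R : seq {poly int}) : map ip Q ++ map ip R = map ip (Q ++ R) by rewrite map_cat.
case: c b sP => [] [] /= sP.
- rewrite map_rcons cat_rcons.
  (* With m later up-steps, (1 + u z) z^a x^m = (u - 1) z^(a+1) x^m + z^a x^(m+1) because x = 1 + z.
     The last term repeats the carried column and drops out; this is the origin of the coefficient u
     - 1 in [pw]. *)
  rewrite (_ : E _ = (u - 1) *: ip (zpow a.+1 (count id s)) + ip (zpow a (count id s).+1));
    last first.
    rewrite /E -zpow_succ zpowS rmorphD /= scalerBl scale1r.
    by rewrite addrC [X in _ = X]addrC; ring.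
  rewrite (_ : ip (zpow a (1 + _)) :: _ = [:: ip (zpow a (count id s).+1)]
    ++ ((u - 1) *: ip (zpow a.+1 (count id s)) + ip (zpow a (count id s).+1))
       :: map E (zcols s a.+1)) //.
  rewrite catA alt_linear; last by rewrite size_cat szP /=; lia.
  rewrite [X in _ + X - _](_ : _ = 0) ?addr0; last first.
    by rewrite -catA /= alt_dup // szP; lia.
  rewrite -mulrBr mulrBl mul1r.
  have H := IH true (rcons P (zpow a (count id s).+1)) a.+1.
  move: H; rewrite size_rcons => /(_ _ an); rewrite /= => H.
  have {}H := H ltac:(lia).
  suff e : alt ((map ip P ++ [:: ip (zpow a (count id s).+1)]) ++
        ip (zpow a.+1 (count id s)) :: map E (zcols s a.+1)) -
      psum u true s (fun t => alt (map ip (P ++ zpow a (count id t) :: zcols t a.+1)))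
    = alt (map ip (rcons (rcons P (zpow a (count id s).+1)) (zpow a.+1 (count id s))) ++
        map E (zcols s a.+1)) -
      psum u true s (fun t => alt (map ip (rcons P (zpow a (count id s).+1) ++ zcols t a.+1))).
    by rewrite e; apply: ND; [apply: Nu | apply: NN].
  congr (_ - _).
    by rewrite !map_rcons !cat_rcons -catA.
  by apply: eq_psum => t _ ct; rewrite cat_rcons ct.
- have := IH false (rcons P (zpow a (count id s))) a.+1.
  rewrite size_rcons => /(_ _ an) H; have {}H := H ltac:(lia).
  rewrite (@eq_psum _ u _ s _
    (fun t => alt (map ip (rcons P (zpow a (count id s)) ++ zcols t a.+1)))) //.
  by move=> t _ ct; rewrite cat_rcons ct.
- rewrite alt_linear; last by rewrite szP; lia.
  rewrite (addrC (u * alt _)) opprD addrACA; apply: ND.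
    have := IH false (rcons P (zpow a (count id s))) a.+1.
    rewrite size_rcons => /(_ _ an) H; have {}H := H ltac:(lia).
    rewrite map_rcons cat_rcons in H.
    rewrite (@eq_psum _ u _ s _
    (fun t => alt (map ip (rcons P (zpow a (count id s)) ++ zcols t a.+1)))) //.
    by move=> t _ ct; rewrite cat_rcons ct.
  rewrite -mulrBr; apply: Nu; rewrite -zpow_succ.
  have := IH true P a.+1 ltac:(lia) an.
  by rewrite map_rcons cat_rcons.
- by apply: (IH false) => //; lia.
Qed.

Lemma pieri_alt s : count id s = k -> size s = n ->
  N (\prod_i (1 + u * (x i - 1)) * alt (map ip (zcols s 0))
     - psum u false s (fun t => alt (map ip (zcols t 0)))).
Proof.
move=> cs ss; have := @pieri_alt_carry false [::] s 0 cs ss.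
rewrite cat0s (_ : map E _ = map (fun p => (u *: ('X - 1) + 1) * p) (map ip (zcols s 0))).
  rewrite alt_scale ?size_map ?size_zcols //.
  by under eq_bigr => i _ do rewrite !hornerE addrC.
rewrite -map_comp; apply: eq_map => p /=.
by rewrite /E rmorphM rmorphB rmorph1 /= map_polyX [RHS]mulrDl mul1r scalerAl.
Qed.

End Pieri.

Section Vandermonde.
Variables (S : comNzRingType) (k : nat).
Local Notation ip := (map_poly (intmul (1 : S))).

Definition vdm_sign : bool :=
  odd (\sum_(j < k) j) (+) perm (@rev_ord_inj k).

(** The columns are z^j x^(k-1-j), so [alt_triangular] applies. In [vdm_sign] the first part comes
    from the constant terms (-1)^j of (X - 1)^j, the second from the reversed order of the
    monomials. *)
Lemma alt_unit_cols (x : 'I_k -> S) m :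
  alt x (map ip (zcols (nseq k true ++ nseq m false) 0)) = (-1) ^+ vdm_sign * vdm x.
Proof.
rewrite zcols_cat zcols_nseq -map_comp.
rewrite (eq_map (g := fun j : 'I_k => 'X^(k.-1 - j) * ('X - 1%:P) ^+ j)); last first.
  by move=> j /=; rewrite /zpow rmorphM !rmorphXn rmorphB rmorph1 /= map_polyX mulrC.
rewrite alt_triangular ?alt_monomials => [|j]; last by rewrite size_exp_XsubC.
rewrite mulrA /vdm_sign signr_addb -signr_odd; congr (_ * _ * _).
rewrite signr_odd (big_morph _ (exprD _) (expr0 _)); apply: eq_bigr => j _.
by rewrite -horner_coef0 horner_exp !hornerE.
Qed.

End Vandermonde.

(** * Laurent polynomials and null classes in K(Gr(k,n)) *)

Section KTheory.
Variables k n : nat.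
Local Notation F := (ratfun k n).
Local Notation R := {mpoly int[k + n]}.
Local Notation tofrac := (@FracField.tofrac R).
Local Notation xvar := (@xvar k n).
Local Notation yvar := (@yvar k n).

Lemma tofracX_neq0 (m : 'X_{1..k + n}) : tofrac 'X_[m] != 0.
Proof.
rewrite tofrac_eq0; apply/eqP => /(congr1 (mcoeff m)) /eqP.
by rewrite mcoeffX eqxx mcoeff0.
Qed.

Lemma xvar_neq0 i : xvar i != 0. Proof. exact: tofracX_neq0. Qed.
Lemma yvar_neq0 i : yvar i != 0. Proof. exact: tofracX_neq0. Qed.

Lemma xvar_inj : injective xvar.
Proof.
move=> i j /tofrac_inj /(congr1 (mcoeff U_(lshift n i))) /eqP.
by rewrite !mcoeffXU eqxx (inj_eq (@lshift_inj _ _)); case: (j =P i).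
Qed.

Lemma yvar_inj : injective yvar.
Proof.
move=> i j /tofrac_inj /(congr1 (mcoeff U_(rshift k i))) /eqP.
by rewrite !mcoeffXU eqxx (inj_eq (@rshift_inj _ _)); case: (j =P i).
Qed.

Lemma is_laurent_poly p : is_laurent (tofrac p).
Proof. by exists p, 0%MM; rewrite mpolyX0 tofrac1 divr1. Qed.

Lemma is_laurentD f g : @is_laurent k n f -> is_laurent g -> is_laurent (f + g).
Proof.
move=> [p [m ->]] [p' [m' ->]]; exists (p * 'X_[m'] + p' * 'X_[m]), (m + m')%MM.
by rewrite mpolyXD tofracD !tofracM addf_div ?tofracX_neq0.
Qed.

Lemma is_laurentM f g : @is_laurent k n f -> is_laurent g -> is_laurent (f * g).
Proof.
move=> [p [m ->]] [p' [m' ->]]; exists (p * p'), (m + m')%MM.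
by rewrite mpolyXD !tofracM mulf_div.
Qed.

Lemma poly_subst_monomial_neq0 vx vy (m : 'X_{1..k + n}) :
  (forall i, vx i != 0) -> (forall j, vy j != 0) -> poly_subst vx vy 'X_[m] != 0.
Proof.
move=> x0 y0; rewrite mpolyXE_id rmorph_prod; apply/prodf_neq0 => a _.
rewrite rmorphXn expf_neq0 //=.
by case: (split_ordP a) => b ->; rewrite ?poly_subst_x ?poly_subst_y.
Qed.

Lemma laurent_value vx vy f : (forall i, vx i != 0) -> (forall j, vy j != 0) ->
  @is_laurent k n f -> exists c, has_value vx vy f c.
Proof.
move=> x0 y0 [p [m ->]].
exists (poly_subst vx vy p / poly_subst vx vy 'X_[m]).
by apply: has_value_div; [apply: poly_subst_monomial_neq0 | apply: has_value_poly..].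
Qed.

(** A Laurent polynomial has a value at every point with nonzero coordinates, so [rsubst] can be
    replaced by [has_value], which respects the ring operations. *)
Lemma sym_laurentP f : @sym_laurent k n f <->
  is_laurent f /\ forall s : 'S_k, has_value (fun i => xvar (s i)) yvar f f.
Proof.
split=> -[lf sf]; split=> // s; last exact: rsubstP.
have [c fc] := @laurent_value (fun i => xvar (s i)) yvar f (fun i => xvar_neq0 _) yvar_neq0 lf.
by rewrite -[X in has_value _ _ _ X](sf s) (rsubstP fc).
Qed.

Lemma KT_idealP f : @KT_ideal k n f <-> sym_laurent f /\
  forall g : 'I_k -> 'I_n, {homo g : a b / (a < b)%N} ->
    has_value (fun a => yvar (g a)) yvar f 0.
Proof.
split=> -[sf vf]; split=> // g hg; last exact/rsubstP/vf.
have [lf _] := sf.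
have [c fc] := @laurent_value (fun a => yvar (g a)) yvar f (fun i => yvar_neq0 _) yvar_neq0 lf.
by rewrite -(vf g hg) (rsubstP fc).
Qed.

Lemma sym_laurentD f g : @sym_laurent k n f -> sym_laurent g -> sym_laurent (f + g).
Proof.
move=> /sym_laurentP[lf sf] /sym_laurentP[lg sg]; apply/sym_laurentP.
by split; [apply: is_laurentD | move=> s; apply: has_valueD].
Qed.

Lemma sym_laurentM f g : @sym_laurent k n f -> sym_laurent g -> sym_laurent (f * g).
Proof.
move=> /sym_laurentP[lf sf] /sym_laurentP[lg sg]; apply/sym_laurentP.
by split; [apply: is_laurentM | move=> s; apply: has_valueM].
Qed.

Lemma sym_laurent_int (z : int) : @sym_laurent k n z%:~R.
Proof.
apply/sym_laurentP; split; last by move=> s; apply: has_value_int.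
by rewrite -(rmorph_int tofrac); apply: is_laurent_poly.
Qed.

Lemma KT_idealD f g : @KT_ideal k n f -> KT_ideal g -> KT_ideal (f + g).
Proof.
move=> /KT_idealP[lf sf] /KT_idealP[lg sg]; apply/KT_idealP; split.
  exact: sym_laurentD.
by move=> h hh; rewrite -[X in has_value _ _ _ X]addr0; apply: has_valueD; auto.
Qed.

Lemma KT_idealM f g : @sym_laurent k n f -> KT_ideal g -> KT_ideal (f * g).
Proof.
move=> lf /KT_idealP[lg sg]; apply/KT_idealP; split.
  exact: sym_laurentM.
move=> h hh; have [c fc] := @laurent_value (fun a => yvar (h a)) yvar f
  (fun i => yvar_neq0 _) yvar_neq0 (proj1 lf).
by rewrite -(mulr0 c); apply: has_valueM; auto.
Qed.

Lemma KT_ideal0 : @KT_ideal k n 0.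
Proof.
apply/KT_idealP; split; first exact: (sym_laurent_int 0).
by move=> g _; apply: has_value0.
Qed.

(** [K_eq f g] is [K_null (f - g)] by conversion. *)
Definition K_null (f : F) : Prop :=
  exists (h : F) (q : 'I_n -> F),
    [/\ KT_ideal h, forall i, sym_laurent (q i)
      & f = h + \sum_(i < n) (yvar i - 1) * q i].

Lemma K_null0 : K_null 0.
Proof.
exists 0, (fun=> 0); split; [exact: KT_ideal0 | by move=> i; apply: (sym_laurent_int 0) |].
by rewrite big1 ?addr0 // => i _; rewrite mulr0.
Qed.

Lemma K_nullD f g : K_null f -> K_null g -> K_null (f + g).
Proof.
move=> [h [q [Ih sq ->]]] [h' [q' [Ih' sq' ->]]].
exists (h + h'), (fun i => q i + q' i); split; first exact: KT_idealD.
  by move=> i; apply: sym_laurentD.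
by rewrite addrACA -big_split; congr (_ + _); apply: eq_bigr => i _; rewrite mulrDr.
Qed.

Lemma K_nullM f g : sym_laurent f -> K_null g -> K_null (f * g).
Proof.
move=> sf [h [q [Ih sq ->]]]; exists (f * h), (fun i => f * q i); split.
- exact: KT_idealM.
- by move=> i; apply: sym_laurentM.
by rewrite mulrDr mulr_sumr; congr (_ + _); apply: eq_bigr => i _; rewrite mulrCA.
Qed.

Lemma K_nullN f : K_null f -> K_null (- f).
Proof. by rewrite -mulN1r; apply: K_nullM; apply: (sym_laurent_int (-1)). Qed.

Lemma K_nullB f g : K_null f -> K_null g -> K_null (f - g).
Proof. by move=> Kf Kg; apply: K_nullD => //; apply: K_nullN. Qed.

Lemma K_null_sum (I : Type) (r : seq I) (P : pred I) (f : I -> F) :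
  (forall i, P i -> K_null (f i)) -> K_null (\sum_(i <- r | P i) f i).
Proof.
move=> sf; elim/big_rec: _ => [|i x Pi]; first exact: K_null0.
by apply: K_nullD; apply: sf.
Qed.

End KTheory.

(** * Quotients of alternants by the Vandermonde determinant *)

Lemma vdm_neq0 (L : idomainType) k (x : 'I_k -> L) : injective x -> vdm x != 0.
Proof.
move=> xI; apply/prodf_neq0 => j _; apply/prodf_neq0 => i ij.
rewrite subr_eq0; apply: contraTneq ij => /xI ->.
by rewrite ltnn.
Qed.

Lemma prod_exchange_one (A : comNzRingType) n (a b : 'I_n -> A) (i : 'I_n) :
  \prod_(j < n) (if (j < i.+1)%N then a j else b j)
  = (a i - b i) * \prod_(j < n | j != i) (if (j < i)%N then a j else b j)
    + \prod_(j < n) (if (j < i)%N then a j else b j).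
Proof.
rewrite (bigD1 i) //= ltnSn [X in _ + X](bigD1 i) //= ltnn mulrBl subrK.
congr (_ * _); apply: eq_bigr => j ji.
by rewrite ltnS leq_eqVlt (inj_eq val_inj) (negPf ji).
Qed.

Lemma telescope_ord (A : zmodType) n (f : nat -> A) :
  \sum_(i < n) (f i.+1 - f i) = f n - f 0.
Proof. by rewrite -(big_mkord xpredT (fun i => f i.+1 - f i)) telescope_sumr. Qed.

Lemma coef_comb_div (L : fieldType) (I : finType) (e : {poly L}) a v (w : I -> {poly L})
    (b : I -> L) j :
  (e * a%:P - \sum_t w t * (b t)%:P)`_j / v
  = e`_j * (a / v) - \sum_t (w t)`_j * (b t / v).
Proof.
rewrite coefB coefMC coef_sum mulrBl mulrA mulr_suml; congr (_ - _).
by apply: eq_bigr => t _; rewrite coefMC mulrA.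
Qed.

Lemma psum_tuple (S : comNzRingType) (u : S) c s K n : size s = n ->
  psum u c s K = \sum_(t : n.-tuple bool) pw u c s t * K t.
Proof. by move=> <-; apply: psumE. Qed.

Section Ratios.
Variables k n : nat.
Local Notation F := (ratfun k n).
Local Notation R := {mpoly int[k + n]}.
Local Notation tofrac := (@FracField.tofrac R).
Local Notation xvar := (@xvar k n).
Local Notation yvar := (@yvar k n).
Local Notation fp := (map_poly tofrac).
Local Notation ip S := (map_poly (intmul (1 : S))).

(** Differs from [vdm] by a sign, chosen so that the unit frame gets the quotient 1. *)
Definition Vand (S : comNzRingType) (vx : 'I_k -> S) : S :=
  alt vx (map (ip S) (zcols (nseq k true ++ nseq (n - k) false) 0)).

Lemma Vand_neq0 (L : fieldType) (vx : 'I_k -> L) : injective vx -> Vand vx != 0.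
Proof. by move=> xI; rewrite /Vand alt_unit_cols mulf_neq0 ?signr_eq0 ?vdm_neq0. Qed.

Definition yonly (p : {poly R}) : Prop :=
  forall vx, map_poly (poly_subst vx yvar) p = fp p.

Lemma yonlyM p q : yonly p -> yonly q -> yonly (p * q).
Proof. by move=> yp yq vx; rewrite !rmorphM /= yp yq. Qed.

Lemma yonly_int p : yonly (ip R p).
Proof.
move=> vx; rewrite -!map_poly_comp; apply: eq_map_poly => z /=.
by rewrite !rmorph_int.
Qed.

Lemma yonlyX_sub_y j : yonly ('X - ('X_(rshift k j))%:P).
Proof. by move=> vx; rewrite !rmorphB /= !map_polyX !map_polyC /= poly_subst_y. Qed.

Lemma yonly_prod (I : Type) (r : seq I) (P : pred I) (p : I -> {poly R}) :
  (forall i, P i -> yonly (p i)) -> yonly (\prod_(i <- r | P i) p i).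
Proof.
move=> sf; elim/big_rec: _ => [|i x Pi]; last by apply: yonlyM; apply: sf.
by move=> vx; rewrite !rmorph1.
Qed.

Lemma fp_int p : fp (ip R p) = ip F p.
Proof.
by rewrite -map_poly_comp; apply: eq_map_poly => z /=; rewrite rmorph_int.
Qed.

Definition ratio (ps : seq {poly F}) : F := alt xvar ps / Vand xvar.

Lemma ratio_poly (cs : seq {poly R}) : exists d, ratio (map fp cs) = tofrac d.
Proof.
have [d dE] := alt_dvd (fun i : 'I_k => 'X_(lshift n i) : R) cs.
exists ((-1) ^+ vdm_sign k * d).
have xI := @xvar_inj k n.
have -> : ratio (map fp cs) = tofrac (alt (fun i => 'X_(lshift n i)) cs) / Vand xvar.
  by rewrite rmorph_alt.
apply: (canLR (mulfK (Vand_neq0 xI))); rewrite /Vand alt_unit_cols dE.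
rewrite !rmorphM /= rmorph_sign mulrACA -signr_addb addbb mul1r; congr (_ * _).
rewrite rmorph_prod; apply: eq_bigr => j _; rewrite rmorph_prod.
by apply: eq_bigr => i _; rewrite rmorphB.
Qed.

Lemma ratio_value vx (cs : seq {poly R}) : injective vx -> {in cs, forall c, yonly c} ->
  has_value vx yvar (ratio (map fp cs)) (alt vx (map fp cs) / Vand vx).
Proof.
move=> xI yc; apply: has_value_div; first exact: Vand_neq0.
  apply: has_value_det => j i; rewrite !mxE; apply: has_value_horner; last exact: has_value_x.
  move=> l; have [jc|cj] := ltnP j (size cs).
    have E : poly_subst vx yvar cs`_j`_l = tofrac cs`_j`_l.
      by rewrite -!coef_map (yc _ (mem_nth 0 jc) vx).
    rewrite (nth_map 0) // coef_map -[X in has_value _ _ _ X]E.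
    exact: has_value_poly.
  have -> : (map fp cs)`_j = 0 by rewrite nth_default ?size_map.
  by rewrite coef0; apply: has_value0.
apply: has_value_det => j i; rewrite !mxE; apply: has_value_horner; last exact: has_value_x.
move=> l; have [jc|cj] := ltnP j (size (zcols (nseq k true ++ nseq (n - k) false) 0)).
  by rewrite (nth_map 0) // coef_map; apply: has_value_int.
set q := map _ _; have -> : q`_j = 0 by rewrite nth_default ?size_map.
by rewrite coef0; apply: has_value0.
Qed.

Lemma ratio_sym (cs : seq {poly R}) : {in cs, forall c, yonly c} ->
  sym_laurent (ratio (map fp cs)).
Proof.
move=> yc; apply/sym_laurentP; split.
  by have [d ->] := ratio_poly cs; apply: is_laurent_poly.
move=> s; have := @ratio_value (xvar \o s) cs (inj_comp (@xvar_inj k n) perm_inj) yc.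
rewrite /Vand !alt_perm invfM mulrACA divff ?mul1r //.
by rewrite signr_eq0.
Qed.

Lemma ratio_linear P Q (a : F) p q : (size P < k)%N ->
  ratio (P ++ (a *: p + q) :: Q) = a * ratio (P ++ p :: Q) + ratio (P ++ q :: Q).
Proof. by move=> sP; rewrite /ratio alt_linear // mulrDl mulrA. Qed.

Lemma homo_inj (g : 'I_k -> 'I_n) : {homo g : a b / (a < b)%N} -> injective g.
Proof.
move=> hg a b gab; apply: val_inj.
by case: (ltngtP a b) => // /hg; rewrite gab ltnn.
Qed.

(** At a fixed point the x_i are distinct y's, so row j of the alternant vanishes while the
    Vandermonde determinant does not. *)
Lemma ratio_KT_ideal (cs : seq {poly R}) (j : 'I_k) : {in cs, forall c, yonly c} ->
  (forall i, (fp cs`_j).[yvar i] = 0) -> KT_ideal (ratio (map fp cs)).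
Proof.
move=> yc c0; apply/KT_idealP; split; first exact: ratio_sym.
move=> g hg; have gI := inj_comp (@yvar_inj k n) (homo_inj hg).
have := ratio_value gI yc; rewrite [alt _ _](_ : _ = 0) ?mul0r //.
rewrite /alt (expand_det_row _ j) big1 // => i _; rewrite !mxE.
have [jc|cj] := ltnP j (size cs); first by rewrite (nth_map 0) // c0 mul0r.
have -> : (map fp cs)`_j = 0 by rewrite nth_default ?size_map.
by rewrite horner0 mul0r.
Qed.

Lemma horner_root_y j : (fp ('X - ('X_(rshift k j))%:P)).[yvar j] = 0.
Proof.
by rewrite map_polyXsubC hornerXsubC subrr.
Qed.

(** With prod_j (X - y_j) in place of (X - 1)^n the ratio would lie in the ideal. The factors are
    replaced one at a time, and the i-th replacement changes the ratio by a multiple of y_i - 1. *)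
Lemma ratio_lift_null (P : seq {poly int}) m : (size P).+1 = k ->
  K_null (ratio (map (ip F) (rcons P (zpow n m)))).
Proof.
move=> sP.
pose y (j : 'I_n) : R := 'X_(rshift k j).
pose w (Q : pred 'I_n) l : {poly R} :=
  \prod_(j < n | Q j) (if (j < l)%N then 'X - 1%:P else 'X - (y j)%:P).
have yw Q l : yonly (w Q l * 'X^m).
  apply: yonlyM; last by have := yonly_int 'X^m; rewrite map_polyXn.
  apply: yonly_prod => j _; case: ifP => _; last exact: yonlyX_sub_y.
  by have := yonly_int ('X - 1%:P); rewrite rmorphB /= map_polyX map_polyC.
pose r (p : {poly R}) := ratio (map fp (rcons (map (ip R) P) p)).
have yr p : yonly p -> {in rcons (map (ip R) P) p, forall c, yonly c}.
  move=> yp c; rewrite mem_rcons inE => /orP[/eqP -> //|/mapP[q _ ->]].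
  exact: yonly_int.
have wS (i : 'I_n) : w predT i.+1 * 'X^m
    = (y i - 1)%:P * (w (predC1 i) i * 'X^m) + w predT i * 'X^m.
  rewrite /w prod_exchange_one mulrDl mulrA; congr (_ * _ * _ + _).
  by rewrite polyCB opprB addrC addrA subrK.
have rS (i : 'I_n) : r (w predT i.+1 * 'X^m) - r (w predT i * 'X^m)
    = (yvar i - 1) * r (w (predC1 i) i * 'X^m).
  rewrite wS /r !map_rcons -!cats1 rmorphD (rmorphM fp (y i - 1)%:P) /= map_polyC /= mul_polyC.
  by rewrite ratio_linear ?size_map ?sP // addrK rmorphB rmorph1.
have rw : ratio (map (ip F) (rcons P (zpow n m))) = r (w predT n * 'X^m).
  rewrite /r !map_rcons -map_comp; congr (ratio (rcons _ _)).
    by apply: eq_map => p /=; rewrite fp_int.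
  rewrite -fp_int; congr fp; rewrite /w /zpow rmorphM !rmorphXn rmorphB rmorph1 /= map_polyX.
  congr (_ * _); rewrite (eq_bigr (fun=> 'X - 1)) ?prodr_const ?card_ord // => j _.
  by rewrite ltn_ord.
rewrite rw; exists (r (w predT 0 * 'X^m)), (fun i => r (w (predC1 i) i * 'X^m)); split.
- have jk : (size P < k)%N by rewrite -sP.
  apply: (ratio_KT_ideal (j := Ordinal jk)); first by apply: yr; apply: yw.
  move=> i; rewrite nth_rcons size_map ltnn eqxx rmorphM hornerM /w rmorph_prod horner_prod.
  rewrite (bigD1 i) // [X in X * _ * _](_ : _ = 0) ?mul0r //.
  exact: horner_root_y.
- by move=> i; apply: ratio_sym; apply: yr; apply: yw.
have -> : \sum_(i < n) (yvar i - 1) * r (w (predC1 i) i * 'X^m)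
    = \sum_(i < n) (r (w predT i.+1 * 'X^m) - r (w predT i * 'X^m)).
  by apply: eq_bigr => i _; rewrite rS.
by rewrite (telescope_ord n (fun i => r (w predT i * 'X^m))) addrC subrK.
Qed.

(* Up to sign and the factor x_1 ... x_k, the dual Grothendieck polynomial at y = 1 of the
   diagram with frame A, where s lists the positions of star A. *)
Definition gK (s : seq bool) : F := ratio (map (ip F) (zcols s 0)).

Definition eK : {poly F} := \prod_(i < k) (1 + 'X * (xvar i - 1)%:P).

Lemma gK_unit : gK (nseq k true ++ nseq (n - k) false) = 1.
Proof. by rewrite /gK /ratio divff // Vand_neq0 //; apply: xvar_inj. Qed.

(** The Pieri rule is used over {poly F} with u = 'X, a polynomial being negligible if all its
    coefficients become null after division by the Vandermonde determinant; then the coefficient of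
    u^j is taken. *)
Lemma pieri_K s j : count id s = k -> size s = n ->
  K_null (eK`_j * gK s - \sum_(t : n.-tuple bool) ((pw 'X false s t)`_j)%:~R * gK t).
Proof.
move=> cs ss.
pose N (a : {poly F}) := forall i, K_null (a`_i / Vand xvar).
have alt_polyC ps : alt (polyC \o xvar) (map (ip {poly F}) ps) = (alt xvar (map (ip F) ps))%:P.
  rewrite rmorph_alt -map_comp; congr alt; apply: eq_map => p /=.
  by rewrite -map_poly_comp; apply: eq_map_poly => z /=; rewrite rmorph_int.
have N0 : N 0 by move=> i; rewrite coef0 mul0r; apply: K_null0.
have ND a b : N a -> N b -> N (a + b).
  by move=> Na Nb i; rewrite coefD mulrDl; apply: K_nullD.
have NN a : N a -> N (- a) by move=> Na i; rewrite coefN mulNr; apply: K_nullN.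
have Nu a : N a -> N ('X * a).
  move=> Na i; rewrite coefXM; case: eqP => _; last exact: Na.
  by rewrite mul0r; apply: K_null0.
have Nn (P : seq {poly int}) m : (size P).+1 = k ->
    N (alt (polyC \o xvar) (map (ip {poly F}) (rcons P (zpow n m)))).
  move=> sP i; rewrite alt_polyC coefC; case: eqP => _; first exact: ratio_lift_null.
  by rewrite mul0r; apply: K_null0.
have H := pieri_alt N0 ND NN Nu Nn cs ss j.
have E1 : \prod_i (1 + 'X * ((polyC \o xvar) i - 1)) = eK.
  by apply: eq_bigr => i _; rewrite rmorphB.
have E2 : psum 'X false s (fun t => alt (polyC \o xvar) (map (ip {poly F}) (zcols t 0)))
    = \sum_(t : n.-tuple bool) ip F (pw 'X false s t) * (alt xvar (map (ip F) (zcols t 0)))%:P.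
  rewrite (psum_tuple _ _ _ ss); apply: eq_bigr => t _; rewrite alt_polyC.
  by rewrite (rmorph_pw (map_poly (intmul (1 : F)) : {rmorphism _ -> _})) /= map_polyX.
move: H; rewrite E1 E2 alt_polyC coef_comb_div.
congr (K_null (_ - _)); apply: eq_bigr => t _.
by rewrite coef_map.
Qed.

End Ratios.

(** * Linear independence *)

Section Residue.

(** The top coefficients in Lagrange's interpolation formula. The left side is the localization
    formula for an integral over P^(n-1). *)
Lemma lagrange_lead_coef (L : fieldType) n (y : 'I_n -> L) (p : {poly L}) :
  injective y -> (size p <= n)%N ->
  \sum_j p.[y j] / (\prod_(i | i != j) (y j - y i)) = p`_n.-1.
Proof.
case: n y => [|n] y yI sp.
  by rewrite big_ord0 (size_poly_leq0P _ sp) coef0.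
pose w j := \prod_(i | i != j) (y j - y i).
have w0 j : w j != 0.
  by apply/prodf_neq0 => i ij; rewrite subr_eq0 (inj_eq yI) eq_sym.
pose l j := \prod_(i | i != j) ('X - (y i)%:P).
have lE i j : (l j).[y i] = if i == j then w j else 0.
  rewrite horner_prod; case: eqP => [->|/eqP ij].
    by apply: eq_bigr => a _; rewrite hornerXsubC.
  by rewrite (bigD1 i) //= hornerXsubC subrr mul0r.
have sl j : size (l j) = n.+1.
  have := size_prod_XsubC (index_enum 'I_n.+1) y.
  rewrite (bigD1 j) //= size_mul ?polyXsubC_eq0 //; last first.
    by apply/prodf_neq0 => i _; rewrite polyXsubC_eq0.
  rewrite size_XsubC [size (index_enum _)](_ : _ = n.+1); first by move=> [].
  by rewrite -[index_enum _]enumT size_enum_ord.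
have pE : p = \sum_j (p.[y j] / w j) *: l j.
  apply/eqP; rewrite -subr_eq0; apply/eqP.
  pose rs := [seq y j | j : 'I_n.+1].
  apply: (@roots_geq_poly_eq0 _ _ rs).
  - apply/allP => _ /mapP[i _ ->]; rewrite rootE hornerD hornerN horner_sum.
    rewrite (@big_only1 _ _ _ _ i) // => [|j ji _].
      by rewrite hornerZ lE eqxx divfK // subrr.
    by rewrite hornerZ lE eq_sym (negPf ji) mulr0.
  - by rewrite map_inj_uniq ?enum_uniq.
  rewrite size_map size_enum_ord (leq_trans (size_polyD _ _)) // geq_max sp size_polyN.
  apply: (leq_trans (size_sum _ _ _)); apply/bigmax_leqP => j _.
  by rewrite (leq_trans (size_scale_leq _ _)) ?sl.
rewrite [in RHS]pE coef_sum; apply: eq_bigr => j _; rewrite coefZ.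
have := lead_coef_prod_XsubC (index_enum 'I_n.+1) (fun i => i != j) y.
by rewrite -/(l j) /lead_coef sl => ->; rewrite mulr1.
Qed.

Lemma comp_shift_coef (S : comNzRingType) n (p : {poly S}) : (size p <= n.+1)%N ->
  (p \Po ('X + 1))`_n = p`_n.
Proof.
move=> sp; rewrite comp_polyE coef_sum.
have sX i : size (('X + 1 : {poly S}) ^+ i) = i.+1 by rewrite -[1]opprK -polyCN size_exp_XsubC.
have [snp|snp] := ltnP n (size p); last first.
  rewrite big1 ?nth_default // => i _; rewrite coefZ [_`_n]nth_default ?mulr0 // sX.
  by rewrite (leq_trans (ltn_ord i)).
rewrite (@big_only1 _ _ _ _ (Ordinal snp)) //= => [|i ni _]; last first.
  by rewrite coefZ [_`_n]nth_default ?mulr0 // sX ltn_neqAle -[(_ <= n)%N]ltnS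
    (leq_trans (ltn_ord i) sp) andbT.
have /monicP : ('X + 1 : {poly S}) ^+ n \is monic.
  by apply: monic_exp; rewrite -[1]opprK -polyCN monicXsubC.
by rewrite /lead_coef sX coefZ => ->; rewrite mulr1.
Qed.

Lemma horner_modulo_roots (A L : comNzRingType) (f : {rmorphism A -> L}) (I : finType)
    (b : I -> A) (q r : {poly A}) i :
  (map_poly f (q * \prod_j ('X - (b j)%:P) + r)).[f (b i)] = (map_poly f r).[f (b i)].
Proof.
rewrite rmorphD rmorphM hornerD hornerM rmorph_prod horner_prod (bigD1 i) //= map_polyXsubC.
by rewrite hornerXsubC subrr mul0r mulr0 add0r.
Qed.

(** The coefficient of z^(n-1) for z = X - 1: what the localization sum becomes at y = 1. *)
Definition res n (p : {poly int}) : int := (p \Po ('X + 1))`_n.-1.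

Lemma res_zpow n e (q : {poly int}) : (0 < n)%N ->
  res n (('X - 1) ^+ e * q) = if (n.-1 < e)%N then 0 else (q \Po ('X + 1))`_(n.-1 - e).
Proof.
move=> n0; rewrite /res rmorphM rmorphXn rmorphB rmorph1 /= comp_polyX addrK.
by rewrite coefXnM.
Qed.

End Residue.

Section Functional.
Variables k n : nat.
Hypothesis n_gt0 : (0 < n)%N.
Local Notation F := (ratfun k n).
Local Notation R := {mpoly int[k + n]}.
Local Notation tofrac := (@FracField.tofrac R).
Local Notation yvar := (@yvar k n).
Local Notation ip S := (map_poly (intmul (1 : S))).
Local Notation y j := ('X_(rshift k j) : R).

Local Notation ev1 := (@meval (k + n) int (fun=> 1)).

Definition weight (j : 'I_n) : F := \prod_(i | i != j) (yvar j - yvar i).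

(** Modulo prod_j (X - y_j) only the remainder counts at the y_j, and its coefficient of X^(n-1) is
    a polynomial. At y = 1 the divisor becomes z^n, which does not affect the coefficient of
    z^(n-1). *)
Lemma residue_int (p : {poly int}) :
  exists2 r : R, \sum_j (ip F p).[yvar j] / weight j = tofrac r & ev1 r = res n p.
Proof.
pose W : {poly R} := \prod_(j < n) ('X - (y j)%:P).
have mW : W \is monic by apply: monic_prod_XsubC.
have sW : size W = n.+1.
  by rewrite size_prod_XsubC -[index_enum _]enumT size_enum_ord.
pose q := Pdiv.Ring.rdivp (ip R p) W; pose r0 := Pdiv.Ring.rmodp (ip R p) W.
have pE : ip R p = q * W + r0 by apply: Pdiv.RingMonic.rdivp_eq.
have sr : (size r0 <= n)%N.
  by rewrite -ltnS -sW Pdiv.Ring.ltn_rmodpN0 ?monic_neq0.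
exists r0`_n.-1.
  rewrite -coef_map -(lagrange_lead_coef (@yvar_inj k n)) ?(leq_trans (size_poly _ _)) //.
  apply: eq_bigr => j _; congr (_ / _).
  by rewrite -fp_int pE; apply: horner_modulo_roots.
have -> : res n p = res n (map_poly ev1 r0).
  have -> : p = map_poly ev1 q * ('X - 1) ^+ n + map_poly ev1 r0.
    rewrite -[('X - 1) ^+ n](_ : map_poly ev1 W = _); last first.
      rewrite map_prod_XsubC (eq_bigr (fun=> 'X - 1)) ?prodr_const ?card_ord // => j _.
      by rewrite -[1 in RHS]polyC1; congr ('X - _%:P); apply: mevalXU.
    transitivity (map_poly ev1 (ip R p)); last by rewrite pE rmorphD rmorphM.
    by apply/polyP=> i; rewrite !coef_map /= rmorph_int intz.
  rewrite [LHS]/res rmorphD coefD -!/(res n _) mulrC res_zpow // ltn_predL n_gt0.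
  by rewrite add0r.
rewrite /res comp_shift_coef ?coef_map // prednK //.
by rewrite (leq_trans (size_poly _ _)).
Qed.

End Functional.

Section Pushforward.
Variables k n : nat.
Hypothesis n_gt0 : (0 < n)%N.
Local Notation F := (ratfun k n).
Local Notation R := {mpoly int[k + n]}.
Local Notation tofrac := (@FracField.tofrac R).
Local Notation yvar := (@yvar k n).
Local Notation ip S := (map_poly (intmul (1 : S))).
Local Notation ev1 := (@meval (k + n) int (fun=> 1)).
Local Notation X a := ('X_(lshift n a) : R).
Local Notation ps g := (poly_subst (fun a => yvar (g a)) yvar).

(* The integration formula on the k-fold product of P^(n-1) by localization at fixed
   points; it takes integral values although the summands have denominators. *)
Definition push (P : R) : F :=
  \sum_(g : {ffun 'I_k -> 'I_n}) ps g P / \prod_a @weight k n (g a).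

Definition push_at1 (P : R) (z : int) : Prop := exists2 r : R, push P = tofrac r & ev1 r = z.

Lemma pushD P Q : push (P + Q) = push P + push Q.
Proof. by rewrite /push -big_split; apply: eq_bigr => g _; rewrite rmorphD mulrDl. Qed.

Lemma pushMl Y P : (forall g : {ffun 'I_k -> 'I_n}, ps g Y = tofrac Y) ->
  push (Y * P) = tofrac Y * push P.
Proof.
by move=> yY; rewrite /push mulr_sumr; apply: eq_bigr => g _; rewrite rmorphM /= yY mulrA.
Qed.

Lemma push_at1_fun P z z' : push_at1 P z -> push_at1 P z' -> z = z'.
Proof. by move=> [r Dr <-] [r' Dr' <-]; move: Dr'; rewrite Dr => /tofrac_inj ->. Qed.

Lemma push_at1D P Q z z' : push_at1 P z -> push_at1 Q z' -> push_at1 (P + Q) (z + z').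
Proof.
move=> [r Dr <-] [r' Dr' <-]; exists (r + r'); first by rewrite pushD Dr Dr' rmorphD.
by rewrite rmorphD.
Qed.

Lemma push_at1Ml Y P z : (forall g : {ffun 'I_k -> 'I_n}, ps g Y = tofrac Y) ->
  push_at1 P z -> push_at1 (Y * P) (ev1 Y * z).
Proof.
move=> yY [r Dr <-]; exists (Y * r); first by rewrite pushMl // Dr rmorphM.
by rewrite rmorphM.
Qed.

Lemma push_at1_int (c : int) P z : push_at1 P z -> push_at1 (c%:~R * P) (c * z).
Proof.
move=> Pz; have ec : ev1 c%:~R = c by rewrite rmorph_int intz.
rewrite -[Q in Q * z]ec; apply: push_at1Ml => // g.
by rewrite !rmorph_int.
Qed.

Lemma push_at1_0 : push_at1 0 0.
Proof.
exists 0; rewrite ?rmorph0 // /push big1 // => g _.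
by rewrite rmorph0 mul0r.
Qed.

Lemma push_at1_sum (I : Type) (r : seq I) (Q : pred I) (P : I -> R) (z : I -> int) :
  (forall i, Q i -> push_at1 (P i) (z i)) ->
  push_at1 (\sum_(i <- r | Q i) P i) (\sum_(i <- r | Q i) z i).
Proof.
by move=> sf; elim/big_rec2: _ => [|i x y Qi]; [apply: push_at1_0 | apply: push_at1D; apply: sf].
Qed.

Lemma push_prod (p : 'I_k -> {poly int}) :
  push (\prod_a (ip R (p a)).[X a]) = \prod_a \sum_j (ip F (p a)).[yvar j] / @weight k n j.
Proof.
rewrite bigA_distr_bigA; apply: eq_bigr => g _.
rewrite rmorph_prod prodf_div; congr (_ / _); apply: eq_bigr => a _.
rewrite -horner_map /= poly_subst_x -map_poly_comp; congr _.[_].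
by apply: eq_map_poly => z /=; rewrite rmorph_int.
Qed.

Lemma push_at1_prod (p : 'I_k -> {poly int}) :
  push_at1 (\prod_a (ip R (p a)).[X a]) (\prod_a res n (p a)).
Proof.
have r_ex a : exists r : R,
    \sum_j (ip F (p a)).[yvar j] / @weight k n j = tofrac r /\ ev1 r = res n (p a).
  by have [r] := residue_int k n_gt0 (p a); exists r.
have [r rE] := fin_all_exists r_ex.
exists (\prod_a r a).
  by rewrite push_prod rmorph_prod; apply: eq_bigr => a _; have [] := rE a.
by rewrite rmorph_prod; apply: eq_bigr => a _; have [] := rE a.
Qed.

(** A monomial is a product of powers of the y's, which are scalars for [push], and of one-variable
    factors, to which [push_at1_prod] applies. *)
Lemma push_at1_ex P : exists z, push_at1 P z.
Proof.
rewrite [P]mpolyE; elim/big_rec: _ => [|m Q _ [z Qz]]; first by exists 0; apply: push_at1_0.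
suff [z' mz'] : exists z', push_at1 (P@_m *: 'X_[m]) z' by exists (z' + z); apply: push_at1D.
pose Y : R := \prod_(j < n) 'X_(rshift k j) ^+ m (rshift k j).
have yY (g : {ffun 'I_k -> 'I_n}) : ps g Y = tofrac Y.
  rewrite !rmorph_prod; apply: eq_bigr => j _; rewrite !rmorphXn; congr (_ ^+ _).
  exact: poly_subst_y.
have -> : P@_m *: 'X_[m] = (P@_m)%:~R * (Y * \prod_a (ip R 'X^(m (lshift n a))).[X a]).
  rewrite -mul_mpolyC mpolyXE_id big_split_ord mulrC [RHS]mulrC; congr (_ * _); last first.
    by rewrite -[in LHS](intz P@_m) rmorph_int.
  rewrite mulrC; congr (_ * _); apply: eq_bigr => a _.
  by rewrite map_polyXn hornerXn.
eexists; apply: push_at1_int; apply: push_at1Ml => //; exact: push_at1_prod.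
Qed.

End Pushforward.

Lemma sort_injective k n (g : 'I_k -> 'I_n) : injective g ->
  exists (h : 'I_k -> 'I_n) (s : 'S_k), {homo h : a b / (a < b)%N} /\ forall i, g i = h (s i).
Proof.
move=> gI; pose e := enum [set g i | i : 'I_k].
have se : size e = k by rewrite -cardE card_imset // card_ord.
have ge i : g i \in e by rewrite mem_enum imset_f.
pose h i := nth (g i) e i.
have idx i : (index (g i) e < k)%N by rewrite -[X in (_ < X)%N]se index_mem.
pose s0 i := Ordinal (idx i).
have hs i : h (s0 i) = g i by rewrite /h /s0 /= nth_index.
have sI : injective s0 by move=> i j ij; apply: gI; rewrite -!hs ij.
exists h, (perm sI); split; last by move=> i; rewrite permE hs.
move=> a b ab; rewrite /h (set_nth_default (g a) (g b)) ?se //.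
rewrite -!(nth_map _ (g a : nat) (fun i : 'I_n => i : nat)) ?se //.
rewrite (sorted_ltn_nth ltn_trans) ?inE ?size_map ?se //.
rewrite /e /enum_mem -enumT; apply: (subseq_sorted ltn_trans (s2 := iota 0 n)); last first.
  exact: iota_ltn_sorted.
by rewrite -val_enum_ord map_subseq // filter_subseq.
Qed.

Lemma rmorph_mpoly_eq m (L : comNzRingType) (f g : {rmorphism {mpoly int[m]} -> L}) :
  (forall a, f 'X_a = g 'X_a) -> f =1 g.
Proof.
move=> fg p; rewrite [p]mpolyE !rmorph_sum; apply: eq_bigr => d _.
rewrite -mul_mpolyC -[p@_d]intz rmorph_int !rmorphM !rmorph_int; congr (_ * _).
rewrite mpolyXE_id !rmorph_prod; apply: eq_bigr => a _.
by rewrite !rmorphXn /= fg.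
Qed.

Lemma cross_mul (L : fieldType) (a b c d : L) : b != 0 -> d != 0 ->
  a / b = c / d -> a * d = c * b.
Proof. by move=> b0 d0 /eqP; rewrite eqr_div // => /eqP. Qed.

Lemma mulf_eq0_l (L : fieldType) (a b : L) : b != 0 -> a * b = 0 -> a = 0.
Proof. by move=> b0 /eqP; rewrite mulf_eq0 (negPf b0) orbF => /eqP. Qed.

Lemma divf_eq0_num (L : fieldType) (a b : L) : b != 0 -> a / b = 0 -> a = 0.
Proof. by move=> b0; apply: mulf_eq0_l; rewrite invr_eq0. Qed.

Section GridVanishing.
Variables k n : nat.
Hypothesis n_gt0 : (0 < n)%N.
Local Notation F := (ratfun k n).
Local Notation R := {mpoly int[k + n]}.
Local Notation tofrac := (@FracField.tofrac R).
Local Notation xvar := (@xvar k n).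
Local Notation yvar := (@yvar k n).
Local Notation X a := ('X_(lshift n a) : R).
Local Notation ps g := (poly_subst (fun a => yvar (g a)) yvar).

Definition perm_x (s : 'S_k) (p : R) : R :=
  p \mPo [tuple match split a with inl i => X (s i) | inr j => 'X_(rshift k j) end | a < k + n].

Lemma poly_subst_perm_x vx vy s p :
  poly_subst vx vy (perm_x s p) = poly_subst (fun i => vx (s i)) vy p.
Proof.
pose f : {rmorphism R -> F} := poly_subst vx vy \o (comp_mpoly
  [tuple match split a with inl i => X (s i) | inr j => 'X_(rshift k j) end | a < k + n]).
apply: (rmorph_mpoly_eq (f := f) (g := poly_subst (fun i => vx (s i)) vy)) => a.
rewrite /f /= comp_mpolyXU -tnth_nth tnth_mktuple.
case: (split_ordP a) => i ->; first by rewrite !poly_subst_x.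
by rewrite !poly_subst_y.
Qed.

Lemma poly_subst_id p : poly_subst xvar yvar p = tofrac p.
Proof.
apply: (rmorph_mpoly_eq (f := poly_subst xvar yvar) (g := tofrac)) => a.
by case: (split_ordP a) => i ->; [apply: poly_subst_x | apply: poly_subst_y].
Qed.

Lemma eq_poly_subst_x vx vx' vy p : vx =1 vx' ->
  @poly_subst k n vx vy p = poly_subst vx' vy p.
Proof.
move=> ev; apply: (rmorph_mpoly_eq (f := poly_subst vx vy) (g := poly_subst vx' vy)) => a.
case: (split_ordP a) => i ->; last by rewrite /= !poly_subst_y.
by rewrite /= !poly_subst_x ev.
Qed.

(** The ideal only speaks of increasing tuples; symmetry in x extends the vanishing to all tuples of
    distinct y's. Symmetry holds for the quotient and not for p itself, hence the cross-multiplied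
    form [E3]. *)
Lemma KT_grid p m (g : 'I_k -> 'I_n) : KT_ideal (tofrac p / tofrac 'X_[m]) ->
  injective g -> ps g p = 0.
Proof.
move=> /KT_idealP[/sym_laurentP[_ sh] vh] /sort_injective[h [s [hh gE]]].
have x0 := @xvar_neq0 k n; have y0 := @yvar_neq0 k n.
have hv vx : (forall i, vx i != 0) -> has_value vx yvar (tofrac p / tofrac 'X_[m])
    (poly_subst vx yvar p / poly_subst vx yvar 'X_[m]).
  move=> vx0; apply: has_value_div; [exact: poly_subst_monomial_neq0 | exact: has_value_poly..].
have E1 := value_at_inj (@tofrac_inj k n) (hv (fun i => xvar (s i)) (fun i => x0 _)) (sh s).
have E2 := value_at_inj (@tofrac_inj k n) (hv (fun i => yvar (h i)) (fun i => y0 _)) (vh h hh).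
have M0 vx : (forall i, vx i != 0) -> poly_subst vx yvar 'X_[m] != 0.
  by move=> vx0; apply: poly_subst_monomial_neq0.
have E3 : perm_x s p * 'X_[m] = p * perm_x s 'X_[m].
  have T q : tofrac (perm_x s q) = poly_subst (fun i => xvar (s i)) yvar q.
    by rewrite -poly_subst_perm_x poly_subst_id.
  apply: (@tofrac_inj k n); rewrite !tofracM !T.
  exact: (cross_mul (M0 (fun i => xvar (s i)) (fun i => x0 _)) (@tofracX_neq0 k n m) E1).
have p0 : ps h p = 0 by exact: (divf_eq0_num (M0 (fun i => yvar (h i)) (fun i => y0 _)) E2).
have E4 := congr1 (ps h) E3; rewrite !rmorphM /= p0 mul0r poly_subst_perm_x in E4.
rewrite (eq_poly_subst_x (vx' := fun i => yvar (h (s i)))) => [|i]; last by rewrite gE.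
exact: (mulf_eq0_l (M0 (fun i => yvar (h i)) (fun i => y0 _)) E4).
Qed.

End GridVanishing.

Definition positions (s : seq bool) (a : nat) : seq nat :=
  [seq i <- iota a (size s) | nth false s (i - a)].

Lemma positions_cons b s a :
  positions (b :: s) a = if b then a :: positions s a.+1 else positions s a.+1.
Proof.
rewrite /positions /= subnn /=.
have -> : [seq i <- iota a.+1 (size s) | nth false (b :: s) (i - a)]
        = [seq i <- iota a.+1 (size s) | nth false s (i - a.+1)].
  by apply: eq_in_filter => i; rewrite mem_iota => /andP[ai _]; rewrite -(subnSK ai).
by case: b.
Qed.

Lemma size_positions s a : size (positions s a) = count id s.
Proof. by elim: s a => // b s IH a; rewrite positions_cons; case: b => /=; rewrite IH. Qed.

Lemma positions_uniq s a : uniq (positions s a).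
Proof. by rewrite filter_uniq // iota_uniq. Qed.

Lemma mem_positions s i : (i \in positions s 0) = nth false s i.
Proof.
rewrite mem_filter mem_iota subn0 add0n leq0n /=; have [//|si] := ltnP i (size s).
  by rewrite andbT.
by rewrite nth_default.
Qed.

Lemma positions_inj s t : size s = size t ->
  {subset positions s 0 <= positions t 0} -> count id s = count id t -> s = t.
Proof.
move=> st sub cst; apply: (@eq_from_nth _ false) => // i _.
rewrite -!mem_positions; have [] := uniq_min_size (positions_uniq s 0) sub.
  by rewrite !size_positions cst.
by move=> _ ->.
Qed.

Lemma zcols_positions s a j : (j < count id s)%N ->
  exists e, (zcols s a)`_j = zpow (nth 0%N (positions s a) j)%N e.
Proof.
elim: s a j => // b s IH a j; rewrite positions_cons; case: b => /=; last exact: IH.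
by case: j => [|j] /=; [exists (count id s) | exact: IH].
Qed.

Lemma alt_eq0 (S : comNzRingType) k (x : 'I_k -> S) ps a b :
  a != b -> x a = x b -> alt x ps = 0.
Proof.
move=> ab xab; rewrite /alt -det_tr; apply: (determinant_alternate ab) => j.
by rewrite !mxE xab.
Qed.

Lemma comb_clear_denominators (L : fieldType) (I : finType) (h v m p : L) (w q p' : I -> L) :
  h * m = p -> (forall i, q i * m = p' i) ->
  (h + \sum_i w i * q i) * v * m = v * p + \sum_i w i * (v * p' i).
Proof.
move=> hm qm; rewrite mulrAC mulrDl hm mulr_suml mulrDl mulrC; congr (_ + _).
by rewrite mulr_suml; apply: eq_bigr => i _; rewrite -qm; ring.
Qed.

Lemma divf_mulKl (L : fieldType) (a b c : L) : b != 0 -> a / b * (b * c) = a * c.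
Proof. by move=> b0; rewrite mulrA divfK. Qed.

Lemma mulr_rearrange (A : comNzRingType) (t s d x y : A) :
  t * (s * d * (x * y)) = s * (y * (t * (d * x))).
Proof. ring. Qed.

Lemma zpow_mul i p e q : ('X - 1) ^+ i * (zpow p e * q) = ('X - 1) ^+ (i + p) * ('X^e * q).
Proof. by rewrite /zpow exprD !mulrA. Qed.

Lemma leq_sum_eq (I : finType) (p b : I -> nat) : (forall i, (p i <= b i)%N) ->
  (\sum_i b i <= \sum_i p i)%N -> forall i, p i = b i.
Proof.
move=> le; rewrite leqNgt => ge i; apply/eqP; rewrite eqn_leq le /= leqNgt.
apply: contra ge => lt; rewrite (bigD1 i) //= [X in (_ < X)%N](bigD1 i) //=.
by rewrite -addSn leq_add // leq_sum.
Qed.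

Section LinearIndependence.
Variables k n : nat.
Hypothesis n_gt0 : (0 < n)%N.
Local Notation F := (ratfun k n).
Local Notation R := {mpoly int[k + n]}.
Local Notation tofrac := (@FracField.tofrac R).
Local Notation xvar := (@xvar k n).
Local Notation yvar := (@yvar k n).
Local Notation ip S := (map_poly (intmul (1 : S))).
Local Notation ev1 := (@meval (k + n) int (fun=> 1)).
Local Notation X := (fun a => 'X_(lshift n a) : R).
Local Notation ps g := (poly_subst (fun a => yvar (g a)) yvar).

Definition altR (t : seq bool) : R := alt X (map (ip R) (zcols t 0)).
Definition VR : R := Vand n X.

Lemma tofrac_altR t : tofrac (altR t) = alt xvar (map (ip F) (zcols t 0)).
Proof.
rewrite /altR rmorph_alt -map_comp; congr alt; apply: eq_map => p /=.
exact: fp_int.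
Qed.

Lemma tofrac_VR : tofrac VR = Vand n xvar.
Proof. exact: tofrac_altR. Qed.

Lemma gK_VR t : gK k n t * tofrac VR = tofrac (altR t).
Proof.
apply: etrans (congr1 (fun v => gK k n t * v) tofrac_VR) (etrans _ (esym (tofrac_altR t))).
have V0 : Vand n xvar != 0 by apply: Vand_neq0; apply: xvar_inj.
exact: divfK V0 _.
Qed.

Lemma VR_grid (g : {ffun 'I_k -> 'I_n}) : ~~ injectiveb g -> ps g VR = 0.
Proof.
move=> /injectivePn[a [b ab gab]]; rewrite /VR /Vand rmorph_alt.
by apply: (alt_eq0 _ ab); rewrite /= !poly_subst_x gab.
Qed.

(** The monomial clears denominators. At a non-injective tuple the Vandermonde determinant vanishes,
    at an injective one the element of the ideal does, and the multiples of y_i - 1 vanish at y =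
    1. *)
Lemma push_null f D : K_null f -> f * tofrac VR = tofrac D ->
  exists m : 'X_{1..k + n}, forall tau, push_at1 (tau * (D * 'X_[m])) 0.
Proof.
move=> [h [q [Ih sq ->]]] fD.
have [[[ph [mh hE]] _] _] := Ih.
have q_ex i : exists pm : R * 'X_{1..k + n}, q i = tofrac pm.1 / tofrac 'X_[pm.2].
  by have [[p [m ->]] _] := sq i; exists (p, m).
have [pm qE] := fin_all_exists q_ex.
pose M : R := 'X_[mh] * \prod_i 'X_[(pm i).2].
pose c i : R := 'X_[mh] * \prod_(j | j != i) 'X_[(pm j).2].
pose ch : R := \prod_i 'X_[(pm i).2].
exists (mh + \sum_i (pm i).2)%MM => tau.
have -> : 'X_[mh + \sum_i (pm i).2] = M by rewrite mpolyXD /M mprodXE.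
have ME i : M = 'X_[(pm i).2] * c i by rewrite /M /c (bigD1 i) //= mulrCA.
have DE : D * M = VR * (ph * ch) + \sum_i ('X_(rshift k i) - 1) * (VR * ((pm i).1 * c i)).
  apply: (@tofrac_inj k n).
  transitivity ((h + \sum_i (yvar i - 1) * q i) * tofrac VR * tofrac M).
    by rewrite fD tofracM.
  rewrite (@comb_clear_denominators _ _ h _ (tofrac M) (tofrac (ph * ch)) _ q
    (fun i => tofrac ((pm i).1 * c i))).
  - rewrite tofracD (tofracM VR); congr (_ + _); rewrite [RHS]rmorph_sum; apply: eq_bigr => i _.
    by rewrite /= !tofracM tofracB tofrac1.
  - by rewrite hE !tofracM divf_mulKl // tofracX_neq0.
  - by move=> i; rewrite qE (ME i) !tofracM divf_mulKl // tofracX_neq0.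
rewrite DE mulrDr mulr_sumr.
have z0 : 0 + \sum_(i < n) 0 = 0 :> int by rewrite big1 ?addr0.
rewrite -[X in push_at1 _ X]z0; apply: push_at1D; last first.
  apply: push_at1_sum => i _; rewrite mulrCA.
  have [z Hz] := push_at1_ex n_gt0 (tau * (VR * ((pm i).1 * c i))).
  have e0 : ev1 ('X_(rshift k i) - 1) = 0 by rewrite rmorphB rmorph1 /= mevalXU subrr.
  rewrite -(mul0r z) -e0; apply: push_at1Ml Hz => g.
  by rewrite !rmorphB !rmorph1 /= poly_subst_y.
exists 0; rewrite ?rmorph0 // /push big1 // => g _.
suff -> : ps g (tau * (VR * (ph * ch))) = 0 by rewrite mul0r.
rewrite !rmorphM /=; have [/injectiveP gI|gI] := boolP (injectiveb g); last first.
  by rewrite VR_grid // !(mul0r, mulr0).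
by rewrite (@KT_grid _ _ ph mh g _ gI) -?hE // !(mul0r, mulr0).
Qed.

(** The term of [s] in the expansion of the alternant, paired with prod_a z_a^(n-1-b_a). *)
Definition minor (t : seq bool) (m : 'X_{1..k + n}) (b : 'I_k -> nat) (s : 'S_k) : int :=
  \prod_a res n (('X - 1) ^+ (n.-1 - b a) * ((zcols t 0)`_(s a) * 'X^(m (lshift n a)))).

Lemma push_alt t m (b : 'I_k -> nat) :
  push_at1 (\prod_a (X a - 1) ^+ (n.-1 - b a) * (altR t * 'X_[m]))
    (\sum_(s : 'S_k) (-1) ^+ s * minor t m b s).
Proof.
pose Y : R := \prod_(j < n) 'X_(rshift k j) ^+ m (rshift k j).
have yY (g : {ffun 'I_k -> 'I_n}) : ps g Y = tofrac Y.
  rewrite !rmorph_prod; apply: eq_bigr => j _; rewrite !rmorphXn; congr (_ ^+ _).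
  exact: poly_subst_y.
have eY : ev1 Y = 1.
  rewrite rmorph_prod big1 // => j _.
  by rewrite rmorphXn /= mevalXU expr1n.
pose P (s : 'S_k) a : {poly int} :=
  ('X - 1) ^+ (n.-1 - b a) * ((zcols t 0)`_(s a) * 'X^(m (lshift n a))).
have -> : \prod_a (X a - 1) ^+ (n.-1 - b a) * (altR t * 'X_[m])
    = \sum_(s : 'S_k) ((-1) ^+ s)%:~R * (Y * \prod_a (ip R (P s a)).[X a]).
  rewrite mpolyXE_id big_split_ord /= -/Y /altR /alt -det_tr /determinant mulr_suml mulr_sumr.
  apply: eq_bigr => s _.
  have -> : \prod_a (ip R (P s a)).[X a]
    = \prod_a (X a - 1) ^+ (n.-1 - b a) * (\prod_a (ip R (zcols t 0)`_(s a)).[X a]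
       * \prod_(a < k) X a ^+ m (lshift n a)).
    rewrite -!big_split; apply: eq_bigr => a _.
    rewrite /P !rmorphM !rmorphXn rmorphB rmorph1 /= map_polyX !hornerM !horner_exp.
    by rewrite !hornerE.
  have -> : \prod_i (\matrix_(j < k, i0 < k) ([seq ip R p | p <- zcols t 0]`_j).[X i0])^T i (s i)
    = \prod_a (ip R (zcols t 0)`_(s a)).[X a].
    apply: eq_bigr => a _; rewrite !mxE; congr (_.[_]).
    have [st|ts] := ltnP (s a) (size (zcols t 0)); first by rewrite (nth_map 0).
    by rewrite !nth_default ?size_map // rmorph0.
  by rewrite rmorph_sign; apply: mulr_rearrange.
apply: push_at1_sum => s _; apply: push_at1_int.
rewrite -[minor _ _ _ _]mul1r -eY; apply: push_at1Ml => //.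
exact: push_at1_prod.
Qed.

(** In each variable the total exponent of z, n - 1 - b_a plus a position of [t], must not exceed n
    - 1. *)
Lemma minor_neq0 t m (b : 'I_k -> nat) s : count id t = k -> (forall a, (b a < n)%N) ->
  minor t m b s != 0 -> forall a, (nth 0%N (positions t 0) (s a) <= b a)%N.
Proof.
move=> ct bn /prodf_neq0 nz a; have := nz a isT.
have [|e ->] := @zcols_positions t 0 (s a); first by rewrite ct.
rewrite zpow_mul res_zpow //; case: ifP; first by rewrite eqxx.
move=> /negbT; rewrite -leqNgt => H _; have := bn a; lia.
Qed.

(** The powers of z combine to exactly z^(n-1), so the remaining powers of x enter by their value at
    x = 1. Hence the monomial that clears denominators does not matter. *)
Lemma minor_diag t m : count id t = k ->
  (forall i, i \in positions t 0 -> (i < n)%N) ->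
  minor t m (fun a => nth 0%N (positions t 0) a) 1 = 1.
Proof.
move=> ct tn; apply: big1 => a _; rewrite perm1.
have [|e ->] := @zcols_positions t 0 a; first by rewrite ct.
have pn : (nth 0%N (positions t 0) a < n)%N by apply: tn; rewrite mem_nth // size_positions ct.
rewrite zpow_mul res_zpow // ifF; last by lia.
have -> : (n.-1 - (n.-1 - nth 0%N (positions t 0) a + nth 0%N (positions t 0) a) = 0)%N by lia.
rewrite -exprD rmorphXn /= comp_polyX -horner_coef0 horner_exp !hornerE.
by rewrite expr1n.
Qed.

(** Take a frame [t0] with nonzero coefficient and least sum of positions, and pair with the power
    product of the z_a dual to it. A surviving term has positions bounded by those of [t0] up to a
    permutation; minimality of the sum makes them equal, which leaves [t0] with the identity. *)
Lemma K_independent (d : seq bool -> int) :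
  K_null (\sum_(t : n.-tuple bool | count id t == k) (d t)%:~R * gK k n t) ->
  forall t : n.-tuple bool, count id t = k -> d t = 0.
Proof.
set f := (X in K_null X) => Kf t1 ct1; apply/eqP/negPn/negP => dt1.
pose D := \sum_(t : n.-tuple bool | count id t == k) (d t)%:~R * altR t.
have fD : f * tofrac VR = tofrac D.
  rewrite /f /D [RHS]rmorph_sum [LHS]mulr_suml; apply: eq_bigr => t _.
  transitivity ((d t)%:~R * tofrac (altR t)); first by rewrite -mulrA gK_VR.
  by rewrite -(rmorph_int tofrac) -tofracM.
have [m Hm] := push_null Kf fD.
pose wsum (t : n.-tuple bool) := (\sum_(i < k) nth 0%N (positions t 0) i)%N.
pose Q (t : n.-tuple bool) := (count id t == k) && (d t != 0).
have Qt1 : Q t1 by rewrite /Q ct1 eqxx dt1.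
case: (arg_minnP wsum Qt1) => t0 /andP[/eqP ct0 dt0] minw.
pose b (a : 'I_k) := nth 0%N (positions t0 0) a.
have b_in a : b a \in positions t0 0 by rewrite mem_nth // size_positions ct0.
have pos_lt (t : n.-tuple bool) i : i \in positions t 0 -> (i < n)%N.
  by rewrite mem_filter mem_iota size_tuple => /andP[].
have bn a : (b a < n)%N by apply: pos_lt (b_in a).
have := Hm (\prod_a (X a - 1) ^+ (n.-1 - b a)).
rewrite {1}/D mulr_suml mulr_sumr => H0.
have H1 : push_at1 (\sum_(t : n.-tuple bool | count id t == k)
     \prod_a (X a - 1) ^+ (n.-1 - b a) * ((d t)%:~R * altR t * 'X_[m]))
   (\sum_(t : n.-tuple bool | count id t == k) d t *
      (\sum_(s : 'S_k) (-1) ^+ s * minor t m b s)).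
  apply: push_at1_sum => t _; rewrite -mulrA mulrCA; apply: push_at1_int.
  exact: push_alt.
have := push_at1_fun H0 H1 => /esym.
have minor_eq (t : n.-tuple bool) s : Q t -> minor t m b s != 0 ->
    forall a, b a = nth 0%N (positions t 0) (s a).
  move=> Qt nz; have ct : count id t = k by case/andP: Qt => /eqP.
  have le := minor_neq0 ct bn nz.
  have ws : (\sum_a nth 0%N (positions t 0) (s a) = wsum t)%N.
    by rewrite /wsum [RHS](reindex_inj (@perm_inj _ s)).
  have := minw t Qt; rewrite -ws => ge a.
  by apply/esym/(leq_sum_eq le).
rewrite (bigD1 t0) ?ct0 ?eqxx //= [X in _ + X]big1 ?addr0; last first.
  move=> t /andP[/eqP ct tt0]; have [->|dt] := eqVneq (d t) 0; first by rewrite mul0r.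
  have Qt : Q t by rewrite /Q ct eqxx dt.
  rewrite big1 ?mulr0 // => s _; apply/eqP; rewrite mulf_eq0; apply/orP; right.
  apply: contraNT tt0 => nz; apply/eqP/val_inj/esym.
  apply: positions_inj; rewrite ?size_tuple ?ct0 ?ct // => i.
  move=> /(nthP 0%N)[j]; rewrite size_positions ct0 => jk <-.
  rewrite -[nth _ _ j]/(b (Ordinal jk)) (minor_eq t s Qt nz) mem_nth // size_positions ct.
  exact: ltn_ord.
rewrite (bigD1 (1%g : 'S_k)) //= big1 ?addr0; last first.
  move=> s s1; apply/eqP; rewrite mulf_eq0; apply/orP; right.
  apply: contraNT s1 => nz; apply/eqP/permP => a; rewrite perm1.
  have Qt0 : Q t0 by rewrite /Q ct0 eqxx dt0.
  have /eqP := minor_eq t0 s Qt0 nz a; rewrite nth_uniq ?positions_uniq ?size_positions ?ct0 //.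
  by move=> /eqP/val_inj.
rewrite odd_perm1 mul1r minor_diag //; last exact: pos_lt.
by rewrite mulr1 => /eqP; rewrite (negPf dt0).
Qed.

End LinearIndependence.

(** * Determinantal formula for the Grothendieck polynomials *)

Section UpperColumns.
Variables (L : fieldType) (n : nat).
Implicit Types (v : 'I_n -> L).

(* The analogue of zpow before the specialization y = 1: 1 - 'X becomes a product over
   the first a of the variables. *)
Definition ypow v a : {poly L} := \prod_(j < n | (j < a)%N) (1 - (v j)^-1 *: 'X).

Fixpoint ucols v (s : seq bool) (a : nat) : seq {poly L} :=
  match s with
  | [::] => [::]
  | true :: t => ypow v a * 'X^(count id t) :: ucols v t a.+1
  | false :: t => ucols v t a.+1
  end.

Lemma size_ucols v s a : size (ucols v s a) = count id s.
Proof. by elim: s a => [|[] s IH] a //=; rewrite IH. Qed.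

Lemma ypowS v (i : 'I_n) : ypow v i.+1 = ypow v i * (1 - (v i)^-1 *: 'X).
Proof.
rewrite /ypow (bigD1 i) //= mulrC; congr (_ * _); apply: eq_bigl => j.
by rewrite ltnS -(inj_eq val_inj) /=; case: ltngtP.
Qed.

(** Unless a = j, the product contains both of the factors of v i and v j or neither. *)
Lemma ypow_tperm v (i j : 'I_n) (a : nat) : j = i.+1 :> nat -> a != j ->
  ypow (v \o tperm i j) a = ypow v a.
Proof.
move=> ji aj; rewrite /ypow (reindex_inj (@perm_inj _ (tperm i j))) /=.
apply: eq_big => [l|l _]; last by rewrite tpermK.
have H : (j < a)%N = (i < a)%N by rewrite ji; move: aj; rewrite ji; lia.
by case: tpermP => // ->.
Qed.

Lemma ucols_cat v s t a :
  ucols v (s ++ t) a = [seq p * 'X^(count id t) | p <- ucols v s a] ++ ucols v t (a + size s).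
Proof.
elim: s a => [|b s IH] a /=; first by rewrite addn0.
rewrite IH addSnnS; case: b => //=; congr (_ :: _).
by rewrite count_cat exprD mulrA.
Qed.

Lemma ucols_tperm v (i j : 'I_n) s a : j = i.+1 :> nat ->
  (a + size s <= j)%N || (j < a)%N -> ucols (v \o tperm i j) s a = ucols v s a.
Proof.
move=> ji; elim: s a => //= b s IH a H; rewrite IH; last by lia.
by case: b => //; rewrite ypow_tperm //; lia.
Qed.

(** Only the column at position j is not symmetric in v i and v j, so by linearity the divided
    difference acts on it alone. It sends 1 - X / v i to 1, as (v i - X) - (v j - X) = v i - v j,
    and this moves the column to position i. *)
Lemma ucols_step k (x : 'I_k -> L) v (i j : 'I_n) s t :
  j = i.+1 :> nat -> size s = i -> (count id s + (count id t).+1)%N = k ->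
  v i != 0 -> v j != 0 -> v i != v j ->
  (v i * alt x (ucols v (s ++ [:: false, true & t]) 0)
   - v j * alt x (ucols (v \o tperm i j) (s ++ [:: false, true & t]) 0)) / (v i - v j)
  = alt x (ucols v (s ++ [:: true, false & t]) 0).
Proof.
move=> ji si ck vi vj vij; rewrite !ucols_cat /= !add0n si -ji.
rewrite (ucols_tperm _ ji); last by lia.
rewrite (ucols_tperm _ ji); last by lia.
set P := map _ _; set Q := ucols v t _.
have sP : (size P < k)%N by rewrite size_map size_ucols; lia.
have phi w : ypow w j = ypow w i * (1 - (w i)^-1 *: 'X) by rewrite ji ypowS.
have phi' : ypow (v \o tperm i j) i = ypow v i.
  by apply: ypow_tperm => //; rewrite ji; lia.
rewrite !phi phi' /= tpermL; set m := count id t; set f := ypow v i.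
have E c : f * (1 - c *: 'X) * 'X^m = - c *: (f * 'X^(m.+1)) + f * 'X^m.
  by rewrite -!mul_polyC polyCN exprS; ring.
rewrite !E !alt_linear //.
have d0 : v i - v j != 0 by rewrite subr_eq0.
by field; rewrite d0 vi vj.
Qed.

Lemma ucols_nseq v k : (k <= n)%N ->
  ucols v (nseq (n - k) false ++ nseq k true) 0
  = [seq ypow v (n - k) * p | p <- [seq 'X^(k.-1 - j) * \prod_(l < n | (n - k <= l < n - k + j)%N)
      (1 - (v l)^-1 *: 'X) | j : 'I_k <- enum 'I_k]].
Proof.
move=> kn; rewrite ucols_cat size_nseq.
have -> : ucols v (nseq (n - k) false) 0 = [::] by elim: (n - k)%N 0%N => //= m IH a.
rewrite /= add0n -map_comp.
have gen m a : ucols v (nseq m true) a = [seq ypow v (a + j) * 'X^(m.-1 - j) | j <- iota 0 m].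
  elim: m a => //= m IH a; rewrite IH addn0 subn0 count_nseq mul1n; congr (_ :: _).
  rewrite (iotaDl 1 0 m) -map_comp; apply/eq_in_map => j.
  by rewrite mem_iota /= => jm; congr (ypow _ _ * 'X^_); lia.
rewrite gen -val_enum_ord -map_comp; apply: eq_map => j /=.
rewrite [in RHS]mulrCA [RHS]mulrC; congr (_ * _).
rewrite /ypow (bigID (fun l : 'I_n => (l < n - k)%N)) /=; congr (_ * _); apply: eq_bigl => l; lia.
Qed.

Lemma size_prod_deg1 (I : Type) (r : seq I) (P : pred I) (p : I -> {poly L}) :
  (forall i, size (p i) <= 2)%N -> (size (\prod_(i <- r | P i) p i)%R <= (count P r).+1)%N.
Proof.
move=> sp; elim: r => [|i r IH]; first by rewrite big_nil size_poly1.
rewrite big_cons /=; case: (P i) => //=.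
apply: (leq_trans (size_polyMleq _ _)).
by have := leq_add (sp i) IH; rewrite add2n; case: (_ + _)%N.
Qed.

(** The common factor [ypow v (n - k)] comes out as the defining product of the full rectangle; what
    remains is triangular with constant terms 1. *)
Lemma alt_ucols_full k (x : 'I_k -> L) v : (k <= n)%N ->
  alt x (ucols v (nseq (n - k) false ++ nseq k true) 0)
  = (\prod_(i < k) \prod_(j < n | (j < n - k)%N) (1 - x i / v j))
    * alt x [seq 'X^(k.-1 - j) | j : 'I_k <- enum 'I_k].
Proof.
move=> kn; rewrite ucols_nseq // alt_scale ?size_map ?size_enum_ord //.
rewrite alt_triangular => [|j].
  rewrite [X in _ * (X * _)]big1 ?mul1r; last first.
    move=> j _; rewrite -horner_coef0 horner_prod big1 // => l _.
    by rewrite !hornerE ?mulr0 ?subr0.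
  congr (_ * _); apply: eq_bigr => i _; rewrite horner_prod.
  by apply: eq_bigr => j _; rewrite !hornerE mulrC.
apply: (leq_trans (size_prod_deg1 _ _ _)) => [l|].
  rewrite (leq_trans (size_polyD _ _)) // geq_max size_poly1 size_polyN.
  by rewrite (leq_trans (size_scale_leq _ _)) ?size_polyX.
rewrite ltnS -[index_enum _]enumT.
rewrite -(count_map (fun i : 'I_n => i : nat) (fun l => n - k <= l < n - k + j)%N) val_enum_ord.
rewrite -size_filter -[X in (_ <= X)%N](size_iota (n - k)); apply: uniq_leq_size.
  by rewrite filter_uniq // iota_uniq.
by move=> l; rewrite mem_filter !mem_iota => /andP[].
by rewrite -enumT size_enum_ord.
Qed.

End UpperColumns.

Lemma bits_split n (A : {set 'I_n}) (i j : 'I_n) : j = i.+1 :> nat ->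
  exists s t, [/\ size s = i, bits A = s ++ [:: i \in A, j \in A & t]
    & bits (i |: (A :\ j)) = s ++ [:: true, false & t]].
Proof.
move=> ji; have jn := ltn_ord j.
exists (take i (bits A)), (drop j.+1 (bits A)).
have sz (B : {set 'I_n}) : (i < size (bits B))%N by rewrite size_bits.
have sz' (B : {set 'I_n}) : (j < size (bits B))%N by rewrite size_bits.
have dec (B : {set 'I_n}) : bits B = take i (bits B) ++ [:: i \in B, j \in B & drop j.+1 (bits B)].
  rewrite -{1}(cat_take_drop i (bits B)) (drop_nth false (sz B)) nth_bits -ji.
  by rewrite (drop_nth false (sz' B)) nth_bits.
split; [by rewrite size_takel ?(ltnW (sz A)) | exact: dec |].
rewrite (dec (i |: (A :\ j))) !inE !eqxx /= (_ : (j == i) = false); last first.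
  by apply/eqP=> E; move: ji; rewrite E; lia.
have nb (B : {set 'I_n}) l (ln : (l < n)%N) : nth false (bits B) l = (Ordinal ln \in B).
  exact: (nth_bits B (Ordinal ln)).
congr (_ ++ [:: _, _ & _]).
  apply: (@eq_from_nth _ false); rewrite !size_takel ?(ltnW (sz _)) // => l li.
  have ln : (l < n)%N by lia.
  rewrite !nth_take // !(nb _ _ ln) !inE.
  have -> : (Ordinal ln == i) = false by apply/eqP=> E; move: li; rewrite -E /= ltnn.
  by have -> : (Ordinal ln == j) = false by apply/eqP=> E; move: li ji; rewrite -E /=; lia.
apply: (@eq_from_nth _ false); rewrite !size_drop !size_bits // => l li.
have ln : (j.+1 + l < n)%N by lia.
rewrite !nth_drop !(nb _ _ ln) !inE.
have -> : (Ordinal ln == i) = false by apply/eqP=> E; move: ji; rewrite -E /=; lia.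
by have -> : (Ordinal ln == j) = false by apply/eqP=> /(congr1 (fun z : 'I_n => z : nat)) /=; lia.
Qed.

Lemma count_bits n (A : {set 'I_n}) : count id (bits A) = #|A|.
Proof.
rewrite count_map cardE [in RHS]/enum_mem -enumT size_filter.
by apply: eq_count.
Qed.

Lemma card_ltn n m : (m <= n)%N -> #|[set j : 'I_n | (j < m)%N]| = m.
Proof.
by move=> mn; rewrite -sum1dep_card -(big_ord_widen n (fun=> 1%N) mn) sum1_card card_ord.
Qed.

Lemma divdiff_mul (L : fieldType) (a b f w V d : L) : V != 0 ->
  (a * f - b * (w / V)) / d * V = (a * (f * V) - b * w) / d.
Proof. by move=> V0; rewrite mulrAC mulrBl -!mulrA mulVf ?mulr1. Qed.

Section UpperGrothendieck.
Variables k n : nat.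
Local Notation F := (ratfun k n).
Local Notation xvar := (@xvar k n).
Local Notation yvar := (@yvar k n).

Definition mono_cols : seq {poly F} := [seq 'X^(k.-1 - j) | j : 'I_k <- enum 'I_k].
Definition V0 : F := alt xvar mono_cols.

Lemma V0_neq0 : V0 != 0.
Proof. by rewrite /V0 alt_monomials mulf_neq0 ?signr_eq0 // vdm_neq0 //; apply: xvar_inj. Qed.

Lemma value_alt vy (ps qs : seq {poly F}) :
  (forall j i, has_value xvar vy (ps`_j)`_i (qs`_j)`_i) ->
  has_value xvar vy (alt xvar ps) (alt xvar qs).
Proof.
move=> pq; apply: has_value_det => j i; rewrite !mxE; apply: has_value_horner => //.
exact: has_value_x.
Qed.

Lemma value_V0 vy : has_value xvar vy V0 V0.
Proof.
apply: value_alt => j i; have [jk|kj] := ltnP j k; last first.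
  have -> : mono_cols`_j = 0 by rewrite nth_default // size_map size_enum_ord.
  by rewrite coef0; apply: has_value0.
rewrite /mono_cols (nth_map (Ordinal jk)) ?size_enum_ord // coefXn.
exact: (has_value_int _ _ (nat_of_bool _)).
Qed.

Lemma value_polyM vy (p p' q q' : {poly F}) :
  (forall i, has_value xvar vy p`_i p'`_i) -> (forall i, has_value xvar vy q`_i q'`_i) ->
  forall i, has_value xvar vy (p * q)`_i (p' * q')`_i.
Proof.
move=> pp qq i; rewrite !coefM; apply: has_value_sum => j _; exact: has_valueM.
Qed.

Lemma value_ucols vy (v w : 'I_n -> F) s :
  (forall j, w j != 0) -> (forall j, has_value xvar vy (v j) (w j)) ->
  forall a j i, has_value xvar vy ((ucols v s a)`_j)`_i ((ucols w s a)`_j)`_i.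
Proof.
move=> w0 vw.
have v1 (i : nat) (c : nat) : has_value xvar vy ('X^c : {poly F})`_i ('X^c : {poly F})`_i.
  by rewrite coefXn; apply: (has_value_int _ _ (nat_of_bool _)).
have vpow a i : has_value xvar vy (ypow v a)`_i (ypow w a)`_i.
  rewrite /ypow; move: i; elim/big_rec2: _ => [|l p q _ IH] i.
    exact: (v1 i 0).
  apply: value_polyM => // {}i; rewrite !coefB !coefZ; apply: has_valueB.
    exact: (v1 i 0).
  by apply: has_valueM; [apply: has_valueV | apply: (v1 i 1)].
elim: s => [|b s IH] a j i /=; first by rewrite nth_nil coef0; apply: has_value0.
case: b => //; case: j => [|j] //=.
by apply: value_polyM => {}i.
Qed.

Lemma value_div_V0 vy f c d : f * V0 = c -> has_value xvar vy c d -> has_value xvar vy f (d / V0).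
Proof.
move=> fV cd; rewrite -(mulfK V0_neq0 f) fV.
by apply: has_value_div => //; [apply: V0_neq0 | apply: value_V0].
Qed.

(** The denominator [V0] is free of y, so a divided difference acts on the numerator alone, where it
    is [ucols_step]. *)
Lemma double_groth_alt A f : (k <= n)%N -> @is_double_groth k n A f ->
  #|A| = k /\ f * V0 = alt xvar (ucols yvar (bits A) 0).
Proof.
move=> kn; elim=> [|{}A {}f i j ji jA iA _ [cA fA]].
  have bE : bits [set i : 'I_n | (n - k <= i)%N] = nseq (n - k) false ++ nseq k true.
    apply: (@eq_from_nth _ false); rewrite size_bits ?size_cat ?size_nseq ?subnK // => l ln.
    rewrite (nth_bits _ (Ordinal ln)) inE nth_cat !nth_nseq size_nseq /=.
    by case: ltnP => // nl; rewrite ifT //; lia.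
  split; first by rewrite -count_bits bE count_cat !count_nseq /= mul0n mul1n.
  by rewrite bE alt_ucols_full.
have ij : i != j by apply: contraNneq iA => ->.
split.
  by rewrite cardsU1 !inE (negPf iA) andbF /= -[in RHS]cA [in RHS](cardsD1 j) jA.
have [s [t [si bA ->]]] := bits_split A ji.
move: fA; rewrite bA (negPf iA) jA => fA.
pose v j := yvar j.
have v0 j' : v (tperm i j j') != 0 by apply: yvar_neq0.
have fs := value_div_V0 fA (value_alt (value_ucols (s ++ [:: false, true & t]) v0
   (fun l => has_value_y xvar (fun l => yvar (tperm i j l)) l) 0%N)).
have sE : y_swap i j f = _ := rsubstP fs.
have vij : yvar i != yvar j by apply: contra ij => /eqP/yvar_inj ->.
rewrite /divdiff sE.
have cs : (count id s + (count id t).+1)%N = k.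
  by rewrite -cA -count_bits bA (negPf iA) jA count_cat.
rewrite -(ucols_step xvar (v := yvar) ji si cs) ?yvar_neq0 // -fA.
exact: divdiff_mul V0_neq0.
Qed.

Lemma full_frame (A : {set 'I_n}) : (k <= n)%N -> #|A| = k ->
  (forall i j : 'I_n, j = i.+1 :> nat -> i \in A -> j \in A) ->
  A = [set i : 'I_n | (n - k <= i)%N].
Proof.
move=> kn cA Aup.
have up (i j : 'I_n) : (i <= j)%N -> i \in A -> j \in A.
  move=> ij iA; have [m jE] : exists m, j = (i + m)%N :> nat by exists (j - i)%N; lia.
  elim: m j jE {ij} => [|m IH] j jE; first by rewrite (_ : j = i) //;
    apply: val_inj; rewrite /= jE addn0.
  have ln : (i + m < n)%N by have := ltn_ord j; lia.
  by apply: (Aup (Ordinal ln)); [rewrite jE addnS | apply: IH].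
apply/eqP; rewrite eqEcard; apply/andP; split; last first.
  have -> : #|[set i : 'I_n | (n - k <= i)%N]| = k; last by rewrite cA.
  have := cardsC [set i : 'I_n | (i < n - k)%N].
  have -> : ~: [set i : 'I_n | (i < n - k)%N] = [set i : 'I_n | (n - k <= i)%N].
    by apply/setP => i; rewrite !inE -leqNgt.
  have -> : #|[set i : 'I_n | (i < n - k)%N]| = (n - k)%N.
    by rewrite card_ltn ?leq_subr.
  by rewrite card_ord; lia.
apply/subsetP => i iA; rewrite inE leqNgt; apply/negP => ik.
have : (#|[set j : 'I_n | (i <= j)%N]| <= k)%N.
  by rewrite -cA; apply: subset_leq_card; apply/subsetP => j; rewrite inE => ij; apply: up ij iA.
have := cardsC [set j : 'I_n | (j < i)%N].
have -> : ~: [set j : 'I_n | (j < i)%N] = [set j : 'I_n | (i <= j)%N].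
  by apply/setP => j; rewrite !inE -leqNgt.
have -> : #|[set j : 'I_n | (j < i)%N]| = i.
  by rewrite card_ltn // ltnW.
by rewrite card_ord; lia.
Qed.

(** Unless the up-steps come last, some up-step is followed by a right-step; exchanging the two
    gives a frame with sum of positions larger by one, from which A is obtained by one divided
    difference. *)
Lemma double_groth_exists (A : {set 'I_n}) : (k <= n)%N -> #|A| = k ->
  exists f : F, is_double_groth A f.
Proof.
move=> kn; have [m] := ubnP (n * k - \sum_(i in A) i)%N.
elim: m A => // m IH A le cA.
have [/existsP[i /existsP[j /and3P[/eqP ji iA jA]]]|] :=
  boolP [exists i : 'I_n, exists j : 'I_n, [&& j == i.+1 :> nat, i \in A & j \notin A]]; last first.
  move=> /existsPn H.
  rewrite (full_frame kn cA); first by eexists; apply: Groth_full.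
  move=> i j ji iA; apply/negPn/negP => jA; have /existsPn/(_ j) := H i.
  by rewrite ji eqxx iA jA.
have ij : j != i by apply: contraNneq jA => ->.
have sA : (\sum_(l in A) l <= n * k)%N.
  rewrite -cA mulnC -sum_nat_const; apply: leq_sum => l _; exact: ltnW.
pose B := j |: (A :\ i).
have cB : #|B| = k by rewrite cardsU1 !inE (negPf jA) andbF -cA (cardsD1 i A) iA.
have sB : (\sum_(l in B) l <= n * k)%N.
  rewrite -cB mulnC -sum_nat_const; apply: leq_sum => l _; exact: ltnW.
have [|f fB] := IH B _ cB.
  have sE : (\sum_(l in B) l = (\sum_(l in A) l).+1)%N.
    by rewrite /B big_setU1 ?inE ?(negPf jA) ?andbF //= (big_setD1 i iA) /= ji addSn.
  by rewrite sE; rewrite sE in sB; lia.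
exists (divdiff i j f).
have -> : A = i |: (B :\ j).
  apply/setP => l; rewrite !inE; case: (eqVneq l i) => [->|li]; first by rewrite iA.
  by case: (eqVneq l j) => [->|lj] //=; rewrite (negPf jA).
apply: Groth_step => //; first by rewrite !inE eqxx.
by rewrite !inE eqxx orbF eq_sym ij.
Qed.

Lemma double_groth_mul_V0 (A : {set 'I_n}) : (k <= n)%N -> #|A| = k ->
  double_groth k A * V0 = alt xvar (ucols yvar (bits A) 0).
Proof.
move=> kn cA; have [f fA] := double_groth_exists kn cA.
exact: (double_groth_alt kn (epsilon_spec (inhabits 0) _ (ex_intro _ f fA))).2.
Qed.

End UpperGrothendieck.

Lemma bits_star n (A : {set 'I_n}) : bits (star A) = rev (bits A).
Proof.
apply: (@eq_from_nth _ false); rewrite ?size_rev !size_bits // => i ni.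
rewrite nth_rev ?size_bits // (nth_bits _ (Ordinal ni)).
rewrite -[(n - i.+1)%N]/(rev_ord (Ordinal ni) : nat) nth_bits /star.
by rewrite -{1}(rev_ordK (Ordinal ni)) mem_imset //; apply: rev_ord_inj.
Qed.

Lemma card_star n (A : {set 'I_n}) : #|star A| = #|A|.
Proof. by rewrite card_imset //; apply: rev_ord_inj. Qed.

Lemma alt_cat0 (S : comNzRingType) k (x : 'I_k -> S) P Q : (size P < k)%N ->
  alt x (P ++ 0 :: Q) = 0.
Proof.
move=> sP; have := alt_linear x Q 1 0 0 sP; rewrite scale1r addr0 mul1r => /eqP.
by rewrite eq_sym -subr_eq0 addrK => /eqP.
Qed.

(** At y = 1 the product [ypow] is (1 - X)^a = (-1)^a z^a, so every column yields a sign. [P]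
    collects the columns already converted. *)
Lemma alt_ucols1 (L : fieldType) n k (x : 'I_k -> L) P s a :
  (a + size s <= n)%N -> (size P + count id s = k)%N ->
  alt x (P ++ ucols (fun _ : 'I_n => 1) s a)
  = (-1) ^+ sumn (positions s a) * alt x (P ++ map (map_poly (intmul 1)) (zcols s a)).
Proof.
elim: s P a => [|b s IH] P a an ck; first by rewrite mul1r.
rewrite positions_cons; case: b an ck => /= an ck; last by apply: IH; lia.
set m := count id s.
have -> : ypow (fun _ : 'I_n => 1 : L) a * 'X^m = (-1) ^+ a *: map_poly (intmul 1) (zpow a m) + 0.
  rewrite addr0 /zpow rmorphM !rmorphXn rmorphB rmorph1 /= map_polyX scalerAl; congr (_ * _).
  rewrite /ypow invr1 scale1r -(big_ord_widen n (fun=> 1 - 'X : {poly L})); last by lia.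
  rewrite prodr_const card_ord -opprB [LHS]exprNn -mul_polyC. congr (_ * _).
  by rewrite rmorphXn rmorphN rmorph1.
have sP : (size P < k)%N by rewrite -ck add1n addnS ltnS leq_addr.
rewrite alt_linear // alt_cat0 // addr0 -!cat_rcons.
by rewrite IH ?size_rcons ?addSnnS //; rewrite exprD mulrA.
Qed.

Lemma mulrACC (L : fieldType) (p s t g V : L) : V != 0 ->
  t * t = 1 -> p * 1 * (s * (g * V) / (t * V)) = p * (s * t * g).
Proof.
move=> V0 tt; have t0 : t != 0.
  by apply/eqP=> t0; move/eqP: tt; rewrite t0 mul0r eq_sym oner_eq0.
have ti : t^-1 = t by rewrite -[LHS]mul1r -tt mulfK.
by rewrite invfM ti; field.
Qed.

Section DualGrothendieck.
Variables k n : nat.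
Hypothesis kn : (k <= n)%N.
Local Notation F := (ratfun k n).
Local Notation xvar := (@xvar k n).
Local Notation yvar := (@yvar k n).

Lemma V0_Vand : V0 k n = (-1) ^+ (\sum_(j < k) j)%N * Vand n xvar.
Proof.
rewrite /V0 /mono_cols alt_monomials /Vand alt_unit_cols mulrA; congr (_ * _).
rewrite -[in RHS]signr_odd -signr_addb /vdm_sign addbA addbb addFb.
by [].
Qed.

(** At y = 1 the reversal of the y's disappears and only [star] on the frame remains. The sign with
    exponent 0 + ... + (k - 1) converts [V0] into [Vand]. *)
Lemma dual_groth1E (A : {set 'I_n}) : #|A| = k ->
  dual_groth1 k A = (\prod_(i < k) xvar i) *
    ((-1) ^+ sumn (positions (bits (star A)) 0) * (-1) ^+ (\sum_(j < k) j)%N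
     * gK k n (bits (star A))).
Proof.
move=> cA; have cS : #|star A| = k by rewrite card_star.
set s := bits _.
have fE := double_groth_mul_V0 kn cS.
pose v (j : 'I_n) : F := yvar (rev_ord j).
have v0 j : v j != 0 by apply: yvar_neq0.
have gV := value_div_V0 fE (value_alt (value_ucols s v0
   (fun l => has_value_y xvar (fun l => yvar (rev_ord l)) l) 0%N)).
have gE : rsubst xvar (fun j => yvar (rev_ord j)) (double_groth k (star A)) = _ := rsubstP gV.
have gVE := divfK (V0_neq0 k n) (alt xvar (ucols v s 0)).
have one0 (j : 'I_n) : (1 : F) != 0 by apply: oner_neq0.
have hV := value_div_V0 gVE (value_alt (value_ucols s one0
   (fun l => has_value_y xvar (fun _ : 'I_n => 1) (rev_ord l)) 0%N)).
rewrite /dual_groth1 /dual_groth gE.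
have := rsubstP (has_valueM (has_valueM (has_value_prod (index_enum 'I_k) (P := xpredT)
   (fun i _ => has_value_x xvar (fun _ : 'I_n => 1) i))
  (has_value_prod (index_enum 'I_n) (P := mem A) (fun i _ => has_valueV (one0 i)
     (has_value_y xvar (fun _ : 'I_n => 1) i)))) hV).
move=> ->.
have -> : \prod_(i in A) (1 : F)^-1 = 1 by rewrite big1 // => i _; rewrite invr1.
have ss : size s = n by apply: size_bits.
have := @alt_ucols1 _ n k xvar [::] s 0; rewrite ss leqnn count_bits cS !cat0s => ->//.
rewrite V0_Vand -(divfK (Vand_neq0 n (@xvar_inj k n)) (alt _ (map _ _))).
apply: mulrACC; first exact: Vand_neq0 (@xvar_inj k n).
by rewrite -exprD addnn -mul2n exprM sqrrN !expr1n.
Qed.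

End DualGrothendieck.

(** * Products of Grothendieck polynomials *)

Section IntegerMatrices.
Variables (A : comNzRingType) (N : nat) (g : 'I_N -> A).
Implicit Types (M : 'M[int]_N) (f : A) (a : 'I_N).

(** The error in the claim that multiplication by f has matrix M on the family [g]; it will be
    required to be null rather than zero. *)
Definition act_defect f M a : A := f * g a - \sum_b (M a b)%:~R * g b.

Lemma act_defect_int z a : act_defect z%:~R z%:M a = 0.
Proof.
rewrite /act_defect (bigD1 a) //= big1 => [|b ba]; first by rewrite mxE eqxx addr0 subrr.
by rewrite mxE eq_sym (negPf ba) mul0r.
Qed.

Lemma act_defect0 a : act_defect 0 0 a = 0.
Proof. by rewrite /act_defect mul0r big1 ?subr0 // => b _; rewrite mxE mul0r. Qed.

Lemma act_defect_unit M u c : g u = 1 ->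
  act_defect (g c) M u = \sum_b ((b == c)%:R - M u b)%:~R * g b.
Proof.
move=> gu; under [RHS]eq_bigr do rewrite rmorphB mulrBl.
rewrite sumrB /act_defect gu mulr1; congr (_ - _).
by rewrite (bigD1 c) //= eqxx mul1r big1 ?addr0 // => b /negPf->; rewrite mul0r.
Qed.

Lemma act_defectD f f' M M' a :
  act_defect (f + f') (M + M') a = act_defect f M a + act_defect f' M' a.
Proof.
rewrite /act_defect mulrDl addrACA -opprD -big_split /=; congr (_ - _).
by apply: eq_bigr => b _; rewrite mxE intrD mulrDl.
Qed.

(** Rows hold the expansions, so the matrix of the factor applied first stands on the left. *)
Lemma act_defectM f f' M M' a : act_defect (f * f') (M' *m M) a
  = f * act_defect f' M' a + \sum_b (M' a b)%:~R * act_defect f M b.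
Proof.
rewrite /act_defect mulrBr mulrA -addrA; congr (_ + _).
under [X in _ = _ + X]eq_bigr do rewrite mulrBr.
rewrite sumrB addrA mulr_sumr; under [X in _ = - X + _ - _]eq_bigr do rewrite mulrCA.
rewrite addNr add0r; congr (- _).
under [RHS]eq_bigr do rewrite mulr_sumr.
rewrite exchange_big /=; apply: eq_bigr => c _; rewrite mxE rmorph_sum mulr_suml.
by apply: eq_bigr => b _; rewrite rmorphM mulrA.
Qed.

End IntegerMatrices.

(** * Matrices indexed by frames and the commutant of the puzzle matrix *)

Section Frames.
Variables k n : nat.
Local Notation F := (ratfun k n).
Local Notation R := {mpoly int[k + n]}.
Local Notation tofrac := (@FracField.tofrac R).
Local Notation xvar := (@xvar k n).
Local Notation yvar := (@yvar k n).

Definition frames : {set n.-tuple bool} := [set t : n.-tuple bool | count id t == k].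
Definition frame (a : 'I_#|frames|) : seq bool := enum_val a.

Lemma size_frame a : size (frame a) = n. Proof. exact: size_tuple. Qed.

Lemma count_frame a : count id (frame a) = k.
Proof. by have := enum_valP a; rewrite inE => /eqP. Qed.

Lemma frame_inj : injective frame.
Proof. by move=> a b ab; apply: enum_val_inj; apply: val_inj. Qed.

Lemma frame_ex s : size s = n -> count id s = k -> exists a, frame a = s.
Proof.
move=> /eqP ss cs; have tf : Tuple ss \in frames by rewrite inE /= cs.
by exists (enum_rank_in tf (Tuple ss)); rewrite /frame enum_rankK_in.
Qed.

Lemma sum_frame (A : nmodType) (f : seq bool -> A) :
  \sum_(t : n.-tuple bool | count id t == k) f t = \sum_a f (frame a).
Proof.
rewrite -(big_enum_val (fun t : n.-tuple bool => f t)).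
by apply: eq_bigl => t; rewrite inE.
Qed.

Lemma sum_frame_supp (A : nmodType) (f : seq bool -> A) :
  (forall t, count id t != k -> f t = 0) ->
  \sum_(t : n.-tuple bool) f t = \sum_a f (frame a).
Proof.
move=> f0; rewrite -sum_frame [RHS]big_mkcond /=; apply: eq_bigr => t _.
by case: ifPn => // /f0.
Qed.

Definition gF (a : 'I_#|frames|) : F := gK k n (frame a).

Lemma frame_independent (n_gt0 : (0 < n)%N) (d : 'I_#|frames| -> int) :
  K_null (\sum_a (d a)%:~R * gF a) -> forall a, d a = 0.
Proof.
pose d' s := \sum_a (frame a == s)%:R * d a.
have dE a : d' (frame a) = d a.
  rewrite /d' (bigD1 a) //= eqxx mul1r big1 ?addr0 // => b ba.
  by rewrite (inj_eq frame_inj) (negPf ba) mul0r.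
move=> H a; rewrite -dE; have ta : size (frame a) == n by rewrite size_frame.
apply: (@K_independent k n n_gt0 d' _ (Tuple ta)); last exact: count_frame.
rewrite (sum_frame (fun t => (d' t)%:~R * gK k n t)).
by move: H; congr K_null; apply: eq_bigr => b _; rewrite dE.
Qed.

Definition pieri_mx j : 'M[int]_#|frames| :=
  \matrix_(a, b) (pw 'X false (frame a) (frame b))`_j.
Definition puz_mx l : 'M[int]_#|frames| :=
  \matrix_(a, b) puz_bits int l (frame a) (frame b).

(** The coefficient of u^j in [puz_pieri]; by [pw_count] only words with k up-steps contribute to
    the sums there. *)
Lemma pieri_puz_mx j l : size l = n -> pieri_mx j *m puz_mx l = puz_mx l *m pieri_mx j.
Proof.
move=> sl; apply/matrixP => a b; rewrite !mxE.
have sa := size_frame a; have sb := size_frame b.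
have := @puz_pieri l (frame a) (frame b); rewrite sa sb sl => /(_ erefl erefl).
have pE s t : puz_bits {poly int} l s t = (puz_bits int l s t)%:P.
  by rewrite /puz_bits -(rmorph_puz polyC).
rewrite (@sum_frame_supp _ (fun t => pw 'X false (frame a) t * puz_bits {poly int} l t (frame b))).
  rewrite (@sum_frame_supp _
    (fun t => pw 'X false t (frame b) * puz_bits {poly int} l (frame a) t)).
    move=> /(congr1 (coefp j)); rewrite /coefp !coef_sum => E.
    transitivity (\sum_c (pw 'X false (frame a) (frame c)
        * puz_bits {poly int} l (frame c) (frame b))`_j).
      by apply: eq_bigr => c _; rewrite pE coefMC !mxE.
    rewrite E; apply: eq_bigr => c _; rewrite pE coefMC !mxE mulrC; congr (_ * _).
  move=> t ct; case: (eqVneq (pw 'X false t (frame b) : {poly int}) 0) => [->|].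
    by rewrite mul0r.
  by move=> /pw_count; rewrite add0n count_frame => E; rewrite E eqxx in ct.
move=> t ct; case: (eqVneq (pw 'X false (frame a) t : {poly int}) 0) => [->|].
  by rewrite mul0r.
by move=> /pw_count; rewrite add0n count_frame => E; rewrite E eqxx in ct.
Qed.

Lemma pieri_act j a : K_null (act_defect gF (eK k n)`_j (pieri_mx j) a).
Proof.
pose f t : F := ((pw 'X false (frame a) t)`_j)%:~R * gK k n t.
have fs : \sum_(t : n.-tuple bool) f t = \sum_b f (frame b).
  apply: sum_frame_supp => t ct.
  case: (eqVneq (pw 'X false (frame a) t : {poly int}) 0) => [E|].
    by rewrite /f E coef0 mul0r.
  by move=> /pw_count; rewrite add0n count_frame => E; case/negP: ct; rewrite E.
have H : K_null ((eK k n)`_j * gK k n (frame a) - \sum_(t : n.-tuple bool) f t).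
  exact: pieri_K (count_frame a) (size_frame a).
rewrite fs in H.
have E : \sum_b (pieri_mx j a b)%:~R * gF b = \sum_b f (frame b).
  by apply: eq_bigr => b _; rewrite /pieri_mx mxE.
by rewrite /act_defect E.
Qed.

Section Acts.
Variable l : seq bool.
Hypothesis sl : size l = n.

(* Multiplication by f has a matrix that commutes with that of the puzzle coefficients. *)
Definition acts (f : F) : Prop := sym_laurent f /\
  exists M : 'M[int]_#|frames|, M *m puz_mx l = puz_mx l *m M
    /\ forall a, K_null (act_defect gF f M a).

Lemma acts_int z : acts z%:~R.
Proof.
split; first exact: sym_laurent_int.
exists z%:M; split=> [|a]; first by rewrite scalar_mxC.
by rewrite act_defect_int; apply: K_null0.
Qed.

Lemma actsD f f' : acts f -> acts f' -> acts (f + f').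
Proof.
move=> [sf [M [MZ Mf]]] [sf' [M' [MZ' Mf']]]; split; first exact: sym_laurentD.
exists (M + M'); split=> [|a]; first by rewrite mulmxDl mulmxDr MZ MZ'.
by rewrite act_defectD; apply: K_nullD.
Qed.

Lemma actsM f f' : acts f -> acts f' -> acts (f * f').
Proof.
move=> [sf [M [MZ Mf]]] [sf' [M' [MZ' Mf']]]; split; first exact: sym_laurentM.
exists (M' *m M); split=> [|a]; first by rewrite -mulmxA MZ !mulmxA MZ'.
rewrite act_defectM; apply: K_nullD; first exact: K_nullM.
by apply: K_null_sum => b _; apply: K_nullM; first exact: sym_laurent_int.
Qed.

Lemma acts_sum (I : Type) (r : seq I) (f : I -> F) :
  (forall i, acts (f i)) -> acts (\sum_(i <- r) f i).
Proof.
move=> af; elim/big_rec: _ => [|i x _]; first exact: (acts_int 0).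
exact: actsD.
Qed.

Lemma acts_prod (I : Type) (r : seq I) (f : I -> F) :
  (forall i, acts (f i)) -> acts (\prod_(i <- r) f i).
Proof.
move=> af; elim/big_rec: _ => [|i x _]; first exact: (acts_int 1).
exact: actsM.
Qed.

Lemma actsX f m : acts f -> acts (f ^+ m).
Proof.
by move=> af; elim: m => [|m IH]; [apply: (acts_int 1) | rewrite exprS; apply: actsM].
Qed.

Lemma eK_sym j : sym_laurent (eK k n)`_j.
Proof.
pose q : {poly R} := \prod_(i < k) (1 + 'X * ('X_(lshift n i) - 1)%:P).
have qE vx : map_poly (poly_subst vx yvar) q = \prod_(i < k) (1 + 'X * (vx i - 1)%:P).
  rewrite rmorph_prod; apply: eq_bigr => i _.
  rewrite rmorphD rmorphM rmorph1 /= map_polyX map_polyC /= rmorphB rmorph1 /=.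
  by rewrite poly_subst_x.
have fE : map_poly tofrac q = eK k n.
  rewrite rmorph_prod /eK; apply: eq_bigr => i _.
  by rewrite rmorphD rmorphM rmorph1 /= map_polyX map_polyC /= rmorphB rmorph1.
have eE : (eK k n)`_j = tofrac q`_j by rewrite -fE coef_map.
apply/sym_laurentP; split; first by rewrite eE; apply: is_laurent_poly.
move=> s; pose w i : F := xvar (s i).
have fE' : map_poly (poly_subst w yvar) q = eK k n.
  rewrite qE; apply/esym.
  exact: (reindex_inj (@perm_inj _ s)).
have E : poly_subst w yvar q`_j = (eK k n)`_j.
  by rewrite -fE' coef_map.
have := has_value_poly w yvar q`_j.
rewrite E -eE.
exact.
Qed.

Lemma acts_eK j : acts (eK k n)`_j.
Proof.
split; first exact: eK_sym.
by exists (pieri_mx j); split=> [|a]; [apply: pieri_puz_mx | apply: pieri_act].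
Qed.

End Acts.
End Frames.

(** * Symmetric polynomials in the x_i - 1 *)

Lemma eq_alt (S : comNzRingType) k (x y : 'I_k -> S) ps : x =1 y -> alt x ps = alt y ps.
Proof. by move=> xy; congr (\det _); apply/matrixP => j i; rewrite !mxE xy. Qed.

Lemma signr_inj (S : comNzRingType) (b : bool) (u v : S) :
  (-1) ^+ b * u = (-1) ^+ b * v -> u = v.
Proof. by move=> /(congr1 ( *%R ((-1) ^+ b))); rewrite !signrMK. Qed.

Lemma vdm_perm (S : comNzRingType) k (x : 'I_k -> S) (w : 'S_k) :
  vdm (x \o w) = (-1) ^+ w * vdm x.
Proof.
apply: (@signr_inj S (perm (@rev_ord_inj k))).
by rewrite -alt_monomials alt_perm alt_monomials mulrCA.
Qed.

Lemma sign_div (L : fieldType) (b : bool) (d v : L) : v != 0 ->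
  d * v / ((-1) ^+ b * v) = (-1) ^+ b * d.
Proof. by move=> v0; rewrite invfM invr_sign mulrACA divff // mulr1 mulrC. Qed.

Section SymmetricPolynomials.
Variables k n : nat.
Local Notation F := (ratfun k n).
Local Notation P := {mpoly int[k]}.
Local Notation xvar := (@xvar k n).
Local Notation ip S := (map_poly (intmul (1 : S))).

Definition at_shift (p : P) : F :=
  mmap (intmul 1 : {rmorphism int -> F}) (fun i => xvar i - 1) p.

Lemma at_shift_is_zmod_morphism : zmod_morphism at_shift.
Proof. by move=> p q; rewrite /at_shift mmapB. Qed.

Lemma at_shift_is_monoid_morphism : monoid_morphism at_shift.
Proof.
have [h1 h2] := mmap_is_multiplicative (fun i => xvar i - 1)
  (intmul 1 : {rmorphism int -> F}).
by split.
Qed.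

HB.instance Definition _ := GRing.isZmodMorphism.Build P F at_shift at_shift_is_zmod_morphism.
HB.instance Definition _ := GRing.isMonoidMorphism.Build P F at_shift at_shift_is_monoid_morphism.

Lemma at_shiftX i : at_shift 'X_i = xvar i - 1.
Proof. by rewrite /at_shift mmapX mmap1U. Qed.

Lemma coef_prod_linear (L : comNzRingType) (z : 'I_k -> L) j :
  (\prod_i (1 + 'X * (z i)%:P))`_j = \sum_(h : {set 'I_k} | #|h| == j) \prod_(i in h) z i.
Proof.
under eq_bigr do rewrite addrC.
rewrite bigA_distr coef_sum [RHS]big_mkcond /=; apply: eq_bigr => h _.
have -> : \prod_(i < k) (if i \in h then 'X * (z i)%:P else 1)
    = (\prod_(i in h) z i)%:P * 'X^#|h|.
  rewrite -big_mkcond big_split /= prodr_const mulrC; congr (_ * _).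
  by rewrite -rmorph_prod.
by rewrite coefCM coefXn eq_sym; case: eqP => _; rewrite ?mulr1 ?mulr0.
Qed.

Lemma at_shift_mesym j : at_shift (mesym k int j) = (eK k n)`_j.
Proof.
rewrite /eK coef_prod_linear rmorph_sum; apply: eq_bigr => h _.
rewrite rmorph_prod; apply: eq_bigr => i _.
exact: at_shiftX.
Qed.

(** By the fundamental theorem a symmetric polynomial is a polynomial in the elementary ones, which
    act by [acts_eK], and [acts] is closed under the ring operations. *)
Lemma acts_sym l q : size l = n -> q \is symmetric -> acts l (at_shift q).
Proof.
move=> sl qs; rewrite (symfP qs); move: (symf q) => t.
have -> : at_shift (t \mPo [tuple mesym k int i.+1 | i < k])
    = \sum_(m <- msupp t) (t@_m)%:~R * \prod_(i < k) (eK k n)`_i.+1 ^+ m i.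
  rewrite comp_mpolyE rmorph_sum; apply: eq_bigr => m _.
  rewrite -mul_mpolyC rmorphM /=; congr (_ * _).
    by rewrite /at_shift mmapC.
  rewrite rmorph_prod; apply: eq_bigr => i _.
  by rewrite rmorphXn tnth_mktuple /= at_shift_mesym.
apply: acts_sum => m; apply: actsM; first exact: acts_int.
by apply: acts_prod => i; apply: actsX; apply: acts_eK.
Qed.

(** The division is carried out among polynomials in z, with x_i = z_i + 1: the quotient of two
    alternating polynomials is symmetric. *)
Lemma gK_sym_poly s : exists2 q : P, q \is symmetric & gK k n s = at_shift q.
Proof.
pose x (i : 'I_k) : P := 'X_i + 1.
pose cs := map (ip P) (zcols s 0).
have [d dE] := alt_dvd x cs.
have ip_rmorph (S S' : comNzRingType) (f : {rmorphism S -> S'}) (ps : seq {poly int}) :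
    map (map_poly f) (map (ip S) ps) = map (ip S') ps.
  rewrite -map_comp; apply: eq_map => p /=.
  by rewrite -map_poly_comp; apply: eq_map_poly => z /=; rewrite rmorph_int.
have v0 : vdm x != 0.
  apply: vdm_neq0 => i j /addIr /(congr1 (mcoeff U_(i))) /eqP.
  by rewrite !mcoeffXU eqxx; case: (j =P i).
have d_sym : d \is symmetric.
  apply/issymP => w.
  have xw i : msym w (x i) = x (w i).
    by rewrite /x rmorphD rmorph1 /=; congr (_ + _); rewrite /msym mmapX mmap1U.
  have E : msym w (alt x cs) = (-1) ^+ w * alt x cs.
    by rewrite rmorph_alt -alt_perm /cs ip_rmorph; apply: eq_alt.
  have Ev : msym w (vdm x) = (-1) ^+ w * vdm x.
    rewrite -vdm_perm rmorph_prod; apply: eq_bigr => j _; rewrite rmorph_prod.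
    by apply: eq_bigr => i _; rewrite rmorphB /= !xw.
  have : (-1) ^+ w * (msym w d * vdm x) = (-1) ^+ w * (d * vdm x).
    by rewrite mulrCA -Ev -dE -E dE rmorphM.
  by move=> /signr_inj /(mulIf v0).
exists ((-1) ^+ vdm_sign k * d).
  by apply/issymP => w; rewrite rmorphM rmorph_sign /= (issymP _ d_sym).
have xE i : at_shift (x i) = xvar i by rewrite /x rmorphD rmorph1 /= at_shiftX subrK.
have -> : gK k n s = alt xvar (map (ip F) (zcols s 0)) / ((-1) ^+ vdm_sign k * vdm xvar).
  by rewrite /gK /ratio /Vand alt_unit_cols.
have -> : alt xvar (map (ip F) (zcols s 0)) = at_shift d * vdm xvar.
  have -> : vdm xvar = at_shift (vdm x).
    rewrite rmorph_prod; apply: eq_bigr => j _; rewrite rmorph_prod.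
    by apply: eq_bigr => i _; rewrite rmorphB /= !xE.
  rewrite -rmorphM -dE rmorph_alt /cs ip_rmorph.
  by apply: eq_alt => i; rewrite /= xE.
rewrite rmorphM rmorph_sign.
apply: sign_div; first exact: vdm_neq0 (@xvar_inj k n).
Qed.
End SymmetricPolynomials.

(** * The product rule for the g's *)

Lemma horner_factor1 (S : comNzRingType) (c : S) : (1 + 'X * (c - 1)%:P).[1] = c.
Proof. by rewrite hornerD hornerM hornerX !hornerC mul1r addrC subrK. Qed.

Section PuzzleProduct.
Variables k n : nat.
Hypotheses (kn : (k <= n)%N) (n_gt0 : (0 < n)%N).
Local Notation xvar := (@xvar k n).
Local Notation gF := (@gF k n).
Local Notation N := #|frames k n|.
Local Notation Lx := (\prod_(i < k) xvar i).

Definition pieri1_mx : 'M[int]_N := \matrix_(a, b) pw 1 false (frame a) (frame b).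

Lemma pieri1_act a : K_null (act_defect gF Lx pieri1_mx a).
Proof.
(* m bounds the degrees of all polynomials in u involved, so that every evaluation at u = 1 is a sum
   of coefficients over the same range. *)
pose m := maxn (size (eK k n))
  (\max_(b : 'I_N) size (pw 'X false (frame a) (frame b) : {poly int})).
have act j : K_null (act_defect gF (\sum_(i < j) (eK k n)`_i) (\sum_(i < j) pieri_mx k n i) a).
  elim: j => [|j IH].
    by rewrite !big_ord0 act_defect0; apply: K_null0.
  by rewrite !big_ord_recr act_defectD; apply: K_nullD => //; apply: pieri_act.
have eE : \sum_(i < m) (eK k n)`_i = Lx.
  have sm : (size (eK k n) <= m)%N by apply: leq_maxl.
  have := horner_coef_wide 1 sm; rewrite {1}/eK horner_prod.
  have -> : \prod_i (1 + 'X * (xvar i - 1)%:P).[1] = Lx.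
    by apply: eq_bigr => i _; apply: horner_factor1.
  by move=> ->; apply: eq_bigr => i _; rewrite expr1n mulr1.
have pE (b : 'I_N) : (\sum_(i < m) pieri_mx k n i) a b = pieri1_mx a b.
  have sm : (size (pw 'X false (frame a) (frame b) : {poly int}) <= m)%N.
    by rewrite /m leq_max; apply/orP; right; apply: leq_bigmax.
  rewrite summxE mxE.
  have -> : pw 1 false (frame a) (frame b) = (pw 'X false (frame a) (frame b)).[1] :> int.
    by rewrite -[RHS]/(horner_eval 1 _) rmorph_pw /= /horner_eval hornerX.
  rewrite (horner_coef_wide 1 sm); apply: eq_bigr => i _.
  by rewrite mxE expr1n mulr1.
have := act m; rewrite eE.
have -> : act_defect gF Lx (\sum_(i < m) pieri_mx k n i) a = act_defect gF Lx pieri1_mx a.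
  by rewrite /act_defect; congr (_ - _); apply: eq_bigr => b _; rewrite pE.
exact.
Qed.

Lemma puz_product a c :
  K_null (gF c * Lx * gF a - \sum_b (puz_bits int (frame a) (frame c) (frame b))%:~R * gF b).
Proof.
have [q qs qE] := gK_sym_poly k n (frame c).
have := acts_sym (size_frame a) qs; rewrite -qE => -[sc [M [MZ Mc]]].
have [u uE] : exists u, @frame k n u = nseq k true ++ nseq (n - k) false.
  apply: frame_ex; first by rewrite size_cat !size_nseq subnKC.
  by rewrite count_cat !count_nseq /= mul1n mul0n addn0.
have gu : gK k n (frame u) = 1 by rewrite uE gK_unit.
have Mu b : M u b = (b == c)%:R.
  apply/esym/eqP; rewrite -subr_eq0; apply/eqP.
  move: b; apply: (frame_independent n_gt0).
  by have := Mc u; rewrite -[gK k n (frame c)]/(gF c) act_defect_unit.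
have Zu t : puz_mx k n (frame a) u t = pieri1_mx a t.
  rewrite !mxE uE; have := @puz_bits_unit int (frame a) (frame t).
  by rewrite !size_frame count_frame; apply.
(* The commutation read in row u: row u of [puz_mx] is row a of [pieri1_mx], and row u of M selects
   row c of [puz_mx]. *)
have PM b : (pieri1_mx *m M) a b = puz_bits int (frame a) (frame c) (frame b).
  transitivity ((puz_mx k n (frame a) *m M) u b).
    by rewrite !mxE; apply: eq_bigr => t _; rewrite Zu.
  rewrite -MZ mxE (bigD1 c) //= big1 => [|t tc]; first by rewrite Mu eqxx mul1r addr0 mxE.
  by rewrite Mu (negPf tc) mul0r.
have H : K_null (act_defect gF (gF c * Lx) (pieri1_mx *m M) a).
  rewrite act_defectM; apply: K_nullD; first by apply: K_nullM => //; apply: pieri1_act.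
  by apply: K_null_sum => b _; apply: K_nullM; [apply: sym_laurent_int | apply: Mc].
have E : \sum_b ((pieri1_mx *m M) a b)%:~R * gF b
  = \sum_b (puz_bits int (frame a) (frame c) (frame b))%:~R * gF b.
  by apply: eq_bigr => b _; rewrite PM.
by rewrite /act_defect E in H.
Qed.

End PuzzleProduct.

(** * Signs and numbers of boxes *)

Lemma sum_ord_double k : ((\sum_(j < k) j).*2 + k = k * k)%N.
Proof.
elim: k => [|k IH]; first by rewrite big_ord0.
rewrite big_ord_recr /= doubleD mulnS mulSn -IH. by move: (\sum_(i < k) i)%N => s; lia.
Qed.

Section FrameSums.
Variable n : nat.
Implicit Types A : {set 'I_n}.

(** Off the diagonal, the ordered pairs from A split evenly into increasing and decreasing ones. *)
Lemma sum_pairs_double A :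
  ((\sum_(j in A) \sum_(i in A) (i < j)).*2 + #|A| = #|A| * #|A|)%N.
Proof.
have : (\sum_(j in A) (\sum_(i in A) (i < j) + \sum_(i in A) (j < i) + 1) = #|A| * #|A|)%N.
  rewrite -sum_nat_const; apply: eq_bigr => j jA.
  rewrite -big_split /= -[in RHS]sum1_card (bigD1 j jA) /= [in RHS](bigD1 j jA) /=.
  rewrite ltnn !add0n addnC; congr (_ + _)%N; apply: eq_bigr => i /andP[_ ij].
  by rewrite -val_eqE /= in ij; case: ltngtP ij.
rewrite !big_split /= sum1_card [in X in (_ + X + _)%N]exchange_big /= addnn.
exact.
Qed.

(** An up-step at zero-based position j has j steps before it: the right-steps among them count the
    boxes of its row, the up-steps add up to the triangular number. *)
Lemma num_boxes_sum A :
  (num_boxes A + \sum_(j < #|A|) j = \sum_(j in A) j)%N.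
Proof.
have -> : (\sum_(j < #|A|) j = \sum_(j in A) \sum_(i in A) (i < j))%N.
  by have := sum_ord_double #|A|; rewrite -sum_pairs_double => /addIn /double_inj.
have -> : num_boxes A = (\sum_(j in A) \sum_(i | i \notin A) (i < j))%N.
  rewrite /num_boxes -sum1dep_card.
  rewrite (eq_bigl (fun p => (xpredT p.1) && [&& p.1 \notin A, p.2 \in A & (p.1 < p.2)%N])) //.
  rewrite -(pair_big_dep xpredT (fun i j => [&& i \notin A, j \in A & (i < j)%N])
    (fun _ _ => 1%N)) /=.
  rewrite (exchange_big_dep xpredT) //= [RHS]big_mkcond; apply: eq_bigr => j _.
  case: ifPn => jA; last by rewrite big1 // => i; rewrite andbF.
  by rewrite big_mkcond [RHS]big_mkcond; apply: eq_bigr => i _; case: (i \in A); case: ltnP.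
rewrite -big_split /=; apply: eq_bigr => j _; rewrite addnC.
transitivity (\sum_(i < n) (i < j))%N; first by rewrite [RHS](bigID (mem A)).
rewrite -[RHS](card_ltn (ltnW (ltn_ord j))) -sum1dep_card [RHS]big_mkcond.
by apply: eq_bigr => i _; case: ltnP.
Qed.

Lemma sumn_positions A : sumn (positions (bits A) 0) = (\sum_(i in A) i)%N.
Proof.
rewrite /positions sumnE big_filter size_bits.
rewrite -val_enum_ord big_map big_enum_cond /= big_mkcond [RHS]big_mkcond; apply: eq_bigr => i _.
by rewrite subn0 nth_bits.
Qed.

Lemma sumn_positions_star A :
  (sumn (positions (bits (star A)) 0) + num_boxes A + \sum_(j < #|A|) j = #|A| * n.-1)%N.
Proof.
rewrite -addnA num_boxes_sum sumn_positions.
rewrite big_imset /=; last by move=> i j _ _; apply: rev_ord_inj.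
rewrite -big_split /= -sum_nat_const; apply: eq_bigr => i _.
by have := ltn_ord i; lia.
Qed.

End FrameSums.

Definition frame_sign k (t : seq bool) : int :=
  (-1) ^+ sumn (positions t 0) * (-1) ^+ (\sum_(j < k) j)%N.

Lemma frame_sign2 k t : frame_sign k t * frame_sign k t = 1.
Proof. by rewrite /frame_sign mulrACA -!expr2 -!exprM !(mulnC _ 2) !exprM !sqrrN !expr1n mulr1. Qed.

(** By [sumn_positions_star] the exponent of each [frame_sign] is congruent to the number of boxes
    plus k (n - 1) modulo 2, and k (n - 1) has the parity of k (n - k). *)
Lemma puzzle_sign k n (kn : (k <= n)%N) (n_gt0 : (0 < n)%N) (A B C : {set 'I_n}) :
  #|A| = k -> #|B| = k -> #|C| = k ->
  (-1) ^ ((num_boxes A)%:Z + (num_boxes B)%:Z - (num_boxes C)%:Z - (k * (n - k))%:Z)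
  = frame_sign k (bits (star A)) * frame_sign k (bits (star B))
    * frame_sign k (bits (star C)) :> int.
Proof.
move=> cA cB cC.
have := sumn_positions_star A; have := sumn_positions_star B; have := sumn_positions_star C.
rewrite cA cB cC /frame_sign; set c := (\sum_(j < k) j)%N.
move: (sumn _) (sumn _) (sumn _) (num_boxes A) (num_boxes B) (num_boxes C) => x y z a b d.
move=> Hz Hy Hx.
have e : (odd (k * n.-1) = odd (k * (n - k)))%N.
  rewrite !oddM oddB //; have -> : odd n.-1 = ~~ odd n by rewrite -{2}(prednK n_gt0) /= negbK.
  by case: (odd k); case: (odd n).
have sN (m : nat) : (-1) ^ (- m%:Z) = (-1) ^+ m :> int by rewrite -exprnN invr_sign.
rewrite !exprzDr ?unitrN1 // !sN -!exprnP -!exprD -signr_odd -[RHS]signr_odd; congr ((-1) ^+ _).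
move: e; rewrite -Hx; move: Hx Hy Hz => /(congr1 odd) Hx /(congr1 odd) Hy /(congr1 odd) Hz.
move=> e; rewrite oddD -e; move: Hy Hz; rewrite -Hx !oddD.
by case: (odd a); case: (odd b); case: (odd d); case: (odd x); case: (odd y);
  case: (odd z); case: (odd c).
Qed.

Section FrameSets.
Variable n : nat.

(** The inverse of [bits] after [star], since [gK] is indexed by the mirrored frame. *)
Definition frame_set (t : seq bool) : {set 'I_n} := [set j | nth false t (rev_ord j)].

Lemma frame_setK t : size t = n -> bits (star (frame_set t)) = t.
Proof.
move=> st; apply: (@eq_from_nth _ false); rewrite size_bits ?st // => i ni.
rewrite (nth_bits _ (Ordinal ni)) -[Ordinal ni]rev_ordK mem_imset; last exact: rev_ord_inj.
by rewrite inE rev_ordK.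
Qed.

Lemma bits_starK (A : {set 'I_n}) : frame_set (bits (star A)) = A.
Proof.
by apply/setP => j; rewrite inE nth_bits mem_imset //; apply: rev_ord_inj.
Qed.

Lemma count_bits_star (A : {set 'I_n}) : count id (bits (star A)) = #|A|.
Proof. by rewrite count_bits card_star. Qed.

Lemma sum_frame_set k (V : nmodType) (f : {set 'I_n} -> V) :
  \sum_(A : {set 'I_n} | #|A| == k) f A = \sum_(a < #|frames k n|) f (frame_set (frame a)).
Proof.
rewrite -(sum_frame k n (fun t => f (frame_set t))).
have ssz (A : {set 'I_n}) : size (bits (star A)) == n by rewrite size_bits.
rewrite (reindex (fun t : n.-tuple bool => frame_set t)) /=.
  by apply: eq_bigl => t; rewrite -count_bits_star frame_setK // size_tuple.
exists (fun A => Tuple (ssz A)) => [t _|A _]; last exact: bits_starK.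
by apply: val_inj; rewrite /= frame_setK // size_tuple.
Qed.

End FrameSets.

(** * The factor x_1 ... x_k and the structure constants of the dual polynomials *)

Section ProductOfVariables.
Variables k n : nat.
Local Notation R := {mpoly int[k + n]}.
Local Notation tofrac := (@FracField.tofrac R).
Local Notation xvar := (@xvar k n).
Local Notation yvar := (@yvar k n).
Local Notation Lx := (\prod_(i < k) xvar i).

Lemma prod_x_neq0 : Lx != 0.
Proof. by apply/prodf_neq0 => i _; apply: xvar_neq0. Qed.

Lemma prod_x_monomial : exists m : 'X_{1..k + n}, Lx = tofrac 'X_[m].
Proof.
exists (\sum_(i < k) U_(lshift n i))%MM.
by rewrite -mprodXE rmorph_prod.
Qed.

Lemma prod_x_value (s : 'S_k) : has_value (fun i => xvar (s i)) yvar Lx Lx.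
Proof.
rewrite [X in has_value _ _ _ X](reindex_inj (@perm_inj _ s)) /=.
by apply: has_value_prod => i _; apply: has_value_x.
Qed.

Lemma prod_x_sym : sym_laurent Lx.
Proof.
apply/sym_laurentP; split; last exact: prod_x_value.
by have [m ->] := prod_x_monomial; apply: is_laurent_poly.
Qed.

Lemma prod_x_inv_sym : sym_laurent Lx^-1.
Proof.
apply/sym_laurentP; split=> [|s].
  by have [m ->] := prod_x_monomial; exists 1, m; rewrite rmorph1 mul1r.
by apply: has_valueV; [exact: prod_x_neq0 | exact: prod_x_value].
Qed.

End ProductOfVariables.

Lemma scale_rearrange (A : comNzRingType) (c s : int) (L g : A) :
  c%:~R * (L * (s%:~R * g)) = L * ((c * s)%:~R * g).
Proof. by rewrite rmorphM mulrCA !mulrA. Qed.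

Lemma sum_coef_sub (A : comNzRingType) (I : finType) (P : pred I) (X : A)
    (c d : I -> int) (f : I -> A) :
  X - \sum_(i | P i) (d i)%:~R * f i - (X - \sum_(i | P i) (c i)%:~R * f i)
  = \sum_(i | P i) (c i - d i)%:~R * f i.
Proof.
rewrite opprB addrCA addrAC subrr add0r -sumrB.
by apply: eq_bigr => i _; rewrite rmorphB mulrBl.
Qed.

(** One of the two factors L stays outside, as in the expansion; the other goes into the product
    rule [puz_product]. *)
Lemma product_rearrange (A : comNzRingType) (I : finType) (P Q L g h : A) (p : I -> int)
    (s t : int) (f : I -> A) :
  P = L * (s%:~R * g) -> Q = L * (t%:~R * h) ->
  P * Q - L * (\sum_a (s * t * p a)%:~R * f a)
  = (L * (s * t)%:~R) * (h * L * g - \sum_a (p a)%:~R * f a).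
Proof.
move=> -> ->; rewrite mulrBr; congr (_ - _); first by rewrite rmorphM /=; ring.
rewrite -mulrA mulr_sumr; congr (_ * _); apply: eq_bigr => a _.
by rewrite !rmorphM /= !mulrA.
Qed.

Section Main.
Variables k n : nat.
Hypotheses (kn : (k <= n)%N) (n_gt0 : (0 < n)%N).
Local Notation xvar := (@xvar k n).
Local Notation gF := (@gF k n).
Local Notation Lx := (\prod_(i < k) xvar i).
Implicit Types A : {set 'I_n}.

Lemma dual_groth1_gK A : #|A| = k ->
  dual_groth1 k A = Lx * ((frame_sign k (bits (star A)))%:~R * gK k n (bits (star A))).
Proof. by move=> cA; rewrite dual_groth1E // rmorphM !rmorph_sign. Qed.

Lemma sum_dual_groth1 (c : {set 'I_n} -> int) :
  \sum_(A : {set 'I_n} | #|A| == k) (c A)%:~R * dual_groth1 k A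
  = Lx * \sum_(a < #|frames k n|) (c (frame_set n (frame a)) * frame_sign k (frame a))%:~R * gF a.
Proof.
rewrite (sum_frame_set k (fun A => (c A)%:~R * dual_groth1 k A)) mulr_sumr.
apply: eq_bigr => a _.
have E := frame_setK (size_frame a).
rewrite dual_groth1_gK; last by rewrite -count_bits_star E count_frame.
by rewrite E; apply: scale_rearrange.
Qed.

Lemma frame_set_ex A : #|A| = k -> exists a : 'I_#|frames k n|, frame a = bits (star A).
Proof. by move=> cA; apply: frame_ex; rewrite ?size_bits ?count_bits_star. Qed.

Definition puzzle_coef (l m v : {set 'I_n}) : int :=
  (-1) ^ ((num_boxes l)%:Z + (num_boxes m)%:Z - (num_boxes v)%:Z - (k * (n - k))%:Z)
  * #|puzzles l m v|%:Z.

Lemma puzzle_product (l m : {set 'I_n}) : #|l| = k -> #|m| = k ->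
  K_null (dual_groth1 k l * dual_groth1 k m
    - \sum_(v : {set 'I_n} | #|v| == k) (puzzle_coef l m v)%:~R * dual_groth1 k v).
Proof.
move=> cl cm; rewrite sum_dual_groth1.
have [a aE] := frame_set_ex cl; have [b bE] := frame_set_ex cm.
pose p c := puz_bits int (frame a) (frame b) (@frame k n c).
have coefE c : puzzle_coef l m (frame_set n (frame c)) * frame_sign k (@frame k n c)
   = frame_sign k (frame a) * frame_sign k (frame b) * p c.
  have E := frame_setK (size_frame c).
  have cv : #|frame_set n (frame c)| = k by rewrite -count_bits_star E count_frame.
  rewrite /puzzle_coef puzzle_sign // E -aE -bE.
  have -> : #|puzzles l m (frame_set n (frame c))|%:Z = p c.
    by rewrite -natz card_puzzles -!bits_star E -aE -bE.
  by rewrite mulrAC -(mulrA (frame_sign k (frame a) * frame_sign k (frame b))) frame_sign2 mulr1.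
have Es : \sum_c (puzzle_coef l m (frame_set n (frame c)) * frame_sign k (frame c))%:~R * gF c
    = \sum_c (frame_sign k (frame a) * frame_sign k (frame b) * p c)%:~R * gF c.
  by apply: eq_bigr => c _; rewrite coefE.
have El := dual_groth1_gK cl; have Em := dual_groth1_gK cm.
rewrite -aE in El; rewrite -bE in Em.
rewrite Es (product_rearrange p gF El Em); apply: K_nullM; last exact: puz_product.
by apply: sym_laurentM; [apply: prod_x_sym | apply: sym_laurent_int].
Qed.

(** The product of the x_i is invertible among symmetric Laurent polynomials, so it cancels and the
    g's remain. *)
Lemma dual_groth1_independent (d : {set 'I_n} -> int) :
  K_null (\sum_(v : {set 'I_n} | #|v| == k) (d v)%:~R * dual_groth1 k v) ->
  forall v : {set 'I_n}, #|v| = k -> d v = 0.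
Proof.
rewrite sum_dual_groth1 => /(K_nullM (prod_x_inv_sym k n)).
rewrite mulKf ?prod_x_neq0 // => /(frame_independent n_gt0) H v cv.
have [a aE] := frame_set_ex cv.
have := H a; rewrite aE bits_starK => /(congr1 (fun z => z * frame_sign k (frame a))).
by rewrite aE -mulrA frame_sign2 mulr1 mul0r.
Qed.

End Main.

Theorem theorem1 (k n : nat) (hkn : (k <= n)%N) (hn : (1 <= n)%N)
    (lambda mu : {set 'I_n}) (hlambda : #|lambda| = k) (hmu : #|mu| = k)
    (c : {set 'I_n} -> int) :
  K_eq (dual_groth1 k lambda * dual_groth1 k mu)
       (\sum_(nu : {set 'I_n} | #|nu| == k) (c nu)%:~R * dual_groth1 k nu)
  <->
  forall nu : {set 'I_n}, #|nu| = k ->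
    c nu = (-1) ^ ((num_boxes lambda)%:Z + (num_boxes mu)%:Z
                   - (num_boxes nu)%:Z - (k * (n - k))%:Z)
           * #|puzzles lambda mu nu|%:Z.
Proof.
have H := puzzle_product hkn hn hlambda hmu; split=> [Hc nu cnu | cE].
  (* Two expansions of the same product have a null difference, so independence makes their
     coefficients agree. *)
  apply/eqP; rewrite -subr_eq0; apply/eqP; move: nu cnu.
  apply: (dual_groth1_independent hkn hn (d := fun nu => c nu - puzzle_coef k lambda mu nu)).
  by have := K_nullB H Hc; rewrite sum_coef_sub.
have -> : \sum_(nu : {set 'I_n} | #|nu| == k) (c nu)%:~R * dual_groth1 k nu
  = \sum_(nu : {set 'I_n} | #|nu| == k) (puzzle_coef k lambda mu nu)%:~R * dual_groth1 k nu.
  by apply: eq_bigr => nu /eqP cnu; rewrite cE.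
exact: H.
Qed.
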